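(* Let $h\in\mathcal{L}$, $a\in\mathbb{C}\setminus\{0\}$, $\pi_a(z)=e^{az}$, $f\in\mathcal{L}_{a,h}$, and suppose that $h$ has a forward-invariant Fatou component $G$ on which $h$ has finite degree $d$. Also, let $g_h$ be an inner function dynamically associated to $h|_G$. Then exactly one of the following holds. (i) $0\in G$ and $U:=\pi_a^{-1}(G)$ is connected. In this case, $f|_U$ is univalent and hence has a dynamically associated inner function $g_f$ which is a conformal automorphism of the unit disc. (ii) $0\notin G$ and $\{U_k\}_{k\in\mathbb{Z}}$ are the connected components of $\pi_a^{-1}(G)$. Then $g_h$ is associated to $f|_{U_k}$ for all $k\in\mathbb{Z}$, and it is a finite Blaschke product of degree $d$.
   Context: $\mathbb{D}$ is the open unit disc and $\mathbb{C}^*=\mathbb{C}\setminus\{0\}$. For a transcendental entire function $f$, the Fatou set $F(f)$ is the set of points having a neighbourhood on which the iterates $\{f^n\}_n$ form a normal family; a Fatou component is a connected component of $F(f)$. A Fatou component $U$ is forward-invariant if $f(U)\subset U$. Degree: if $U,V$ are Fatou components of $f$ with $f(U)\subset V$, then $f|_U:U\to V$ has finite degree $d$ if it is proper of degree $d$ (every point of $V$ has exactly $d$ preimages in $U$, counting multiplicity); otherwise it has infinite degree. $\mathcal{L}$ is the set of all transcendental entire functions $h$ with $h(\mathbb{C}^* )\subset\mathbb{C}^*$; equivalently, $h(w)=w^m e^{H(w)}$ with $m\in\mathbb{N}\cup\{0\}$ and $H$ a non-constant entire function. For $h\in\mathcal{L}$ and $a\in\mathbb{C}^*$, $\mathcal{L}_{a,h}$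 is the set of all transcendental entire functions $f$ with $h\circ\pi_a=\pi_a\circ f$ in $\mathbb{C}$, where $\pi_a(z)=e^{az}$. Each connected component of $\pi_a^{-1}(G)$ is a Fatou component of $f$, and all Fatou components considered here are simply connected. When $0\notin G$, the components of $\pi_a^{-1}(G)$ are indexed by $\mathbb{Z}$ so that $U_{k+1}=U_k+\frac{2\pi i}{a}$. Inner functions: an inner function is a holomorphic self-map of $\mathbb{D}$ whose radial limits exist and lie on $\partial\mathbb{D}$ almost everywhere. A Riemann map is a conformal bijection. If $U,V$ are simply connected Fatou components of $f$ with $f(U)\subset V$, an inner function associated to $f|_U$ is any function $\psi^{-1}\circ f\circ\varphi:\mathbb{D}\to\mathbb{D}$, where $\varphi:\mathbb{D}\to U$ and $\psi:\mathbb{D}\to V$ are Riemann maps. If $U=V$ and $\psi=\varphi$, it is called dynamically associated to $f|_U$. A finite Blaschke product of degree $d$ is a function $B(z)=e^{i\theta}\prod_{n=1}^d\frac{|a_n|}{a_n}\frac{a_n-z}{1-\overline{a_n}z}$ with $\theta\in\mathbb{R}$, $a_n\in\mathbb{D}$ (the factor is interpreted as $z$ when $a_n=0$). *)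

(* Defs.v *)
(* MathComp-Analysis. *)
From HB Require Import structures.
From mathcomp Require Import all_boot all_order all_algebra.
From mathcomp Require Import complex.
From mathcomp Require Import all_classical all_reals all_analysis.
Set Implicit Arguments.
Unset Strict Implicit.
Unset Printing Implicit Defensive.
Import Order.TTheory GRing.Theory Num.Theory numFieldNormedType.Exports.
Local Open Scope classical_set_scope.
Local Open Scope complex_scope.
Local Open Scope ring_scope.

(* R[i] seen as an abstract numClosedFieldType, so that it carries the topology
   and the normed structure that MathComp-Analysis puts on every such field.
   Its norm is Cplx-valued (and real), its order is the partial order of R[i]. *)
Definition Cplx (R : realType) : numClosedFieldType := R[i].

Section Defs.
Variable R : realType.
Notation C := (Cplx R).

Definition expC (z : C) : C :=
  (expR (complex.Re z) * cos (complex.Im z)) +i*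
  (expR (complex.Re z) * sin (complex.Im z)).

Definition disc : set C := [set z | `|z| < 1].

(* Complex differentiability: the base field of the normed module C is C.
   Only used on open sets. *)
Definition holomorphic_on (A : set C) (f : C -> C) : Prop :=
  forall z, A z -> derivable f z 1.

Definition transcendental_entire (f : C -> C) : Prop :=
  holomorphic_on setT f /\ ~ exists p : {poly C}, forall z, f z = p.[z].

Definition univalent_on (A : set C) (f : C -> C) : Prop :=
  holomorphic_on A f /\ set_inj A f.

(* On an open set the inverse of such a map is automatically holomorphic.  With
   A = disc this is a Riemann map onto B, with A = B = disc a conformal
   automorphism of the disc. *)
Definition conformal_bij (A B : set C) (f : C -> C) : Prop :=
  holomorphic_on A f /\ set_bij A B f.

(* The Riemann sphere is option C, None being the point at infinity. *)
Definition chordal (p q : option C) : C :=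
  match p, q with
  | Some z, Some w =>
      2 * `|z - w| / (sqrtC (1 + `|z| ^+ 2) * sqrtC (1 + `|w| ^+ 2))
  | Some z, None | None, Some z => 2 / sqrtC (1 + `|z| ^+ 2)
  | None, None => 0
  end.

(* Normality in the sense of Montel: every sequence in the family has a
   subsequence converging, uniformly on the compact subsets of N and for the
   chordal metric, to a map into the sphere. *)
Definition normal_family (F : set (C -> C)) (N : set C) : Prop :=
  forall u : nat -> C -> C, (forall n, F (u n)) ->
  exists (s : nat -> nat) (g : C -> option C),
    {homo s : m n / (m < n)%N} /\
    forall K : set C, compact K -> K `<=` N ->
    forall e : C, 0 < e ->
    \forall n \near \oo, forall z, K z -> chordal (Some (u (s n) z)) (g z) < e.

Definition Fatou (f : C -> C) : set C :=
  [set z | exists N : set C,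
     open_nbhs z N /\ normal_family (range (fun n => iter n f)) N].

Definition component (A U : set C) : Prop :=
  exists2 z, A z & U = connected_component A z.

Definition Fatou_component (f : C -> C) (U : set C) : Prop :=
  component (Fatou f) U.

(* f takes the value f z at z with multiplicity k; k > 0 is forced by g z != 0. *)
Definition multiplicity (f : C -> C) (z : C) (k : nat) : Prop :=
  exists (g : C -> C) (N : set C),
    [/\ open_nbhs z N, holomorphic_on N g, g z != 0 &
        forall x, N x -> f x - f z = (x - z) ^+ k * g x].

Definition proper_on (U V : set C) (f : C -> C) : Prop :=
  forall K : set C, compact K -> K `<=` V -> compact (U `&` f @^-1` K).

Definition finite_degree (f : C -> C) (U V : set C) (d : nat) : Prop :=
  [/\ f @` U `<=` V, proper_on U V f &
      forall w, V w -> exists (s : seq C) (k : C -> nat),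
        [/\ uniq s,
            forall z, z \in s <-> U z /\ f z = w,
            forall z, z \in s -> multiplicity f z (k z) &
            (\sum_(z <- s) k z)%N = d]].

Definition class_L (h : C -> C) : Prop :=
  transcendental_entire h /\ forall w, w != 0 -> h w != 0.

Definition pi_map (a z : C) : C := expC (a * z).

Definition class_La (a : C) (h f : C -> C) : Prop :=
  transcendental_entire f /\ h \o pi_map a =1 pi_map a \o f.

(* Points of the unit circle are parametrised by their argument. *)
Definition inner_function (g : C -> C) : Prop :=
  [/\ holomorphic_on disc g, g @` disc `<=` disc &
      {ae (@lebesgue_measure R), forall t : R, exists2 l : C, `|l| = 1 &
         g ((r%:C : C) * expC (t *i)) @[r --> (1 : R)^'-] --> l}].

(* g is the inner function psi^-1 \o f \o phi associated to f : U -> V.  That U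
   and V are components of the Fatou set of f is not part of the predicate; that
   they are simply connected follows from the existence of phi and psi. *)
Definition associated_inner (f : C -> C) (U V : set C) (g : C -> C) : Prop :=
  [/\ inner_function g, f @` U `<=` V &
      exists phi psi : C -> C,
        [/\ conformal_bij disc U phi, conformal_bij disc V psi &
            forall z, disc z -> psi (g z) = f (phi z)]].

Definition dyn_associated_inner (f : C -> C) (U : set C) (g : C -> C) : Prop :=
  [/\ inner_function g, f @` U `<=` U &
      exists2 phi : C -> C, conformal_bij disc U phi &
        forall z, disc z -> phi (g z) = f (phi z)].

Definition Blaschke_factor (b z : C) : C :=
  if b == 0 then z else `|b| / b * ((b - z) / (1 - b^* * z)).

(* Functions on the disc are represented by total functions on C, whose values
   outside the disc are irrelevant. *)
Definition finite_Blaschke (d : nat) (g : C -> C) : Prop :=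
  exists (t : R) (b : 'I_d -> C), (forall n, disc (b n)) /\
    forall z, disc z -> g z = expC (t *i) * \prod_(n < d) Blaschke_factor (b n) z.

(* U lists the components of the preimage of G under pi_map a, each one once,
   consecutive ones differing by the period 2 pi i / a. *)
Definition component_indexing (a : C) (G : set C) (U : int -> set C) : Prop :=
  [/\ injective U,
      forall A : set C, component (pi_map a @^-1` G) A <-> exists k, A = U k &
      forall k : int,
        U (k + 1) = [set z + ((pi *+ 2) *i : C) / a | z in U k]].

End Defs.

(* Main.v *)
Require Import Defs.
From HB Require Import structures.
From mathcomp Require Import all_boot all_order all_algebra.
From mathcomp Require Import complex.
From mathcomp Require Import all_classical all_reals all_analysis.
From mathcomp Require Import ring lra.
Set Implicit Arguments.
Unset Strict Implicit.
Unset Printing Implicit Defensive.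
Import Order.TTheory GRing.Theory Num.Theory numFieldNormedType.Exports.
Local Open Scope classical_set_scope.
Local Open Scope ring_scope.

(** Everything is read in the Riemann coordinate phi : D -> G, in which
    phi o g_h = h o phi.

    Since h is proper on G, |g_h| tends to 1 at the unit circle, and the
    preimages of phi 0 under h, counted with multiplicity, become d zeros of g_h.
    Let B be the Blaschke product with these zeros.  Then g_h / B has no zeros,
    and the maximum principle bounds both it and its inverse by 1, so that it is
    a constant of modulus 1 and g_h is a finite Blaschke product of degree d
    ([finite_degree_blaschke]).

    If 0 is not in G, then phi has a holomorphic logarithm L on the disc, and the
    components of the preimage of G under z |-> e^(a z) are the images of the
    univalent maps phi_k = (L + 2 pi i k) / a.  Both a (f o phi_k) and L o g_h are
    logarithms of h o phi = phi o g_h, so they differ by a constant period; that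
    is, f o phi_k = phi_j o g_h for some j, and g_h itself is associated to f on
    the k-th component ([case_avoiding]).

    If 0 is in G, a Moebius change of coordinate makes phi 0 = 0.  As h has no
    zeros outside 0, the Blaschke product then vanishes only at 0: it is c z^d.
    Write phi z = z e^(Q z).  The map Phi s = (s + Q (e^s)) / a takes the left
    half-plane univalently onto the preimage of G, which is therefore connected,
    and e^(a Phi s) = phi (e^s); comparing logarithms again gives
    f o Phi = Phi o T with T s = d s + i c, c real.  As T is an automorphism of the half-plane, f is
    univalent, and the Cayley transform of T is g_f ([case_containing]).

    The function theory behind this rests on integrals along segments, which give
    Goursat's lemma and hence primitives on discs and half-planes ([primitive]).
    A primitive P of s |-> f (w + e^s) satisfies P (s + 2 pi i) - P s = 2 pi i f w, also when f is
    merely continuous at w; this is the mean value property on circles, and the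
    mean value theorem of real calculus turns it into a maximum principle that
    tolerates finitely many exceptional points ([max_principle]).  Applied to
    difference quotients, that principle shows that these converge at an
    exceptional point ([removable]).  Division by x - w, holomorphy of the
    derivative, finiteness of the order of zeros, the open mapping property and
    the non-vanishing of the derivative of a univalent map all follow from it. *)

(** * Modulus, limits and complex derivatives *)

Section RealModulus.
Variable R : realType.
Notation C := (Cplx R).
Implicit Types (z w : C).

Definition re z : R := complex.Re z.
Definition im z : R := complex.Im z.
Definition cart x y : C := Complex x y.
Definition rc x : C := cart x 0.
Definition ii : C := cart 0 1.
Definition cj z : C := cart (re z) (- im z).
(** The real-valued modulus; the norm of [Cplx R] takes its values in [Cplx R]
    itself. *)
Definition cmod z : R := Num.sqrt (re z ^+ 2 + im z ^+ 2).

Lemma complex_ext z w : re z = re w -> im z = im w -> z = w.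
Proof. by case: z w => [a b] [c d]; rewrite /re /im /= => -> ->. Qed.

Lemma re_cart x y : re (cart x y) = x. Proof. by []. Qed.
Lemma im_cart x y : im (cart x y) = y. Proof. by []. Qed.
Lemma re_rc x : re (rc x) = x. Proof. by []. Qed.
Lemma im_rc x : im (rc x) = 0. Proof. by []. Qed.
Lemma re_ii : re ii = 0. Proof. by []. Qed.
Lemma im_ii : im ii = 1. Proof. by []. Qed.
Lemma re_cj z : re (cj z) = re z. Proof. by []. Qed.
Lemma im_cj z : im (cj z) = - im z. Proof. by []. Qed.
Lemma reD z w : re (z + w) = re z + re w. Proof. by case: z w => [? ?] []. Qed.
Lemma imD z w : im (z + w) = im z + im w. Proof. by case: z w => [? ?] []. Qed.
Lemma reN z : re (- z) = - re z. Proof. by case: z. Qed.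
Lemma imN z : im (- z) = - im z. Proof. by case: z. Qed.
Lemma reM z w : re (z * w) = re z * re w - im z * im w.
Proof. by case: z w => [? ?] []. Qed.
Lemma imM z w : im (z * w) = re z * im w + im z * re w.
Proof. by case: z w => [? ?] []. Qed.
Lemma re0 : re 0 = 0. Proof. by []. Qed.
Lemma im0 : im 0 = 0. Proof. by []. Qed.
Lemma re1 : re 1 = 1. Proof. by []. Qed.
Lemma im1 : im 1 = 0. Proof. by []. Qed.

Definition rimE := (reD, imD, reN, imN, reM, imM, re_cart, im_cart, re_rc, im_rc,
  re_ii, im_ii, re_cj, im_cj, re0, im0, re1, im1).

Lemma rcD x y : rc (x + y) = rc x + rc y.
Proof. by apply: complex_ext; rewrite !rimE ?addr0. Qed.
Lemma rcN x : rc (- x) = - rc x.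
Proof. by apply: complex_ext; rewrite !rimE ?oppr0. Qed.
Lemma rcB x y : rc (x - y) = rc x - rc y.
Proof. by rewrite rcD rcN. Qed.
Lemma rcM x y : rc (x * y) = rc x * rc y.
Proof. by apply: complex_ext; rewrite !rimE; ring. Qed.
Lemma rc0 : rc 0 = 0. Proof. by []. Qed.
Lemma rc1 : rc 1 = 1. Proof. by []. Qed.
Lemma rc_inj : injective rc. Proof. by move=> x y []. Qed.
Lemma rc_eq0 x : (rc x == 0) = (x == 0).
Proof. by apply/eqP/eqP => [[]|->]. Qed.
Lemma rcV x : rc x^-1 = (rc x)^-1.
Proof.
have [->|x0] := eqVneq x 0; first by rewrite invr0 rc0 invr0.
apply: (@mulfI _ (rc x)); first by rewrite rc_eq0.
by rewrite -rcM !divff ?rc_eq0.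
Qed.
Lemma rc_nat n : rc n%:R = n%:R.
Proof. by elim: n => // n IH; rewrite -natr1 rcD IH natr1. Qed.
Lemma cartE x y : cart x y = rc x + ii * rc y.
Proof. by apply: complex_ext; rewrite !rimE; ring. Qed.
Lemma ii2 : ii * ii = -1.
Proof. by apply: complex_ext; rewrite !rimE; ring. Qed.
Lemma ii_neq0 : ii != 0.
Proof. by apply/eqP => -[/eqP]; rewrite oner_eq0. Qed.

Lemma cmodE z : `|z| = rc (cmod z). Proof. by case: z. Qed.
Lemma cmod_ge0 z : 0 <= cmod z. Proof. exact: sqrtr_ge0. Qed.
Lemma cmod_sqr z : cmod z ^+ 2 = re z ^+ 2 + im z ^+ 2.
Proof. by rewrite sqr_sqrtr// addr_ge0// sqr_ge0. Qed.
Lemma cmod0 : cmod 0 = 0.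
Proof. by apply: rc_inj; rewrite -cmodE normr0. Qed.
Lemma cmod1 : cmod 1 = 1.
Proof. by apply: rc_inj; rewrite -cmodE normr1. Qed.
Lemma cmod_eq0 z : (cmod z == 0) = (z == 0).
Proof. by rewrite -rc_eq0 -cmodE normr_eq0. Qed.
Lemma cmod_gt0 z : (0 < cmod z) = (z != 0).
Proof. by rewrite lt_def cmod_eq0 cmod_ge0 andbT. Qed.
Lemma cmodM z w : cmod (z * w) = cmod z * cmod w.
Proof. by apply: rc_inj; rewrite rcM -!cmodE normrM. Qed.
Lemma cmodN z : cmod (- z) = cmod z.
Proof. by apply: rc_inj; rewrite -!cmodE normrN. Qed.
Lemma cmodB z w : cmod (z - w) = cmod (w - z).
Proof. by rewrite -cmodN opprB. Qed.
Lemma cmodV z : cmod z^-1 = (cmod z)^-1.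
Proof. by apply: rc_inj; rewrite rcV -!cmodE normfV. Qed.
Lemma cmodX z n : cmod (z ^+ n) = cmod z ^+ n.
Proof. by elim: n => [|n IH]; rewrite ?expr0 ?cmod1// !exprS cmodM IH. Qed.
Lemma ler_rc x y : (rc x <= rc y) = (x <= y).
Proof. exact: lecR. Qed.
Lemma ltr_rc x y : (rc x < rc y) = (x < y).
Proof. exact: ltcR. Qed.
Lemma cmodD z w : cmod (z + w) <= cmod z + cmod w.
Proof. by rewrite -ler_rc rcD -!cmodE ler_normD. Qed.
Lemma cmod_tri w z v : cmod (z - v) <= cmod (z - w) + cmod (w - v).
Proof. by rewrite (le_trans _ (cmodD _ _))// addrA subrK. Qed.
Lemma cmod_lB z w : cmod z - cmod w <= cmod (z - w).
Proof. by rewrite lerBlDr (le_trans _ (cmodD _ _))// subrK. Qed.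
Lemma cmod_rc x : cmod (rc x) = `|x|.
Proof. by rewrite /cmod !rimE expr0n addr0 sqrtr_sqr. Qed.
Lemma cmod_ii : cmod ii = 1.
Proof. by rewrite /cmod !rimE expr0n add0r expr1n sqrtr1. Qed.
Lemma cmod_cj z : cmod (cj z) = cmod z.
Proof. by rewrite /cmod !rimE sqrrN. Qed.
Lemma cjM z : z * cj z = rc (cmod z ^+ 2).
Proof. by rewrite cmod_sqr; apply: complex_ext; rewrite !rimE; ring. Qed.
Lemma re_le_cmod z : `|re z| <= cmod z.
Proof. by rewrite -sqrtr_sqr /cmod ler_wsqrtr// lerDl sqr_ge0. Qed.
Lemma im_le_cmod z : `|im z| <= cmod z.
Proof. by rewrite -sqrtr_sqr /cmod ler_wsqrtr// lerDr sqr_ge0. Qed.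
Lemma cmod_le_re_im z : cmod z <= `|re z| + `|im z|.
Proof.
rewrite [X in cmod X](_ : z = rc (re z) + ii * rc (im z)); last first.
  by rewrite -cartE; case: (z).
by rewrite (le_trans (cmodD _ _))// cmodM !cmod_rc cmod_ii mul1r.
Qed.
Lemma re_cmod z : re z <= cmod z.
Proof. exact: le_trans (ler_norm _) (re_le_cmod z). Qed.

(** Multiplication by the conjugate direction of z makes its modulus a real
    part. This reduces estimates of complex increments to the mean value
    theorem for real functions. *)
Lemma unit_dir z : exists2 c : C, cmod c <= 1 & re (c * z) = cmod z.
Proof.
have [->|z0] := eqVneq z 0; first by exists 0; rewrite ?mul0r cmod0.
have nz : cmod z != 0 by rewrite cmod_eq0.
exists (cj z * rc (cmod z)^-1).
  by rewrite cmodM cmod_cj cmod_rc ger0_norm ?invr_ge0 ?cmod_ge0// divff.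
by rewrite mulrAC [cj z * z]mulrC cjM -rcM re_rc expr2 mulfK.
Qed.

Lemma discP z : disc z <-> cmod z < 1.
Proof. by rewrite /disc /= cmodE -rc1 ltr_rc. Qed.

(** Radii of balls in [Cplx R] are complex numbers that happen to be positive;
    only the real ones matter. *)
Lemma nbhs_cmodP (z : C) (P : set C) :
  nbhs z P <-> exists2 d : R, 0 < d & forall w, cmod (w - z) < d -> P w.
Proof.
split=> [/nbhs_ballP[e /= e0 eP]|[d d0 dP]].
  have eE : e = rc (re e).
    by move: e0; rewrite ltcE /= => /andP[/eqP h _]; apply: complex_ext; rewrite ?rimE.
  exists (re e) => [|w wz]; first by rewrite -ltr_rc -eE.
  by apply: eP; rewrite /ball /= distrC cmodE eE ltr_rc.
apply/nbhs_ballP; exists (rc d) => /=; first by rewrite -rc0 ltr_rc.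
by move=> w; rewrite /ball /= distrC cmodE ltr_rc => /dP.
Qed.

Definition ctn (f : C -> C) z := forall e : R, 0 < e ->
  exists2 d : R, 0 < d & forall w, cmod (w - z) < d -> cmod (f w - f z) < e.

Lemma ctnP (f : C -> C) z : ctn f z <-> {for z, continuous f}.
Proof.
split=> [cf P|cf e e0].
  move=> /nbhs_cmodP[e e0 eP]; have [d d0 dP] := cf _ e0.
  by apply/nbhs_cmodP; exists d => // w /dP /eP.
have : nbhs (f z) [set w | cmod (w - f z) < e] by apply/nbhs_cmodP; exists e.
by move/cf => /nbhs_cmodP.
Qed.

Definition cderiv (f : C -> C) z (l : C) := is_derive z (1 : C) f l.

Lemma derivable_cderiv (f : C -> C) z : derivable f z 1 <-> exists l, cderiv f z l.
Proof.
split=> [df|[l []//]]; by exists (derive f z 1).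
Qed.

Lemma cderivP (f : C -> C) z l : cderiv f z l <-> forall e : R, 0 < e ->
  exists2 d : R, 0 < d & forall w, cmod (w - z) < d ->
    cmod (f w - f z - l * (w - z)) <= e * cmod (w - z).
Proof.
split=> [[df fl] e e0|H].
  have /cvgrPdist_le : (fun h : C => h^-1 *: ((f \o shift z) (h *: 1) - f z))
      @ 0^' --> l by rewrite -fl; exact: df.
  move=> /(_ (rc e)); rewrite -rc0 ltr_rc => /(_ e0).
  rewrite /prop_near1 /dnbhs /within /=  => /nbhs_cmodP[d d0 dP].
  exists d => // w wz; have [->|wz0] := eqVneq w z.
    by rewrite !subrr mulr0 subrr cmod0 mulr0.
  have wz1 : w - z != 0 by rewrite subr_eq0.
  have := dP (w - z); rewrite subr0 wz wz1 => /(_ erefl erefl) /=.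
  rewrite cmodE ler_rc -[_ *: 1]/(_ * 1) mulr1 subrK.
  rewrite -[_ *: _]/(_ * _) => h.
  have -> : f w - f z - l * (w - z) = - (l - (w - z)^-1 * (f w - f z)) * (w - z).
    by field.
  by rewrite cmodM cmodN ler_wpM2r// cmod_ge0.
have cv : (fun h : C => h^-1 *: ((f \o shift z) (h *: 1) - f z)) @ 0^' --> l.
  apply/cvgrPdist_le => e e0.
  have eE : e = rc (re e).
    by move: e0; rewrite ltcE /= => /andP[/eqP h _]; apply: complex_ext; rewrite ?rimE.
  have re0 : 0 < re e by rewrite -ltr_rc -eE.
  have [d d0 dP] := H _ re0.
  apply/nbhs_cmodP; exists d => // h; rewrite subr0 /= => hd h0.
  rewrite cmodE eE ler_rc -[_ *: 1]/(_ * 1) mulr1 -[_ *: _]/(_ * _).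
  have := dP (h + z); rewrite addrK => /(_ hd).
  rewrite -[X in X <= _ -> _]cmodN.
  rewrite [X in cmod X <= _](_ : _ = (l - h^-1 * (f (h + z) - f z)) * h); last by field.
  by rewrite cmodM ler_pM2r ?cmod_gt0.
by split; [apply/cvg_ex; exists l | exact: cvg_lim cv].
Qed.

Lemma cderiv_uniq (f : C -> C) z l l' : cderiv f z l -> cderiv f z l' -> l = l'.
Proof. by move=> [_ <-] [_ <-]. Qed.

Lemma cderiv_near (f g : C -> C) z l : (exists2 d : R, 0 < d &
  forall w, cmod (w - z) < d -> f w = g w) -> cderiv f z l -> cderiv g z l.
Proof. by move=> fg; apply: near_eq_is_derive; apply/nbhs_cmodP. Qed.

Lemma cderiv_ext (f g : C -> C) z l : f =1 g -> cderiv f z l -> cderiv g z l.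
Proof. by move=> fg; apply: cderiv_near; exists 1. Qed.

Lemma cderiv_eq (f : C -> C) z l l' : cderiv f z l -> l = l' -> cderiv f z l'.
Proof. by move=> ? <-. Qed.

Lemma cderiv_ctn (f : C -> C) z l : cderiv f z l -> ctn f z.
Proof.
move=> [df _]; apply/ctnP; apply: differentiable_continuous.
exact/derivable1_diffP.
Qed.

Lemma cderiv_cst (k : C) z : cderiv (fun=> k) z 0.
Proof. exact: is_derive_cst. Qed.

Lemma cderiv_id z : cderiv id z 1.
Proof. exact: is_derive_id. Qed.

Lemma cderivD (f g : C -> C) z l m : cderiv f z l -> cderiv g z m ->
  cderiv (fun x => f x + g x) z (l + m).
Proof. exact: is_deriveD. Qed.

Lemma cderivN (f : C -> C) z l : cderiv f z l -> cderiv (fun x => - f x) z (- l).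
Proof. exact: is_deriveN. Qed.

Lemma cderivB (f g : C -> C) z l m : cderiv f z l -> cderiv g z m ->
  cderiv (fun x => f x - g x) z (l - m).
Proof. exact: is_deriveB. Qed.

Lemma cderivM (f g : C -> C) z l m : cderiv f z l -> cderiv g z m ->
  cderiv (fun x => f x * g x) z (l * g z + f z * m).
Proof.
move=> df dg; apply: cderiv_eq (@is_deriveM _ _ _ _ _ _ _ _ df dg) _.
by rewrite /= addrC -![_ *: _]/(_ * _) [g z * _]mulrC.
Qed.

Lemma cderivMl (k : C) (f : C -> C) z l : cderiv f z l -> cderiv (fun x => k * f x) z (k * l).
Proof. by move=> /(cderivM (cderiv_cst k z)) /cderiv_eq; apply; rewrite mul0r add0r. Qed.

Lemma cderivV (f : C -> C) z l : f z != 0 -> cderiv f z l ->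
  cderiv (fun x => (f x)^-1) z (- (l / f z ^+ 2)).
Proof.
move=> f0 [df fl]; split; first exact: derivableV.
by rewrite deriveV// fl -[_ *: _]/(_ * _) mulNr mulrC.
Qed.

Lemma cderivX (f : C -> C) n z l : cderiv f z l ->
  cderiv (fun x => f x ^+ n) z (n%:R * f z ^+ n.-1 * l).
Proof.
move=> df; apply: cderiv_ext (@is_deriveX _ _ f n z 1 l df).
by move=> x; elim: n => //= n IH; rewrite !exprS -IH.
Qed.

Lemma cderiv_comp (f g : C -> C) z l m : cderiv f z l -> cderiv g (f z) m ->
  cderiv (fun x => g (f x)) z (m * l).
Proof.
move=> df /cderivP dg; have cf := cderiv_ctn df; move/cderivP: df => df.
apply/cderivP => e e0.
set K := cmod l + 1; have K0 : 0 < K by rewrite ltr_wpDl// cmod_ge0.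
set M := cmod m + 1; have M0 : 0 < M by rewrite ltr_wpDl// cmod_ge0.
have [d1 d10 d1P] := dg (e / 2 / K) (divr_gt0 (divr_gt0 e0 (ltr0Sn _ 1)) K0).
have [d2 d20 d2P] := cf d1 d10.
have [d3 d30 d3P] := df 1 ltr01.
have [d4 d40 d4P] := df (e / 2 / M) (divr_gt0 (divr_gt0 e0 (ltr0Sn _ 1)) M0).
exists (Num.min d2 (Num.min d3 d4)).
  by rewrite !lt_min d20 d30.
move=> w; rewrite !lt_min => /and3P[/d2P h2 /d3P h3 /d4P h4].
have {}h2 := d1P _ h2.
have h5 : cmod (f w - f z) <= K * cmod (w - z).
  rewrite [f w - f z](_ : _ = (f w - f z - l * (w - z)) + l * (w - z)); last by ring.
  rewrite (le_trans (cmodD _ _))// cmodM mulrDl mul1r addrC lerD2l.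
  by rewrite mul1r in h3.
rewrite [_ - _ - _](_ : _ = (g (f w) - g (f z) - m * (f w - f z)) +
   m * (f w - f z - l * (w - z))); last by ring.
rewrite (le_trans (cmodD _ _))// cmodM [e]splitr mulrDl lerD//.
  rewrite (le_trans h2)// -mulrA ler_pM2l ?divr_gt0//.
  by rewrite -[leRHS](mulKf (lt0r_neq0 K0)) ler_pM2l ?invr_gt0.
have mM : cmod m <= M by rewrite lerDl.
rewrite (le_trans (ler_pM (cmod_ge0 _) (cmod_ge0 _) mM h4))//.
by rewrite mulrA [M * _]mulrC divfK ?lt0r_neq0.
Qed.

Lemma cderiv_div (f g : C -> C) z l m : g z != 0 -> cderiv f z l -> cderiv g z m ->
  cderiv (fun x => f x / g x) z ((l * g z - f z * m) / g z ^+ 2).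
Proof.
move=> g0 df dg; apply: cderiv_eq (cderivM df (cderivV g0 dg)) _.
by field.
Qed.

Definition copen (A : set C) := forall z, A z ->
  exists2 r : R, 0 < r & forall w, cmod (w - z) < r -> A w.

Lemma copenP (A : set C) : copen A <-> open A.
Proof.
rewrite openE /interior; split=> H z /H /nbhs_cmodP; first by [].
by case=> d d0 dP; exists d.
Qed.

End RealModulus.

(** * Compact discs and functions of a real variable *)

Section CompactExp.
Variable R : realType.
Notation C := (Cplx R).
Implicit Types (z w : C).

(** The disc is a closed part of the image of a square under the continuous map
    [cart]. *)
Lemma closed_disc_compact z (r : R) : compact [set w : C | cmod (w - z) <= r].
Proof.
pose B := `[re z - r, re z + r] `*` `[im z - r, im z + r].
have cB : compact (B : set (R * R)).
  by apply: compact_setX; exact: segment_compact.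
pose k (p : R * R) : C := cart p.1 p.2.
have ck : continuous k.
  move=> p P /nbhs_cmodP[d d0 dP].
  exists (ball p.1 (d / 2), ball p.2 (d / 2)).
    by split; apply: nbhsx_ballx; rewrite divr_gt0.
  move=> q [/= h1 h2]; apply: dP; apply: le_lt_trans (cmod_le_re_im _) _.
  rewrite reD imD reN imN (splitr d) ltrD// distrC; [exact: h1|exact: h2].
apply: (@subclosed_compact _ _ (k @` B)).
- rewrite -[X in closed X]setCK; apply: open_closedC; apply/copenP => x /= /negP.
  rewrite -ltNge => xr; exists (cmod (x - z) - r); first by rewrite subr_gt0.
  move=> w wx; apply/negP; rewrite -ltNge.
  have := cmod_tri w x z; rewrite [cmod (x - w)]cmodB; lra.
- by apply: continuous_compact => //; apply: continuous_subspaceT.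
- move=> w /= wr; exists (re w, im w); last by case: (w).
  have := le_trans (re_le_cmod (w - z)) wr; have := le_trans (im_le_cmod (w - z)) wr.
  rewrite !rimE !ler_norml => h1 h2.
  by split; rewrite /= in_itv /=; lra.
Qed.

Lemma circle_compact z (r : R) : compact [set w : C | cmod (w - z) = r].
Proof.
apply: subclosed_compact (closed_disc_compact (z := z) (r := r)) _ => [|w /= ->//].
rewrite -[X in closed X]setCK; apply: open_closedC; apply/copenP => x /= xr.
exists `|cmod (x - z) - r|; first by rewrite normr_gt0 subr_eq0; apply/eqP.
move=> w wx wr; have := cmod_lB (x - z) (w - z).
have := cmod_lB (w - z) (x - z).
rewrite (_ : w - z - _ = w - x); last by ring.
rewrite (_ : x - z - _ = x - w); last by ring.
rewrite wr [cmod (x - w)]cmodB => h1 h2.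
by move: wx; rewrite ltNge ler_norml => /negP; apply; lra.
Qed.

Lemma compact_max (K : set C) (f : C -> R) : K !=set0 -> compact K ->
  (forall z, K z -> forall e : R, 0 < e -> exists2 d : R, 0 < d &
     forall w, cmod (w - z) < d -> `|f w - f z| < e) ->
  exists2 z, K z & forall w, K w -> f w <= f z.
Proof.
move=> K0 cK cf.
have /(compact_EVT_max K0 cK)[c] : {within K, continuous f}.
  apply: continuous_in_subspaceT => z; rewrite inE => /cf {}cf P.
  move=> /nbhs_ballP[e /= e0 eP]; have [d d0 dP] := cf _ e0.
  by apply/nbhs_cmodP; exists d => // w /dP h; apply: eP; rewrite /ball /= distrC.
by rewrite inE => Kc cmax; exists c => // w Kw; apply: cmax; rewrite inE.
Qed.

Lemma cmod_ctn (f : C -> C) z (e : R) : ctn f z -> 0 < e ->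
  exists2 d : R, 0 < d & forall w, cmod (w - z) < d -> `|cmod (f w) - cmod (f z)| < e.
Proof.
move=> cf /cf[d d0 dP]; exists d => // w /dP h.
have := cmod_lB (f w) (f z); have := cmod_lB (f z) (f w); rewrite [X in _ <= X -> _]cmodB.
by rewrite ltr_norml => h1 h2; lra.
Qed.

Lemma sup_cmod (K : set C) (f : C -> C) : K !=set0 -> compact K ->
  (forall z, K z -> ctn f z) ->
  exists2 z, K z & forall w, K w -> cmod (f w) <= cmod (f z).
Proof.
move=> K0 cK cf; apply: compact_max => // z /cf h e e0; exact: cmod_ctn.
Qed.

Lemma inf_cmod (K : set C) (f : C -> C) : K !=set0 -> compact K ->
  (forall z, K z -> ctn f z) ->
  exists2 z, K z & forall w, K w -> cmod (f z) <= cmod (f w).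
Proof.
move=> K0 cK cf; have [|z Kz zP] := @compact_max K (fun z => - cmod (f z)) K0 cK.
  move=> z /cf h e e0; have [d d0 dP] := cmod_ctn h e0; exists d => // w /dP.
  by rewrite -opprD normrN.
by exists z => // w /zP; rewrite lerN2.
Qed.

Lemma real_derivP (f : R -> R) (x l : R) : is_derive x (1 : R) f l <->
  forall e : R, 0 < e -> exists2 d : R, 0 < d & forall y, `|y - x| < d ->
    `|f y - f x - l * (y - x)| <= e * `|y - x|.
Proof.
split=> [[df fl] e e0|H].
  have /cvgrPdist_le : (fun h : R => h^-1 *: ((f \o shift x) (h *: 1) - f x))
      @ 0^' --> l by rewrite -fl; exact: df.
  move=> /(_ e e0).
  rewrite /prop_near1 /dnbhs /within /= => /nbhs_ballP[d /= d0 dP].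
  exists d => // w wz; have [->|wz0] := eqVneq w x.
    by rewrite !subrr mulr0 subrr normr0 mulr0.
  have wz1 : w - x != 0 by rewrite subr_eq0.
  have := dP (w - x); rewrite /ball /= sub0r normrN wz wz1 => /(_ erefl erefl) /=.
  rewrite -[_ *: 1]/(_ * 1) mulr1 subrK.
  rewrite -[_ *: _]/(_ * _) => h.
  have -> : f w - f x - l * (w - x) = - (l - (w - x)^-1 * (f w - f x)) * (w - x).
    by field.
  by rewrite normrM normrN ler_wpM2r.
have cv : (fun h : R => h^-1 *: ((f \o shift x) (h *: 1) - f x)) @ 0^' --> l.
  apply/cvgrPdist_le => e e0.
  have [d d0 dP] := H _ e0.
  apply/nbhs_ballP; exists d => // h; rewrite /ball /= sub0r normrN /= => hd h0.
  rewrite -[_ *: 1]/(_ * 1) mulr1 -[_ *: _]/(_ * _).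
  have := dP (h + x); rewrite addrK => /(_ hd).
  rewrite (_ : f (h + x) - f x - l * h = - ((l - h^-1 * (f (h + x) - f x)) * h)).
    by rewrite normrN normrM ler_pM2r ?normr_gt0.
  by field.
by split; [apply/cvg_ex; exists l | exact: cvg_lim cv].
Qed.

(** Derivatives of curves are given by their expansion, since [Cplx R] is a
    normed module over itself and not over R. *)
Definition rderiv (G : R -> C) (t : R) (l : C) := forall e : R, 0 < e ->
  exists2 d : R, 0 < d & forall s, `|s - t| < d ->
    cmod (G s - G t - rc (s - t) * l) <= e * `|s - t|.

Lemma rderiv_re (c : C) G t l : rderiv G t l ->
  is_derive t (1 : R) (fun s => re (c * G s)) (re (c * l)).
Proof.
move=> dG; apply/real_derivP => e e0.
have K0 : 0 < cmod c + 1 by rewrite ltr_wpDl// cmod_ge0.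
have [d d0 dP] := dG _ (divr_gt0 e0 K0); exists d => // s /dP h.
rewrite (_ : re (c * G s) - re (c * G t) - re (c * l) * (s - t) =
  re (c * (G s - G t - rc (s - t) * l))); last by rewrite !rimE; ring.
rewrite (le_trans (re_le_cmod _))// cmodM.
have cK : cmod c <= cmod c + 1 by rewrite lerDl.
rewrite (le_trans (ler_pM (cmod_ge0 _) (cmod_ge0 _) cK h))//.
by rewrite mulrA [_ * (e / _)]mulrC divfK ?lt0r_neq0.
Qed.

Lemma rderiv_cart (G1 G2 : R -> R) (t l1 l2 : R) :
  is_derive t (1 : R) G1 l1 -> is_derive t (1 : R) G2 l2 ->
  rderiv (fun s => cart (G1 s) (G2 s)) t (cart l1 l2).
Proof.
move=> /real_derivP d1 /real_derivP d2 e e0; have e20 : 0 < e / 2 by rewrite divr_gt0.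
have [a a0 aP] := d1 _ e20; have [b b0 bP] := d2 _ e20.
exists (Num.min a b); first by rewrite lt_min a0.
move=> s; rewrite lt_min => /andP[/aP h1 /bP h2].
rewrite (le_trans (cmod_le_re_im _))// (splitr e) mulrDl !rimE.
rewrite !mul0r addr0 subr0 ![(s - t) * _]mulrC.
exact: lerD.
Qed.

Lemma cderiv_rderiv (F : C -> C) (a b : C) (t : R) l : cderiv F (a + rc t * b) l ->
  rderiv (fun s => F (a + rc s * b)) t (l * b).
Proof.
move=> /cderivP dF e e0.
have K0 : 0 < cmod b + 1 by rewrite ltr_wpDl// cmod_ge0.
have [d d0 dP] := dF _ (divr_gt0 e0 K0).
exists (d / (cmod b + 1)); first by rewrite divr_gt0.
move=> s sd; have E : a + rc s * b - (a + rc t * b) = rc (s - t) * b.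
  by rewrite rcB; ring.
have bK : cmod b <= cmod b + 1 by rewrite lerDl.
have := dP (a + rc s * b); rewrite E cmodM cmod_rc.
have -> : l * (rc (s - t) * b) = rc (s - t) * (l * b) by ring.
move=> H; apply: le_trans (H _) _.
  rewrite -(divfK (lt0r_neq0 K0) d) (le_lt_trans (ler_wpM2l _ bK))//.
  by rewrite ltr_pM2r.
rewrite [leLHS](_ : _ = e * `|s - t| * (cmod b / (cmod b + 1))); last by ring.
by rewrite ler_piMr ?mulr_ge0 ?(ltW e0)// ler_pdivrMr// mul1r.
Qed.

Lemma rderivB (F G : R -> C) t l m : rderiv F t l -> rderiv G t m ->
  rderiv (fun s => F s - G s) t (l - m).
Proof.
move=> dF dG e e0; have e20 : 0 < e / 2 by rewrite divr_gt0.
have [a a0 aP] := dF _ e20; have [b b0 bP] := dG _ e20.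
exists (Num.min a b); first by rewrite lt_min a0.
move=> s; rewrite lt_min => /andP[/aP h1 /bP h2].
rewrite [X in cmod X](_ : _ = (F s - F t - rc (s - t) * l)
  - (G s - G t - rc (s - t) * m)); last by ring.
by rewrite (le_trans (cmodD _ _))// cmodN (splitr e) mulrDl lerD.
Qed.

(** Rotate the increment onto the positive axis and apply the mean value
    theorem to the real part. *)
Lemma rderiv_mean (G g : R -> C) (M : R) :
  (forall t : R, 0 <= t <= 1 -> rderiv G t (g t)) ->
  (forall t : R, 0 <= t <= 1 -> cmod (g t) <= M) -> cmod (G 1 - G 0) <= M.
Proof.
move=> dG gM; have [c c1 <-] := unit_dir (G 1 - G 0).
have D (t : R) : 0 <= t <= 1 -> is_derive t (1 : R) (fun s => re (c * G s)) (re (c * g t)).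
  by move=> /dG; exact: rderiv_re.
have [| |t] := @MVT _ (fun s => re (c * G s)) (fun s => re (c * g s)) 0 1 ltr01.
- by move=> x; rewrite in_itv /= => /andP[h1 h2]; apply: D; rewrite !ltW.
- apply: derivable_within_continuous => x; rewrite in_itv /= => h.
  by have [] := D x h.
rewrite in_itv /= subr0 mulr1 => /andP[h1 h2].
rewrite mulrBr reD reN => ->; rewrite (le_trans (re_cmod _))// cmodM.
have gt : cmod (g t) <= M by apply: gM; rewrite !ltW.
by rewrite (le_trans (ler_pM (cmod_ge0 _) (cmod_ge0 _) c1 gt))// mul1r.
Qed.

End CompactExp.

(** * The complex exponential *)

Section Exponential.
Variable R : realType.
Notation C := (Cplx R).
Implicit Types (z w : C).

Lemma re_expC z : re (expC z) = expR (re z) * cos (im z). Proof. by []. Qed.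
Lemma im_expC z : im (expC z) = expR (re z) * sin (im z). Proof. by []. Qed.

Lemma expC0 : expC 0 = 1 :> C.
Proof. by apply: complex_ext; rewrite ?re_expC ?im_expC !rimE expR0 ?cos0 ?sin0 mul1r. Qed.

Lemma expCD z w : expC (z + w) = expC z * expC w.
Proof.
apply: complex_ext; rewrite !(re_expC, im_expC, rimE) expRD ?cosD ?sinD; ring.
Qed.

Lemma cmod_expC z : cmod (expC z) = expR (re z).
Proof.
apply/eqP; rewrite -(@eqrXn2 _ 2) ?cmod_ge0 ?expR_ge0// cmod_sqr re_expC im_expC.
by rewrite !exprMn -mulrDr cos2Dsin2 mulr1.
Qed.

Lemma expC_neq0 z : expC z != 0.
Proof. by rewrite -cmod_gt0 cmod_expC expR_gt0. Qed.

Lemma expCN z : expC (- z) = (expC z)^-1.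
Proof.
apply: (mulfI (expC_neq0 z)).
by rewrite -expCD subrr expC0 divff ?expC_neq0.
Qed.

Lemma expCMn z n : expC (n%:R * z) = expC z ^+ n.
Proof.
elim: n => [|n IH]; first by rewrite mul0r expC0 expr0.
by rewrite -natr1 mulrDl mul1r expCD IH exprSr.
Qed.

(** By the functional equation it suffices to estimate e^h - 1 - h; the
    first-order expansions of exp, cos and sin at 0 do it for both coordinates.
    *)
Lemma cderiv_expC z : cderiv (@expC R) z (expC z).
Proof.
apply/cderivP => e e0.
have De : is_derive (0 : R) (1 : R) (@expR R) 1.
  by rewrite -[X in is_derive _ _ _ X](@expR0 R); exact: is_derive_expR.
have Dc : is_derive (0 : R) (1 : R) (@cos R) 0.
  by have := is_derive_cos (0 : R); rewrite sin0 oppr0.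
have Ds : is_derive (0 : R) (1 : R) (@sin R) 1.
  by rewrite -[X in is_derive _ _ _ X](@cos0 R); exact: is_derive_sin.
move/real_derivP: De => De; move/real_derivP: Dc => Dc; move/real_derivP: Ds => Ds.
pose K := expR (re z); have K0 : 0 < K := expR_gt0 _.
have [m m0 [m1 mK]] : exists2 m : R, 0 < m & m <= 1 /\ K * (12 * m) <= e.
  (* 12 leaves room for the factor 9 in the estimate of the remainder below. *)
  exists (Num.min 1 (e / K / 12)); first by rewrite lt_min ltr01 !divr_gt0.
  split; first by rewrite ge_min lexx.
  by rewrite mulrC -ler_pdivlMr// mulrC -ler_pdivlMr// ge_min lexx orbT.
have [d1 d10 {}De] := De _ m0; have [d2 d20 {}Dc] := Dc _ m0.
have [d3 d30 {}Ds] := Ds _ m0.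
exists (Num.min m (Num.min d1 (Num.min d2 d3))); first by rewrite !lt_min m0 d10 d20.
move=> w; have [h hE] : {h | h = w - z} by exists (w - z).
rewrite -hE !lt_min => /and4P[hm h1 h2 h3].
have wE : w = z + h by rewrite hE; ring.
rewrite wE expCD.
rewrite [X in cmod X](_ : _ = expC z * (expC h - 1 - h)); last by ring.
rewrite cmodM cmod_expC -/K.
set x := re h; set y := im h; set N := cmod h; rewrite -/N in hm h1 h2 h3.
have xN : `|x| <= N := re_le_cmod h; have yN : `|y| <= N := im_le_cmod h.
have := De x; rewrite subr0 expR0 mul1r => /(_ (le_lt_trans xN h1)) {}De.
have := Dc y; rewrite subr0 cos0 mul0r subr0 => /(_ (le_lt_trans yN h2)) {}Dc.
have := Ds y; rewrite subr0 sin0 subr0 mul1r => /(_ (le_lt_trans yN h3)) {}Ds.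
have N0 : 0 <= N := cmod_ge0 _.
have mx : m * `|x| <= m * N by rewrite ler_pM2l.
have my : m * `|y| <= m * N by rewrite ler_pM2l.
have mN : m * N <= m by rewrite ler_piMr ?ltW// (lt_le_trans hm).
have E1 : `|expR x| <= 3.
  rewrite (_ : expR x = (expR x - 1 - x) + 1 + x); last by ring.
  rewrite (le_trans (ler_normD _ _))// (le_trans (lerD (ler_normD _ _) (lexx _)))//.
  by rewrite normr1; lra.
have xy : `|x| * `|y| <= m * N.
  by rewrite ler_pM// (le_trans xN)// ltW.
have E2 : `|expR x * cos y - 1 - x| <= 4 * (m * N).
  rewrite (_ : _ - x = (expR x - 1 - x) + expR x * (cos y - 1)); last by ring.
  rewrite (le_trans (ler_normD _ _))// normrM.
  have := ler_pM (normr_ge0 _) (normr_ge0 _) E1 (le_trans Dc my); lra.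
have E3 : `|expR x * sin y - y| <= 5 * (m * N).
  rewrite (_ : _ - y = expR x * (sin y - y) + ((expR x - 1 - x) * y + x * y)); last by ring.
  rewrite (le_trans (ler_normD _ _))// normrM.
  rewrite (le_trans (lerD (lexx _) (ler_normD _ _)))// !normrM.
  have := ler_pM (normr_ge0 _) (normr_ge0 _) E1 (le_trans Ds my).
  have y1 : `|y| <= 1 by lra.
  have := ler_pM (normr_ge0 _) (normr_ge0 _) (le_trans De mx) y1; lra.
have : cmod (expC h - 1 - h) <= 9 * (m * N).
  rewrite (le_trans (cmod_le_re_im _))// !(re_expC, im_expC, rimE) -/x -/y oppr0 addr0.
  by lra.
move=> H; rewrite (le_trans (ler_wpM2l (ltW K0) H))//.
rewrite (_ : K * (9 * (m * N)) = K * (9 * m) * N); last by ring.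
by rewrite ler_wpM2r// (le_trans _ mK)// ler_pM2l// ler_pM2r//; lra.
Qed.

Lemma cos_eq1 (x : R) : 0 <= x < pi *+ 2 -> cos x = 1 -> x = 0.
Proof.
move=> /andP[x0 x2] cx; apply/eqP; rewrite eq_le x0 andbT leNgt; apply/negP => xp.
have h : 0 < x / 2 < pi.
  by rewrite divr_gt0//= ltr_pdivrMr// mulr_natr.
have := sin_gt0_pi h; have := cos_mulr2n (x / 2).
rewrite (_ : x / 2 *+ 2 = x); last by rewrite -mulr_natr divfK.
rewrite cx cos2sin2 => E s0.
have : sin (x / 2) ^+ 2 = 0 by lra.
by move/eqP; rewrite sqrf_eq0 gt_eqF.
Qed.

Lemma expC_period (k : int) : expC (ii R * rc (pi *+ 2 *~ k)) = 1 :> C.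
Proof.
have P (n : nat) : expC (ii R * rc (pi *+ 2 *+ n)) = 1.
  apply: complex_ext; rewrite ?re_expC ?im_expC !rimE !mul0r !mul1r subrr add0r expR0 mul1r.
    by rewrite -[X in cos X]add0r (periodicn (@cosD2pi R)) cos0.
  by rewrite -[X in sin X]add0r (periodicn (@sinD2pi R)) sin0.
case: k => n; first exact: P.
rewrite NegzE mulrNz rcN mulrN expCN; apply: invr_inj.
by rewrite invrK invr1; exact: P.
Qed.

(** The argument is reduced modulo 2 pi into the interval where the cosine
    takes the value 1 only at 0. *)
Lemma expC_eq1 z : expC z = 1 -> exists k : int, z = ii R * rc (pi *+ 2 *~ k).
Proof.
move=> z1; have P2 : 0 < pi *+ 2 :> R by rewrite pmulrn_lgt0// pi_gt0.
have rz : re z = 0.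
  by apply: expR_inj; rewrite -cmod_expC z1 cmod1 expR0.
pose k := Num.floor (im z / (pi *+ 2)); exists k.
pose y := im z - pi *+ 2 *~ k.
have : expC (ii R * rc y) = 1.
  rewrite /y rcB mulrBr expCD (_ : ii R * _ = z); last first.
    by apply: complex_ext; rewrite !rimE ?rz; ring.
  by rewrite z1 mul1r expCN expC_period invr1.
move/(congr1 (@re R)); rewrite re_expC !rimE !mul0r mulr0 subrr expR0 mul1r add0r.
rewrite mul1r => /cos_eq1 y0.
have {}y0 : y = 0.
  apply: y0; rewrite /y -mulrzr.
  have := floor_le (im z / (pi *+ 2)); have := floorD1_gt (im z / (pi *+ 2)).
  rewrite ler_pdivlMr// ltr_pdivrMr// -/k rmorphD /= mulrDl mul1r.
  by rewrite ![_ * (pi *+ 2)]mulrC => h1 h2; apply/andP; split; lra.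
apply: complex_ext; rewrite !rimE ?rz; first by ring.
by move: y0; rewrite /y => /eqP; rewrite subr_eq0 => /eqP ->; ring.
Qed.

Lemma expC_surj z : z != 0 -> exists s : C, expC s = z.
Proof.
move=> z0; have n0 : 0 < cmod z by rewrite cmod_gt0.
have [x xE] : exists x, expR x = cmod z by apply: expR_total.
pose u := re z / cmod z; pose v := im z / cmod z.
have uv : u ^+ 2 + v ^+ 2 = 1.
  by rewrite /u /v !expr_div_n -mulrDl -cmod_sqr divff// expf_neq0// gt_eqF.
have u1 : -1 <= u <= 1.
  by rewrite -ler_norml -(@ler_pXn2r _ 2) ?nnegrE// expr1n real_normK ?num_real//
    -uv lerDl sqr_ge0.
have s2 : sin (acos u) = `|v|.
  by rewrite sin_acos// -uv [u ^+ 2 + _]addrC addrK sqrtr_sqr.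
have c2 : cos (acos u) = u by rewrite acosK// in_itv.
have [v0|v0] := leP 0 v.
  exists (cart x (acos u)); apply: complex_ext; rewrite ?re_expC ?im_expC !rimE xE ?c2 ?s2.
    by rewrite /u mulrC divfK// gt_eqF.
  by rewrite ger0_norm// /v mulrC divfK// gt_eqF.
exists (cart x (- acos u)); apply: complex_ext; rewrite ?re_expC ?im_expC !rimE xE.
  by rewrite cosN c2 /u mulrC divfK// gt_eqF.
by rewrite sinN s2 ltr0_norm// opprK /v mulrC divfK// gt_eqF.
Qed.

End Exponential.

(** * Integrals along segments *)

Section Goursat.
Variable R : realType.
Notation C := (Cplx R).
Implicit Types (z w : C).

Lemma antiderivative (g : R -> R) : continuous g ->
  exists G : R -> R, forall t : R, 0 <= t <= 1 -> is_derive t (1 : R) G (g t).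
Proof.
move=> cg; (* The lower limit -1 makes 0 and 1 interior points of the interval of
   integration. *)
exists (fun x => \int[@lebesgue_measure R]_(t in `[(-1)%R, x]) g t)%R.
move=> t /andP[t0 t1].
have t2 : t < 2 by rewrite (le_lt_trans t1)// ltr1n.
have tN1 : -1 < t by rewrite (lt_le_trans _ t0)// ltrN10.
have ig : (@lebesgue_measure R).-integrable `[-1, 2] (EFin \o g).
  apply: continuous_compact_integrable; first exact: segment_compact.
  by apply: continuous_subspaceT => x; exact: cg.
have [] := @continuous_FTC1_closed R g (-1) t 2 t2 ig tN1 (cg t).
by rewrite derive1E => ? ?; split.
Qed.

Definition on_seg (a b : C) (t : R) : C := a + rc t * (b - a).

(** v is the integral of f along the segment from a to b, as the increment of
    an antiderivative along it. Everything needed about integrals then follows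
    from the mean value inequality. *)
Definition is_seg_int (f : C -> C) (a b v : C) := exists2 G : R -> C,
  (forall t : R, 0 <= t <= 1 -> rderiv G t (f (on_seg a b t) * (b - a))) &
  v = G 1 - G 0.

(** The integrand is extended to a continuous function on the line by clamping
    the parameter to the unit interval. *)
Lemma is_seg_int_exists (f : C -> C) a b :
  (forall t : R, 0 <= t <= 1 -> ctn f (on_seg a b t)) -> exists v, is_seg_int f a b v.
Proof.
move=> cf; pose cl (t : R) := Num.max 0 (Num.min t 1).
have cl01 t : 0 <= cl t <= 1.
  by rewrite /cl le_max lexx/= ge_max ler01 ge_min lexx orbT.
have clE t : 0 <= t <= 1 -> cl t = t.
  by move=> /andP[t0 t1]; rewrite /cl min_l// max_r.
have cl_lip s t : `|cl s - cl t| <= `|s - t|.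
  rewrite /cl; case: (leP s 1) => ?; case: (leP t 1) => ?;
  do 2 ?[case: (leP 0 _) => ?]; rewrite ?subrr ?normr0//;
  rewrite ler_norml; case: (leP 0 (s - t)) => h;
  rewrite ?(ger0_norm h) ?(ltr0_norm h); lra.
pose k t := f (on_seg a b (cl t)) * (b - a).
have ck t (e : R) : 0 < e -> exists2 d : R, 0 < d & forall s : R, `|s - t| < d ->
    cmod (k s - k t) < e.
  move=> e0; have K0 : 0 < cmod (b - a) + 1 by rewrite ltr_wpDl// cmod_ge0.
  have [d d0 dP] := cf _ (cl01 t) _ (divr_gt0 e0 K0).
  exists (d / (cmod (b - a) + 1)); first by rewrite divr_gt0.
  move=> s sd; rewrite /k -mulrBl cmodM.
  have bK : cmod (b - a) <= cmod (b - a) + 1 by rewrite lerDl.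
  have h : cmod (f (on_seg a b (cl s)) - f (on_seg a b (cl t))) < e / (cmod (b - a) + 1).
    apply: dP; rewrite /on_seg (_ : _ - _ = rc (cl s - cl t) * (b - a)); last first.
      by rewrite rcB; ring.
    rewrite cmodM cmod_rc; apply: le_lt_trans (ler_pM _ (cmod_ge0 _) (cl_lip s t) bK) _ => //.
    by rewrite -ltr_pdivlMr.
  rewrite (le_lt_trans (ler_wpM2l (cmod_ge0 _) bK))// -ltr_pdivlMr//.
have cre : continuous (fun t => re (k t)).
  move=> t P /nbhs_ballP[e /= e0 eP]; have [d d0 dP] := ck t e e0.
  apply/nbhs_ballP; exists d => // s; rewrite /ball /= distrC => /dP h.
  apply: eP; rewrite /ball /= distrC; apply: le_lt_trans h.
  by rewrite -reN -reD re_le_cmod.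
have cim : continuous (fun t => im (k t)).
  move=> t P /nbhs_ballP[e /= e0 eP]; have [d d0 dP] := ck t e e0.
  apply/nbhs_ballP; exists d => // s; rewrite /ball /= distrC => /dP h.
  apply: eP; rewrite /ball /= distrC; apply: le_lt_trans h.
  by rewrite -imN -imD im_le_cmod.
have [G1 G1P] := antiderivative cre; have [G2 G2P] := antiderivative cim.
exists (cart (G1 1) (G2 1) - cart (G1 0) (G2 0)).
exists (fun t => cart (G1 t) (G2 t)) => // t t01.
have := rderiv_cart (G1P t t01) (G2P t t01).
suff -> : cart (re (k t)) (im (k t)) = f (on_seg a b t) * (b - a) by [].
by rewrite /k clE//; apply: complex_ext.
Qed.

Lemma rderiv_affine (G : R -> C) (p q t : R) l : rderiv G (p + q * t) l ->
  rderiv (fun s => G (p + q * s)) t (rc q * l).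
Proof.
move=> dG e e0; have K0 : 0 < `|q| + 1 by rewrite ltr_wpDl.
have [d d0 dP] := dG _ (divr_gt0 e0 K0).
exists (d / (`|q| + 1)); first by rewrite divr_gt0.
move=> s sd; have E : p + q * s - (p + q * t) = q * (s - t) by ring.
have qK : `|q| <= `|q| + 1 by rewrite lerDl.
have := dP (p + q * s); rewrite E rcM normrM.
have -> : rc q * rc (s - t) * l = rc (s - t) * (rc q * l) by ring.
move=> H; apply: le_trans (H _) _.
  apply: le_lt_trans (ler_wpM2r _ qK) _ => //.
  by rewrite mulrC -ltr_pdivlMr.
rewrite [leLHS](_ : _ = e * `|s - t| * (`|q| / (`|q| + 1))); last by ring.
by rewrite ler_piMr ?mulr_ge0 ?(ltW e0)// ler_pdivrMr// mul1r.
Qed.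

(** The difference between an antiderivative along the segment and F has a
    derivative of modulus at most M |b - a|. With F linear this compares the
    integral with f z (b - a); with F quadratic it is the estimate behind
    Goursat's lemma. *)
Lemma is_seg_int_approx (f F F' : C -> C) a b v (M : R) : is_seg_int f a b v ->
  (forall t : R, 0 <= t <= 1 -> cderiv F (on_seg a b t) (F' (on_seg a b t))) ->
  (forall t : R, 0 <= t <= 1 -> cmod (f (on_seg a b t) - F' (on_seg a b t)) <= M) ->
  cmod (v - (F b - F a)) <= M * cmod (b - a).
Proof.
move=> [G dG ->] dF fM.
have E : G 1 - G 0 - (F b - F a) = (G 1 - F (on_seg a b 1)) - (G 0 - F (on_seg a b 0)).
  rewrite /on_seg rc1 rc0 (_ : a + 1 * (b - a) = b); last by ring.
  by rewrite (_ : a + 0 * (b - a) = a); ring.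
rewrite E; apply: (@rderiv_mean _ (fun t => G t - F (on_seg a b t))
   (fun t => f (on_seg a b t) * (b - a) - F' (on_seg a b t) * (b - a))).
  by move=> t t01; apply: rderivB (dG t t01) (cderiv_rderiv (dF t t01)).
move=> t t01; rewrite -mulrBl cmodM ler_wpM2r ?cmod_ge0//; exact: fM.
Qed.

Lemma is_seg_int_uniq (f : C -> C) a b v v' : is_seg_int f a b v -> is_seg_int f a b v' -> v = v'.
Proof.
move=> [G dG ->] [H dH ->]; apply/eqP; rewrite -subr_eq0 -cmod_eq0 eq_le cmod_ge0 andbT.
rewrite (_ : _ - _ - _ = (G 1 - H 1) - (G 0 - H 0)); last by ring.
apply: (rderiv_mean (G := fun t => G t - H t)).
  by move=> t t01; apply: rderivB (dG t t01) (dH t t01).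
by move=> t _ /=; rewrite subrr cmod0.
Qed.

Lemma is_seg_int_rev (f : C -> C) a b v : is_seg_int f a b v -> is_seg_int f b a (- v).
Proof.
move=> [G dG ->]; exists (fun t => G (1 + (-1) * t)).
  move=> t t01; have t01' : 0 <= 1 + (-1) * t <= 1 by lra.
  have := rderiv_affine (dG _ t01'); congr rderiv.
  have -> : on_seg a b (1 + -1 * t) = on_seg b a t.
    by rewrite /on_seg rcD rcM rcN rc1; ring.
  by rewrite rcN rc1; ring.
by rewrite mulr0 addr0 mulr1 subrr opprB.
Qed.

Definition mid (a b : C) : C := (a + b) / 2.

Lemma is_seg_int_mid (f : C -> C) a b v : is_seg_int f a b v ->
  exists v1 v2, [/\ v = v1 + v2, is_seg_int f a (mid a b) v1 & is_seg_int f (mid a b) b v2].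
Proof.
move=> [G dG ->]; exists (G (1 / 2) - G 0), (G 1 - G (1 / 2)); split; first by ring.
- exists (fun t => G (0 + 1 / 2 * t)); last by rewrite mulr1 mulr0 add0r addr0.
  move=> t t01; have t01' : 0 <= 0 + 1 / 2 * t <= 1 by lra.
  have := rderiv_affine (dG _ t01'); congr rderiv.
  have -> : on_seg a b (0 + 1 / 2 * t) = on_seg a (mid a b) t.
    by rewrite /on_seg /mid rcD !rcM rcV rc1 rc0 (rc_nat _ 2); field.
  by rewrite rcM rcV rc1 (rc_nat _ 2) /mid; field.
- exists (fun t => G (1 / 2 + 1 / 2 * t)); last first.
    by rewrite mulr1 mulr0 addr0; congr (G _ - _); field.
  move=> t t01; have t01' : 0 <= 1 / 2 + 1 / 2 * t <= 1 by lra.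
  have := rderiv_affine (dG _ t01'); congr rderiv.
  have -> : on_seg a b (1 / 2 + 1 / 2 * t) = on_seg (mid a b) b t.
    by rewrite /on_seg /mid rcD !rcM rcV rc1 (rc_nat _ 2); field.
  by rewrite rcM rcV rc1 (rc_nat _ 2) /mid; field.
Qed.

(** The numbers u n - 2 c / 2^n increase and the numbers u n + 2 c / 2^n
    decrease; p is the supremum of the former. *)
Lemma geometric_limit (u : nat -> R) (c : R) :
  (forall n, `|u n.+1 - u n| <= c / 2 ^+ n) ->
  exists p : R, forall n, `|u n - p| <= 2 * c / 2 ^+ n.
Proof.
move=> H; have P2 n : 0 < 2 ^+ n :> R by rewrite exprn_gt0.
have c0 : 0 <= c by have := le_trans (normr_ge0 _) (H 0%N); rewrite expr0 divr1.
have eS n : 2 * c / 2 ^+ n.+1 = c / 2 ^+ n.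
  by rewrite exprS; field; rewrite gt_eqF.
have up m n : u (m + n)%N - 2 * c / 2 ^+ (m + n) >= u m - 2 * c / 2 ^+ m
    /\ u (m + n)%N + 2 * c / 2 ^+ (m + n) <= u m + 2 * c / 2 ^+ m.
  elim: n => [|n IH]; first by rewrite addn0.
  rewrite addnS eS; have := H (m + n)%N; rewrite ler_norml.
  have E : 2 * c / 2 ^+ (m + n) = c / 2 ^+ (m + n) + c / 2 ^+ (m + n) by ring.
  rewrite E in IH.
  by lra.
have e0 n : 0 <= 2 * c / 2 ^+ n by rewrite divr_ge0 ?mulr_ge0// ltW.
have le m n : u m - 2 * c / 2 ^+ m <= u n + 2 * c / 2 ^+ n.
  have [/subnKC <-|/ltnW/subnKC <-] := leqP m n.
    have [h _] := up m (n - m)%N; have := e0 (m + (n - m))%N; lra.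
  have [_ h] := up n (m - n)%N; have := e0 (n + (m - n))%N; lra.
pose A : set R := [set u n - 2 * c / 2 ^+ n | n in setT].
exists (sup A) => n; rewrite ler_norml.
have ubA m : ubound A (u m + 2 * c / 2 ^+ m) by move=> _ [k _ <-]; exact: le.
have A0 : A !=set0 by exists (u 0%N - 2 * c / 2 ^+ 0), 0%N.
have s1 : sup A <= u n + 2 * c / 2 ^+ n by apply: ge_sup.
have s2 : u n - 2 * c / 2 ^+ n <= sup A.
  by apply: ub_le_sup; [exists (u n + 2 * c / 2 ^+ n); exact: ubA|exists n].
by lra.
Qed.

Lemma geometric_limit_C (u : nat -> C) (c : R) :
  (forall n, cmod (u n.+1 - u n) <= c / 2 ^+ n) ->
  exists p : C, forall n, cmod (u n - p) <= 4 * c / 2 ^+ n.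
Proof.
move=> H; have [|x xP] := @geometric_limit (fun n => re (u n)) c.
  by move=> n; rewrite -reN -reD (le_trans (re_le_cmod _)).
have [|y yP] := @geometric_limit (fun n => im (u n)) c.
  by move=> n; rewrite -imN -imD (le_trans (im_le_cmod _)).
exists (cart x y) => n; rewrite (le_trans (cmod_le_re_im _))// !rimE.
by have := lerD (xP n) (yP n); congr (_ <= _); ring.
Qed.

End Goursat.

(** * Goursat's lemma and primitives *)

Section Primitive.
Variable R : realType.
Notation C := (Cplx R).
Implicit Types (z w : C).

Definition cconvex (K : set C) := forall a b, K a -> K b ->
  forall t : R, 0 <= t <= 1 -> K (on_seg a b t).

Definition cclosed (K : set C) := forall p,
  (forall e : R, 0 < e -> exists2 k, K k & cmod (k - p) < e) -> K p.

(** Convexity in the form that Goursat's lemma uses: the bisected triangles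
    stay in a closed convex part of A, so that their limit is in A. *)
Definition region (A : set C) := copen A /\ forall a b c, A a -> A b -> A c ->
  exists2 K : set C, K `<=` A & [/\ cconvex K, cclosed K, K a, K b & K c].

Definition holo (A : set C) (f : C -> C) := forall z, A z -> exists l, cderiv f z l.

Lemma region_seg A a b : region A -> A a -> A b ->
  forall t : R, 0 <= t <= 1 -> A (on_seg a b t).
Proof.
move=> [_ rA] Aa Ab t t01; have [K KA [cK _ Ka Kb _]] := rA a b b Aa Ab Ab.
by apply: KA; apply: cK.
Qed.

Lemma cmod_on_seg z a b (t r : R) : 0 <= t <= 1 -> cmod (a - z) <= r -> cmod (b - z) <= r ->
  cmod (on_seg a b t - z) <= r.
Proof.
move=> /andP[t0 t1] ar br.
rewrite (_ : _ - z = rc (1 - t) * (a - z) + rc t * (b - z)); last first.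
  by rewrite /on_seg rcB rc1; ring.
rewrite (le_trans (cmodD _ _))// !cmodM !cmod_rc !ger0_norm ?subr_ge0//.
rewrite (_ : r = (1 - t) * r + t * r); last by ring.
by rewrite lerD// ler_wpM2l// subr_ge0.
Qed.

Lemma region_ball z (r : R) : region [set w | cmod (w - z) < r].
Proof.
split=> [w wr|a b c ar br cr].
  exists (r - cmod (w - z)); first by rewrite subr_gt0.
  by move=> v /= vr; have := cmod_tri w v z; lra.
pose s := Num.max (cmod (a - z)) (Num.max (cmod (b - z)) (cmod (c - z))).
exists [set w | cmod (w - z) <= s].
  by move=> w /= ws; apply: le_lt_trans ws _; rewrite !gt_max ar br cr.
split; rewrite /= /s ?le_max ?lexx ?orbT//.
  by move=> x y /= xs ys t t01; exact: cmod_on_seg.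
move=> p H; rewrite /= leNgt; apply/negP => h.
have [k /= ks kp] := H _ (eq_ind_r is_true h (subr_gt0 _ _)).
have := cmod_tri k p z; rewrite [cmod (p - k)]cmodB; lra.
Qed.

Lemma region_halfplane (r : R) : region [set w | re w < r].
Proof.
split=> [w wr|a b c ar br cr].
  exists (r - re w); first by rewrite subr_gt0.
  by move=> v /= vr; have := re_cmod (v - w); rewrite !rimE; lra.
pose s := Num.max (re a) (Num.max (re b) (re c)).
exists [set w | re w <= s].
  by move=> w /= ws; apply: le_lt_trans ws _; rewrite !gt_max ar br cr.
split; rewrite /= /s ?le_max ?lexx ?orbT//.
  move=> x y /= xs ys t /andP[t0 t1]; rewrite /on_seg !rimE mul0r subr0.
  rewrite (_ : _ + _ = (1 - t) * re x + t * re y); last by ring.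
  rewrite [leRHS](_ : _ = (1 - t) * s + t * s); last by rewrite -/s; ring.
  by rewrite lerD// ler_wpM2l// subr_ge0.
move=> p H; rewrite /= -/s leNgt; apply/negP => h.
have [k /= ks kp] := H _ (eq_ind_r is_true h (subr_gt0 _ _)).
have := re_cmod (p - k); rewrite cmodB !rimE; rewrite -/s in ks; lra.
Qed.

Definition seg_int (f : C -> C) (a b : C) : C := xget 0 (is_seg_int f a b).

Section InRegion.
Variables (A : set C) (f : C -> C).
Hypotheses (rA : region A) (cf : forall z, A z -> ctn f z).

Lemma seg_intP a b : A a -> A b -> is_seg_int f a b (seg_int f a b).
Proof.
move=> Aa Ab; rewrite /seg_int; case: xgetP => [//|h].
have [v vP] : exists v, is_seg_int f a b v.
  by apply: is_seg_int_exists => t t01; apply: cf; exact: region_seg t01.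
by case: (h v).
Qed.

Lemma seg_int_rev a b : A a -> A b -> seg_int f b a = - seg_int f a b.
Proof.
by move=> Aa Ab; apply: is_seg_int_uniq (seg_intP Ab Aa) (is_seg_int_rev (seg_intP Aa Ab)).
Qed.

Lemma on_seg_mid (a b : C) : on_seg a b (1 / 2) = mid a b.
Proof. by rewrite /on_seg /mid rcM rcV rc1 (rc_nat _ 2); field. Qed.

Lemma mid_in (K : set C) a b : cconvex K -> K a -> K b -> K (mid a b).
Proof. by move=> cK Ka Kb; rewrite -on_seg_mid; apply: cK => //; lra. Qed.

Lemma region_mid a b : A a -> A b -> A (mid a b).
Proof.
by move=> Aa Ab; rewrite -on_seg_mid; apply: (region_seg rA) => //; lra.
Qed.

Lemma seg_int_mid a b : A a -> A b ->
  seg_int f a b = seg_int f a (mid a b) + seg_int f (mid a b) b.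
Proof.
move=> Aa Ab; have Am := region_mid Aa Ab.
have [v1 [v2 [-> h1 h2]]] := is_seg_int_mid (seg_intP Aa Ab).
by rewrite (is_seg_int_uniq (seg_intP Aa Am) h1) (is_seg_int_uniq (seg_intP Am Ab) h2).
Qed.

Definition loop (t : C * C * C) := seg_int f t.1.1 t.1.2 + seg_int f t.1.2 t.2 + seg_int f t.2 t.1.1.
Definition perim (t : C * C * C) : R := cmod (t.1.1 - t.1.2) + cmod (t.1.2 - t.2) + cmod (t.2 - t.1.1).
Definition corners (K : set C) (t : C * C * C) := [/\ K t.1.1, K t.1.2 & K t.2].

Lemma cmod_half z : cmod (z / 2) = cmod z / 2.
Proof. by rewrite cmodM cmodV -(rc_nat _ 2) cmod_rc ger0_norm. Qed.

(** The integral around a triangle is the sum of those around the four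
    triangles cut by the midpoints, so one of these carries at least a quarter
    of it. *)
Lemma bisect (K : set C) t : K `<=` A -> cconvex K -> corners K t ->
  exists t', [/\ corners K t', perim t' = perim t / 2,
    cmod (t'.1.1 - t.1.1) <= perim t & cmod (loop t) <= 4 * cmod (loop t')].
Proof.
case: t => -[a b] c KA cK [/= Ka Kb Kc].
have Km1 := mid_in cK Ka Kb; have Km2 := mid_in cK Kb Kc; have Km3 := mid_in cK Kc Ka.
set m1 := mid a b in Km1; set m2 := mid b c in Km2; set m3 := mid c a in Km3.
pose t1 : C * C * C := (a, m1, m3); pose t2 : C * C * C := (m1, b, m2).
pose t3 : C * C * C := (m3, m2, c); pose t4 : C * C * C := (m1, m2, m3).
have E : loop (a, b, c) = loop t1 + loop t2 + loop t3 + loop t4.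
  rewrite /loop /= (seg_int_mid (KA _ Ka) (KA _ Kb)) (seg_int_mid (KA _ Kb) (KA _ Kc)).
  rewrite (seg_int_mid (KA _ Kc) (KA _ Ka)) -/m1 -/m2 -/m3.
  rewrite (seg_int_rev (KA _ Km1) (KA _ Km3)) (seg_int_rev (KA _ Km1) (KA _ Km2)).
  by rewrite (seg_int_rev (KA _ Km2) (KA _ Km3)); ring.
have p0 : 0 <= perim (a, b, c) by rewrite !addr_ge0 ?cmod_ge0.
have h1 : cmod (a - b) <= perim (a, b, c).
  by rewrite /perim /= -addrA lerDl addr_ge0 ?cmod_ge0.
have h3 : cmod (c - a) <= perim (a, b, c).
  by rewrite /perim /= lerDr addr_ge0 ?cmod_ge0.
have e1 : cmod (m1 - a) <= perim (a, b, c).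
  rewrite (_ : m1 - a = - ((a - b) / 2)); last by rewrite /m1 /mid; field.
  by rewrite cmodN cmod_half; lra.
have e3 : cmod (m3 - a) <= perim (a, b, c).
  rewrite (_ : m3 - a = (c - a) / 2); last by rewrite /m3 /mid; field.
  by rewrite cmod_half; lra.
have e0 : cmod (a - a) <= perim (a, b, c) by rewrite subrr cmod0.
have [q [Pq LPq]] : exists q, [/\ corners K q, perim q = perim (a, b, c) / 2 &
    cmod (q.1.1 - a) <= perim (a, b, c)] /\ cmod (loop (a, b, c)) <= 4 * cmod (loop q).
  have [l1|l1] := leP (cmod (loop (a, b, c))) (4 * cmod (loop t1)).
    exists t1; split=> //; split=> //; rewrite /perim /=.
    rewrite (_ : a - m1 = (a - b) / 2) ?cmod_half; last by rewrite /m1 /mid; field.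
    rewrite (_ : m1 - m3 = (b - c) / 2) ?cmod_half; last by rewrite /m1 /m3 /mid; field.
    rewrite (_ : m3 - a = (c - a) / 2) ?cmod_half; last by rewrite /m3 /mid; field.
    by ring.
  have [l2|l2] := leP (cmod (loop (a, b, c))) (4 * cmod (loop t2)).
    exists t2; split=> //; split=> //; rewrite /perim /=.
    rewrite (_ : m1 - b = (a - b) / 2) ?cmod_half; last by rewrite /m1 /mid; field.
    rewrite (_ : b - m2 = (b - c) / 2) ?cmod_half; last by rewrite /m2 /mid; field.
    rewrite (_ : m2 - m1 = (c - a) / 2) ?cmod_half; last by rewrite /m2 /m1 /mid; field.
    by ring.
  have [l3|l3] := leP (cmod (loop (a, b, c))) (4 * cmod (loop t3)).
    exists t3; split=> //; split=> //; rewrite /perim /=.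
    rewrite (_ : m3 - m2 = (a - b) / 2) ?cmod_half; last by rewrite /m3 /m2 /mid; field.
    rewrite (_ : m2 - c = (b - c) / 2) ?cmod_half; last by rewrite /m2 /mid; field.
    rewrite (_ : c - m3 = (c - a) / 2) ?cmod_half; last by rewrite /m3 /mid; field.
    by ring.
  exists t4; split.
    split=> //; rewrite /perim /=.
    rewrite (_ : m1 - m2 = - ((c - a) / 2)) ?cmodN ?cmod_half; last by rewrite /m1 /m2 /mid; field.
    rewrite (_ : m2 - m3 = - ((a - b) / 2)) ?cmodN ?cmod_half; last by rewrite /m2 /m3 /mid; field.
    rewrite (_ : m3 - m1 = - ((b - c) / 2)) ?cmodN ?cmod_half; last by rewrite /m3 /m1 /mid; field.
    by ring.
  have := cmodD (loop t1 + loop t2 + loop t3) (loop t4); rewrite -E.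
  have := cmodD (loop t1 + loop t2) (loop t3); have := cmodD (loop t1) (loop t2).
  by lra.
by exists q; case: Pq.
Qed.

Hypothesis hf : holo A f.

(** Bisection yields nested triangles of perimeter L / 2^n carrying at least
    4^-n of the integral. At their limit p the function differs from its
    first-order expansion, which has a primitive, by o(L / 2^n), so the
    integral around the n-th triangle is o(4^-n). *)
Lemma goursat a b c : A a -> A b -> A c -> seg_int f a b + seg_int f b c + seg_int f c a = 0.
Proof.
move=> Aa Ab Ac; have [_ /(_ a b c Aa Ab Ac)[K KA [cK clK Ka Kb Kc]]] := rA.
have /choice[step stepP] : forall t : C * C * C, exists t', corners K t ->
    [/\ corners K t', perim t' = perim t / 2,
    cmod (t'.1.1 - t.1.1) <= perim t & cmod (loop t) <= 4 * cmod (loop t')].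
  move=> t; have [Kt|nKt] := pselect (corners K t); last by exists t.
  by have [t' ?] := bisect KA cK Kt; exists t'.
pose u n : C * C * C := iter n step (a, b, c).
pose L := perim (a, b, c); pose T := cmod (loop (a, b, c)).
have uP n : [/\ corners K (u n), perim (u n) = L / 2 ^+ n & T <= 4 ^+ n * cmod (loop (u n))].
  elim: n => [|n [IH1 IH2 IH3]]; first by rewrite !expr0 divr1 mul1r.
  have [h1 h2 h3 h4] := stepP _ IH1; split=> //.
    by rewrite [LHS]h2 IH2 exprS; field; rewrite expf_neq0.
  rewrite (le_trans IH3)// exprSr -mulrA ler_pM2l// exprn_gt0//.
have uS n : cmod ((u n.+1).1.1 - (u n).1.1) <= L / 2 ^+ n.
  by have [h1 h2 h3] := uP n; have [_ _] := stepP _ h1; rewrite h2.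
have [p pP] := geometric_limit_C uS.
have small (e : R) : 0 < e -> exists n : nat, L / 2 ^+ n < e.
  move=> e0; have L0 : 0 <= L by rewrite !addr_ge0 ?cmod_ge0.
  have [n nP] : exists n : nat, L / e < n%:R.
    exists (Num.truncn (L / e)).+1; rewrite truncnS_gt//.
  exists n; rewrite ltr_pdivrMr ?exprn_gt0// mulrC -ltr_pdivrMr//.
  by rewrite (lt_le_trans nP)// -natrX ler_nat ltnW// ltn_expl.
have Kp : K p.
  apply: clK => e e0; have [n nP] := small (e / 4) (divr_gt0 e0 (ltr0Sn _ 3)).
  exists (u n).1.1; first by have [[]] := uP n.
  by apply: le_lt_trans (pP n) _; rewrite -mulrA; lra.
have [l /cderivP dl] := hf (KA _ Kp).
suff T0 : T <= 0.
  by apply/eqP; rewrite -cmod_eq0 eq_le cmod_ge0 andbT.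
apply/ler_addgt0Pr => e e0; rewrite add0r.
have L1 : 0 < L + 1 by rewrite ltr_wpDl// !addr_ge0 ?cmod_ge0.
(* With this k the total error k (5 r) r on a triangle of perimeter r = L / 2^n
   becomes at most e after multiplication by 4^n. *)
pose k := e / (6 * (L + 1) ^+ 2).
have k0 : 0 < k by rewrite divr_gt0// mulr_gt0// exprn_gt0.
have [d d0 dP] := dl _ k0.
have [n nP] := small (d / 6) (divr_gt0 d0 (ltr0Sn _ 5)).
have [Kn Pn Tn] := uP n; have pn := pP n.
move: Kn Pn Tn pn; case: (u n) => -[x y] v /= [Kx Ky Kv] Pn Tn xp.
set r := L / 2 ^+ n in nP Pn xp.
have r0 : 0 <= r by rewrite -Pn !addr_ge0 ?cmod_ge0.
have xp' : cmod (x - p) <= 5 * r by move: xp; rewrite -mulrA -/r; lra.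
have Pn' : cmod (x - y) + cmod (y - v) + cmod (v - x) = r by [].
have n1 := cmod_ge0 (x - y); have n2 := cmod_ge0 (y - v); have n3 := cmod_ge0 (v - x).
have yp : cmod (y - p) <= 5 * r.
  by have := cmod_tri x y p; rewrite [cmod (y - x)]cmodB; move: xp; rewrite -mulrA -/r; lra.
have vp : cmod (v - p) <= 5 * r.
  by have := cmod_tri x v p; move: xp; rewrite -mulrA -/r; lra.
(* A primitive of the first-order expansion of f at p. *)
pose F z := f p * z + l * ((z - p) ^+ 2 / 2); pose F' z := f p + l * (z - p).
have dF z : cderiv F z (F' z).
  apply: cderiv_eq (cderivD (cderivMl (f p) (cderiv_id z))
    (cderivMl l (cderivM (cderivX 2 (cderivB (cderiv_id z) (cderiv_cst p z))) (cderiv_cst 2^-1 z)))) _.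
  by rewrite /F' /=; field.
have side q q' : K q -> K q' -> cmod (q - p) <= 5 * r -> cmod (q' - p) <= 5 * r ->
    cmod (seg_int f q q' - (F q' - F q)) <= k * (5 * r) * cmod (q - q').
  move=> Kq Kq' qr qr'; rewrite [cmod (q - q')]cmodB.
  apply: is_seg_int_approx (seg_intP (KA _ Kq) (KA _ Kq')) _ _; first by move=> t _; exact: dF.
  move=> t t01; have sr := cmod_on_seg t01 qr qr'.
  rewrite /F' opprD addrA (le_trans (dP _ _))//; last by rewrite ler_pM2l.
  by apply: le_lt_trans sr _; lra.
have := side x y Kx Ky xp' yp; have := side y v Ky Kv yp vp; have := side v x Kv Kx vp xp'.
move=> s3 s2 s1.
have B : cmod (loop (x, y, v)) <= k * (5 * r) * r.
  rewrite /loop /= (_ : _ + _ + _ = (seg_int f x y - (F y - F x)) +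
    (seg_int f y v - (F v - F y)) + (seg_int f v x - (F x - F v))); last by ring.
  rewrite (le_trans (cmodD _ _))// (le_trans (lerD (cmodD _ _) (lexx _)))//.
  by rewrite -[X in _ <= _ * X]Pn' 2!mulrDr !lerD.
rewrite (le_trans Tn)// (le_trans (ler_wpM2l _ B)) ?exprn_ge0//.
rewrite (_ : 4 ^+ n * _ = k * 5 * L ^+ 2); last first.
  have E4 : 4 = 2 ^+ 2 :> R by rewrite -natrX.
  rewrite /r E4 -exprM mulnC exprM.
  by field; rewrite expf_neq0.
have L12 : L ^+ 2 <= (L + 1) ^+ 2.
  have : 0 <= L by rewrite !addr_ge0 ?cmod_ge0.
  by rewrite !expr2; nra.
have k5 : 0 <= k * 5 by rewrite pmulr_lge0// ltW.
rewrite (le_trans (ler_wpM2l k5 L12))//.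
rewrite /k [leLHS](_ : _ = e * (5 / 6)); last first.
  by field; rewrite gt_eqF.
by lra.
Qed.

(** The integral from a fixed point: by Goursat's lemma its increments are
    integrals along short segments. *)
Lemma primitive : exists F, forall z, A z -> cderiv F z (f z).
Proof.
have [[z0 Az0]|A0] := pselect (A !=set0); last first.
  by exists f => z Az; case: A0; exists z.
exists (seg_int f z0) => z Az; apply/cderivP => e e0.
have [d1 d10 d1P] := (rA.1 z Az); have [d2 d20 d2P] := cf Az e0.
exists (Num.min d1 d2); first by rewrite lt_min d10.
move=> w; rewrite lt_min => /andP[/d1P Aw w2].
have /eqP := goursat Az0 Az Aw; rewrite (seg_int_rev Az0 Aw) subr_eq0 => /eqP <-.
rewrite (_ : _ - _ - _ = seg_int f z w - (f z * w - f z * z)); last by ring.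
apply: (is_seg_int_approx (F' := fun=> f z) (F := fun x => f z * x) (seg_intP Az Aw)).
  by move=> t _; apply: cderiv_eq (cderivMl _ (cderiv_id _)) _; rewrite mulr1.
move=> t t01; apply/ltW/d2P.
rewrite /on_seg addrAC subrr add0r cmodM cmod_rc.
rewrite (le_lt_trans _ w2)// ler_piMl ?cmod_ge0//.
by have /andP[? ?] := t01; rewrite ger0_norm.
Qed.

End InRegion.
End Primitive.

(** * The maximum principle *)

Section MaximumPrinciple.
Variable R : realType.
Notation C := (Cplx R).
Implicit Types (z w : C).
Notation ii := (ii R).

Lemma cderiv_mean (F F' : C -> C) a b (M : R) :
  (forall t : R, 0 <= t <= 1 -> cderiv F (on_seg a b t) (F' (on_seg a b t))) ->
  (forall t : R, 0 <= t <= 1 -> cmod (F' (on_seg a b t)) <= M) ->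
  cmod (F b - F a) <= M * cmod (b - a).
Proof.
move=> dF FM.
have := @rderiv_mean _ (fun t => F (on_seg a b t)) (fun t => F' (on_seg a b t) * (b - a))
  (M * cmod (b - a)).
rewrite /on_seg rc1 rc0 (_ : a + 1 * (b - a) = b); last by ring.
rewrite (_ : a + 0 * (b - a) = a); last by ring.
apply=> t t01; first by apply: cderiv_rderiv; exact: dF.
by rewrite cmodM ler_wpM2r ?cmod_ge0// FM.
Qed.

Lemma cderiv0_cst (A : set C) (F : C -> C) : region A -> (forall z, A z -> cderiv F z 0) ->
  forall a b, A a -> A b -> F a = F b.
Proof.
move=> rA dF a b Aa Ab; apply/eqP; rewrite -subr_eq0 -cmod_eq0 eq_le cmod_ge0 andbT cmodB.
rewrite -(mul0r (cmod (b - a))); apply: (@cderiv_mean _ (fun=> 0)) => t t01.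
  by apply: dF; exact: region_seg t01.
by rewrite cmod0.
Qed.

(** The mean value property on circles, with f merely continuous at the centre
    w. Let Q be a primitive of the periodic function g s = f (w + e^s) on a
    half-plane. Then Q (s + 2 pi i) - Q s has derivative 0, hence is constant,
    and for Re s -> -oo it tends to 2 pi i f w. P is Q along the vertical
    segment over the circle of radius rho. *)
Lemma circle_mean (f : C -> C) w (r rho : R) : 0 < rho < r -> ctn f w ->
  (forall z, 0 < cmod (z - w) < r -> exists l, cderiv f z l) ->
  exists2 P : R -> C,
    forall t : R, rderiv P t (f (w + rc rho * expC (ii * rc t)) * ii) &
    P (pi *+ 2) - P 0 = f w * (ii * rc (pi *+ 2)).
Proof.
move=> /andP[rho0 rhor] cf df; have r0 : 0 < r by rewrite (lt_trans rho0).
pose A : set C := [set s | re s < ln r].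
have rA : region A := region_halfplane (ln r).
have inA s : A s -> 0 < cmod (w + expC s - w) < r.
  rewrite addrAC subrr add0r cmod_expC expR_gt0 /= => As.
  by rewrite -[X in _ < X]lnK ?posrE// ltr_expR.
pose g s := f (w + expC s).
have hg : holo A g.
  move=> s /inA /df[l dl]; exists (l * (0 + expC s)).
  exact: cderiv_comp (cderivD (cderiv_cst w s) (cderiv_expC s)) dl.
have cg s : A s -> ctn g s by move=> /hg[l]; exact: cderiv_ctn.
have [Q dQ] := primitive rA cg hg.
pose p : C := ii * rc (pi *+ 2).
have rep : re p = 0 by rewrite /p !rimE; ring.
have Ap s : A s -> A (s + p) by rewrite /A /= reD rep addr0.
have gp s : g (s + p) = g s.
  by rewrite /g expCD /p -[pi *+ 2]/(pi *+ 2 *~ 1) expC_period mulr1.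
have DQ : forall a b, A a -> A b -> Q (a + p) - Q a = Q (b + p) - Q b.
  apply: (cderiv0_cst (F := fun s => Q (s + p) - Q s) rA) => s As.
  have := cderivB (cderiv_comp (cderivD (cderiv_id s) (cderiv_cst p s)) (dQ _ (Ap _ As))) (dQ _ As).
  by move/cderiv_eq; apply; rewrite gp addr0 mulr1 subrr.
have lim s : A s -> Q (s + p) - Q s = f w * p.
  move=> As; apply/eqP; rewrite -subr_eq0 -cmod_eq0 eq_le cmod_ge0 andbT.
  apply/ler_addgt0Pr => e e0; rewrite add0r.
  have p0 : 0 < cmod p + 1 by rewrite ltr_wpDl// cmod_ge0.
  have [d d0 dP] := cf _ (divr_gt0 e0 p0).
  pose m := Num.min d r / 2.
  have m0 : 0 < m by rewrite divr_gt0// lt_min d0.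
  have mm : m < Num.min d r by rewrite ltr_pdivrMr// ltr_pMr ?ltr1n// lt_min d0.
  have As1 : A (rc (ln m)).
    rewrite /A /= ltr_ln ?posrE//; by apply: lt_le_trans mm _; rewrite ge_min lexx orbT.
  rewrite (DQ _ _ As As1); set s1 := rc (ln m).
  rewrite (_ : _ - _ - _ = (Q (s1 + p) - f w * (s1 + p)) - (Q s1 - f w * s1)); last by ring.
  have sE t : re (on_seg s1 (s1 + p) t) = ln m.
    by rewrite /on_seg !rimE; ring.
  apply: le_trans (_ : e / (cmod p + 1) * cmod (s1 + p - s1) <= _).
    apply: (cderiv_mean (F := fun s => Q s - f w * s) (F' := fun s => g s - f w)) => t t01.
      apply: cderiv_eq (cderivB (dQ _ _) (cderivMl (f w) (cderiv_id _))) _; last by rewrite mulr1.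
      by change (re (on_seg s1 (s1 + p) t) < ln r); rewrite sE; exact: As1.
    apply/ltW/dP; rewrite addrAC subrr add0r cmod_expC sE lnK ?posrE//.
    by apply: lt_le_trans mm _; rewrite ge_min lexx.
  rewrite addrAC subrr add0r mulrAC ler_pdivrMr// ler_pM2l//; lra.
exists (fun t => Q (rc (ln rho) + rc t * ii)).
  move=> t; have As : A (rc (ln rho) + rc t * ii).
    change (re (rc (ln rho) + rc t * ii) < ln r).
    by rewrite !rimE mulr0 mul0r subrr addr0 ltr_ln ?posrE// (lt_trans rho0).
  have := cderiv_rderiv (dQ _ As); congr rderiv; congr (f (w + _) * _).
  rewrite expCD [rc t * ii]mulrC; congr (_ * _).
  by apply: complex_ext; rewrite !(re_expC, im_expC, rimE) ?cos0 ?sin0 ?mulr0 ?mulr1 ?lnK ?posrE.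
have As : A (rc (ln rho)) by rewrite /A /= ltr_ln ?posrE// (lt_trans rho0).
by rewrite rc0 mul0r addr0 [rc (pi *+ 2) * ii]mulrC -/p lim.
Qed.

Lemma real_derivD (f g : R -> R) (t l m : R) : is_derive t (1 : R) f l ->
  is_derive t (1 : R) g m -> is_derive t (1 : R) (fun x => f x + g x) (l + m).
Proof. exact: is_deriveD. Qed.

Lemma cmod_sqrD z w : cmod (z + w) ^+ 2 =
  cmod z ^+ 2 + cmod w ^+ 2 + 2 * (re z * re w + im z * im w).
Proof. by rewrite !cmod_sqr !rimE; ring. Qed.

(** The mean value of Re (c f) + e |z-w0|^2 over a small circle around w
    exceeds its value at w: the first summand has mean value Re (c f w), and
    the second one is strictly subharmonic. The mean value theorem for a
    primitive produces a point where the mean is attained. *)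
Lemma no_interior_max (f : C -> C) (w0 c w : C) (r e : R) : 0 < r -> 0 < e ->
  ctn f w -> (forall z, 0 < cmod (z - w) < r -> exists l, cderiv f z l) ->
  exists2 z, cmod (z - w) < r &
    re (c * f w) + e * cmod (w - w0) ^+ 2 < re (c * f z) + e * cmod (z - w0) ^+ 2.
Proof.
move=> r0 e0 cf df; pose rho := r / 2.
have rho0 : 0 < rho by rewrite divr_gt0.
have rhor : rho < r by rewrite /rho ltr_pdivrMr// ltr_pMr// ltr1n.
have [|P dP EP] := @circle_mean f w r rho _ cf df; first by rewrite rho0.
set k := w - w0; pose zt (t : R) := w + rc rho * expC (ii * rc t).
(* v is a primitive of the function t |-> Re (c f) + e |z-w0|^2 at the point zt
   t of the circle; the factor - ii undoes the derivative i of the angle. *)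
pose v (t : R) := re ((c * - ii) * P t) + e * ((cmod k ^+ 2 + rho ^+ 2) * t
   + 2 * rho * (re k * sin t - im k * cos t)).
have nzt t : cmod (zt t - w0) ^+ 2 = cmod k ^+ 2 + rho ^+ 2 + 2 * rho * (re k * cos t + im k * sin t).
  rewrite /zt (_ : _ - w0 = k + rc rho * expC (ii * rc t)); last by rewrite /k; ring.
  rewrite cmod_sqrD cmodM cmod_rc cmod_expC !(re_expC, im_expC, rimE).
  rewrite (_ : 0 * t - 1 * 0 = 0); last by ring.
  rewrite (_ : 0 * 0 + 1 * t = t); last by ring.
  by rewrite expR0 gtr0_norm//; ring.
have dv (t : R) : is_derive t (1 : R) v (re (c * f (zt t)) + e * cmod (zt t - w0) ^+ 2).
  apply: is_derive_eq.
    apply: real_derivD; first exact: rderiv_re (dP t).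
  congr (_ + _); last by rewrite nzt -![_ *: _]/(_ * _); ring.
  congr re; rewrite -/(zt t) (_ : _ * _ = - (ii * ii) * (c * f (zt t))); last by ring.
  by rewrite ii2; ring.
have pi0 : 0 < pi *+ 2 :> R by rewrite pmulrn_lgt0// pi_gt0.
have [|t _] := @MVT _ v (fun t => re (c * f (zt t)) + e * cmod (zt t - w0) ^+ 2) 0 (pi *+ 2) pi0.
  by apply: derivable_within_continuous => x _; have [] := dv x.
have -> : v (pi *+ 2) - v 0 = (re (c * f w) + e * (cmod k ^+ 2 + rho ^+ 2)) * (pi *+ 2).
  rewrite /v sin2pi cos2pi sin0 cos0.
  rewrite (_ : re (c * f w) = re (c * - ii * (f w * ii))); last first.
    rewrite (_ : _ * (f w * ii) = - (ii * ii) * (c * f w)); last by ring.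
    by rewrite ii2 opprK mul1r.
  have := congr1 (fun x => re (c * - ii * x)) EP.
  rewrite mulrBr reD reN (_ : _ * (f w * _) = rc (pi *+ 2) * (c * - ii * (f w * ii))); last by ring.
  rewrite [re (rc _ * _)]reM re_rc im_rc mul0r subr0 => E.
  have {E} -> : re (c * - ii * P (pi *+ 2)) =
    re (c * - ii * P 0) + pi *+ 2 * re (c * - ii * (f w * ii)) by rewrite -E; ring.
  by ring.
rewrite subr0 => /(mulIf (lt0r_neq0 pi0)) E; exists (zt t).
  rewrite /zt addrAC subrr add0r cmodM cmod_rc cmod_expC !rimE mul0r mulr0 subrr expR0 mulr1.
  by rewrite gtr0_norm.
by rewrite -E mulrDr addrA ltrDl mulr_gt0// exprn_gt0.
Qed.

Lemma isolate (E : seq C) z : exists2 d : R, 0 < d &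
  forall w, 0 < cmod (w - z) < d -> w \notin E.
Proof.
elim: E => [|x E [d d0 dP]]; first by exists 1.
have [->|zx] := eqVneq x z.
  exists d => // w /[dup] /dP wE /andP[w0 _]; rewrite inE negb_or wE andbT.
  by rewrite -subr_eq0 -cmod_eq0 gt_eqF.
exists (Num.min d (cmod (x - z))); first by rewrite lt_min d0 cmod_gt0 subr_eq0.
move=> w /andP[w0]; rewrite lt_min => /andP[wd wx]; rewrite inE negb_or.
rewrite dP ?w0 ?wd// andbT; apply: contraTneq wx => ->; by rewrite ltxx.
Qed.

(** If |f z1| > M inside, rotate f z1 onto its modulus and add a multiple of
    |z-w|^2 that is too small to make up the difference on the boundary. The
    maximum of the sum on the closed disc is then attained inside, which
    [no_interior_max] forbids, also at a point of E since the mean value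
    property needs continuity only at the centre. *)
Lemma max_principle (f : C -> C) w (r M : R) (E : seq C) :
  0 < r -> (forall z, cmod (z - w) <= r -> ctn f z) ->
  (forall z, cmod (z - w) < r -> z \notin E -> exists l, cderiv f z l) ->
  (forall z, cmod (z - w) = r -> cmod (f z) <= M) ->
  forall z, cmod (z - w) <= r -> cmod (f z) <= M.
Proof.
move=> r0 cf df fM z1 z1r; rewrite leNgt; apply/negP => Mz1.
have [c c1 cE] := unit_dir (f z1).
have r20 : 0 < r ^+ 2 by rewrite exprn_gt0.
have [e e0 er] : exists2 e : R, 0 < e & e * r ^+ 2 = (cmod (f z1) - M) / 2.
  exists ((cmod (f z1) - M) / 2 / r ^+ 2); first by rewrite !divr_gt0// subr_gt0.
  by rewrite divfK// gt_eqF.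
pose u z := re (c * f z) + e * cmod (z - w) ^+ 2.
have [||z2 /= z2r z2M] := @compact_max _ [set z : C | cmod (z - w) <= r] u _ (@closed_disc_compact _ w r).
- by exists w; rewrite /= subrr cmod0 ltW.
- move=> z /= zr eps eps0.
  have e20 : 0 < eps / 2 by rewrite divr_gt0.
  have K0 : 0 < cmod c + 1 by rewrite ltr_wpDl// cmod_ge0.
  have [d1 d10 d1P] := cf z zr _ (divr_gt0 e20 K0).
  have L0 : 0 < e * (2 * r + 1) by rewrite mulr_gt0//; lra.
  exists (Num.min d1 (Num.min 1 (eps / 2 / (e * (2 * r + 1))))).
    by rewrite !lt_min d10 ltr01 divr_gt0.
  move=> x; rewrite !lt_min => /and3P[/d1P xz1 xz2 xz3].
  rewrite (_ : _ - _ = re (c * (f x - f z)) +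
     e * ((cmod (x - w) - cmod (z - w)) * (cmod (x - w) + cmod (z - w)))); last first.
    by rewrite /u !rimE; ring.
  rewrite (splitr eps) (le_lt_trans (ler_normD _ _))// ltr_leD//.
    rewrite (le_lt_trans (re_le_cmod _))// cmodM mulrC.
    rewrite (le_lt_trans _ (_ : cmod (f x - f z) * (cmod c + 1) < _))//.
      by rewrite ler_wpM2l ?cmod_ge0// lerDl.
    by rewrite -ltr_pdivlMr.
  rewrite !normrM (gtr0_norm e0).
  have a1 : `|cmod (x - w) - cmod (z - w)| <= cmod (x - z).
    have := cmod_lB (x - w) (z - w); have := cmod_lB (z - w) (x - w).
    rewrite (_ : z - w - _ = z - x); last by ring.
    rewrite (_ : x - w - _ = x - z); last by ring.
    by rewrite [cmod (z - x)]cmodB ler_norml => h1 h2; lra.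
  have a2 : `|cmod (x - w) + cmod (z - w)| <= 2 * r + 1.
    rewrite ger0_norm ?addr_ge0 ?cmod_ge0//.
    by have := cmod_tri z x w; lra.
  have a3 := ler_pM (normr_ge0 _) (normr_ge0 _) a1 a2.
  rewrite (le_trans (ler_wpM2l (ltW e0) a3))//.
  by rewrite mulrCA -ler_pdivlMr// ltW.
have uz1 : M + e * r ^+ 2 < u z1.
  rewrite /u cE er; have : 0 <= e * cmod (z1 - w) ^+ 2 by rewrite mulr_ge0 ?sqr_ge0 ?ltW.
  lra.
have z2lt : cmod (z2 - w) < r.
  rewrite lt_neqAle z2r andbT; apply/negP => /eqP z2E.
  have := z2M z1 z1r; apply/negP; rewrite -ltNge (le_lt_trans _ uz1)// /u z2E lerD2r.
  rewrite (le_trans (re_cmod _))// cmodM (le_trans (ler_wpM2r (cmod_ge0 _) c1))// mul1r.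
  exact: fM.
have [d d0 dP] := isolate E z2.
pose r' := Num.min d (r - cmod (z2 - w)).
have r'0 : 0 < r' by rewrite lt_min d0 subr_gt0.
have [|z zr'] := no_interior_max w c r'0 e0 (cf z2 z2r).
  move=> z /andP[zz0]; rewrite lt_min => /andP[zd zr]; apply: df.
    by have := cmod_tri z2 z w; lra.
  by apply: dP; rewrite zz0.
apply/negP; rewrite -leNgt; apply: z2M => /=.
move: zr'; rewrite lt_min => /andP[_ zr]; have := cmod_tri z2 z w; lra.
Qed.

End MaximumPrinciple.

(** * Removable singularities *)

Section Removable.
Variable R : realType.
Notation C := (Cplx R).
Implicit Types (z w : C).

Lemma ctnB (f g : C -> C) z : ctn f z -> ctn g z -> ctn (fun x => f x - g x) z.
Proof. by move=> /ctnP cf /ctnP cg; apply/ctnP; exact: continuousB cf cg. Qed.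

Lemma ctnM (f g : C -> C) z : ctn f z -> ctn g z -> ctn (fun x => f x * g x) z.
Proof. by move=> /ctnP cf /ctnP cg; apply/ctnP; exact: continuousM cf cg. Qed.

Lemma ctnV (f : C -> C) z : f z != 0 -> ctn f z -> ctn (fun x => (f x)^-1) z.
Proof. by move=> f0 /ctnP cf; apply/ctnP; exact: continuousV f0 cf. Qed.

Lemma ctn_id z : ctn id z. Proof. exact: cderiv_ctn (cderiv_id z). Qed.
Lemma ctn_cst (k : C) z : ctn (fun=> k) z. Proof. exact: cderiv_ctn (cderiv_cst k z). Qed.

Lemma ctn_near (f g : C -> C) z : (exists2 d : R, 0 < d &
  forall w, cmod (w - z) < d -> f w = g w) -> ctn f z -> ctn g z.
Proof.
move=> [d d0 dP] cf e e0; have [d' d'0 d'P] := cf e e0.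
exists (Num.min d d'); first by rewrite lt_min d0.
move=> w; rewrite lt_min => /andP[wd /d'P]; rewrite (dP _ wd) dP//.
by rewrite subrr cmod0.
Qed.

(** The value l at z is meant to be the derivative of f there. *)
Definition quot (f : C -> C) z (l x : C) : C :=
  if x == z then l else (f x - f z) / (x - z).

Lemma quotE (f : C -> C) z l x : f x = f z + (x - z) * quot f z l x.
Proof.
rewrite /quot; case: eqVneq => [->|xz]; first by rewrite subrr mul0r addr0.
by rewrite mulrC divfK ?subr_eq0// addrC subrK.
Qed.

Lemma quot_near (f : C -> C) z l x : x != z -> exists2 d : R, 0 < d &
  forall y, cmod (y - x) < d -> (f y - f z) / (y - z) = quot f z l y.
Proof.
move=> xz; exists (cmod (x - z)); first by rewrite cmod_gt0 subr_eq0.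
move=> y yx; rewrite /quot; case: eqVneq => // yz.
by move: yx; rewrite yz cmodB ltxx.
Qed.

Lemma quot_cderiv (f : C -> C) z l x m : x != z -> cderiv f x m -> exists l', cderiv (quot f z l) x l'.
Proof.
move=> xz df; eexists; apply: cderiv_near (quot_near f l xz) _.
apply: cderiv_div; first by rewrite subr_eq0.
  exact: cderivB df (cderiv_cst _ _).
exact: cderivB (cderiv_id _) (cderiv_cst _ _).
Qed.

Lemma quot_ctn (f : C -> C) z l x : x != z -> ctn f x -> ctn (quot f z l) x.
Proof.
move=> xz cf; apply: ctn_near (quot_near f l xz) _.
apply: ctnM; first exact: ctnB cf (ctn_cst _ _).
apply: (ctnV (f := fun x => x - z)); first by rewrite subr_eq0.
exact: ctnB (ctn_id _) (ctn_cst _ _).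
Qed.

Lemma quot_ctn_at (f : C -> C) z l : cderiv f z l -> ctn (quot f z l) z.
Proof.
move=> /cderivP df e e0; have e20 : 0 < e / 2 by rewrite divr_gt0.
have [d d0 dP] := df _ e20; exists d => // w wd.
rewrite [quot f z l z](_ : _ = l); last by rewrite /quot eqxx.
have [->|wz] := eqVneq w z; first by rewrite /quot eqxx subrr cmod0.
rewrite /quot (negbTE wz).
have wz0 : w - z != 0 by rewrite subr_eq0.
rewrite (_ : _ - l = (f w - f z - l * (w - z)) / (w - z)); last by field.
rewrite cmodM cmodV ltr_pdivrMr ?cmod_gt0// (le_lt_trans (dP _ wd))//.
by rewrite ltr_pM2r ?cmod_gt0//; lra.
Qed.

Section Punctured.
Variables (f : C -> C) (w : C) (r : R).
Hypotheses (r0 : 0 < r) (cf : ctn f w)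
  (df : forall z, 0 < cmod (z - w) < r -> exists l, cderiv f z l).

Let rho := r / 2.
Let rho0 : 0 < rho. Proof. by rewrite divr_gt0. Qed.
Let rhor : rho < r. Proof. by rewrite /rho ltr_pdivrMr// ltr_pMr// ltr1n. Qed.

Let df' z : cmod (z - w) < r -> z != w -> exists l, cderiv f z l.
Proof. by move=> zr zw; apply: df; rewrite zr cmod_gt0 subr_eq0 zw. Qed.

Let cf' z : cmod (z - w) < r -> ctn f z.
Proof.
move=> zr; have [->//|zw] := eqVneq z w.
by have [l] := df' zr zw; exact: cderiv_ctn.
Qed.

Lemma bounded_disc : exists2 M : R, 0 <= M & forall z, cmod (z - w) <= rho -> cmod (f z) <= M.
Proof.
have [||z _ zM] := @sup_cmod _ [set z : C | cmod (z - w) <= rho] f _ (@closed_disc_compact _ w rho).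
- by exists w; rewrite /= subrr cmod0 ltW.
- by move=> z /= zr; apply: cf'; exact: le_lt_trans rhor.
by exists (cmod (f z)); [exact: cmod_ge0|exact: zM].
Qed.

(** Apply the maximum principle to difference quotients of f, with their base
    points and w as exceptional points. On the circle of radius rho they are
    bounded, and so f is Lipschitz near w; knowing this, two of them with base
    points z and y differ on the circle by O(|z-y|), hence also at w. *)
Lemma punctured_estimates : exists2 M : R, 0 <= M &
  forall z, z != w -> cmod (z - w) < rho / 2 ->
  (forall x, cmod (x - w) <= rho -> cmod (f x - f z) <= M * cmod (x - z)) /\
  (forall y, y != w -> cmod (y - w) < rho / 2 ->
    cmod ((f w - f z) / (w - z) - (f w - f y) / (w - y)) <= M * cmod (z - y)).
Proof.
have [M M0 fM] := bounded_disc.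
(* On the circle |x - z| >= rho / 2, whence 2 M / (rho / 2) for a single
   quotient; for the difference of two of them the numerator is at most 8 M
   |z-y| and the denominator at least (rho / 2)^2. *)
pose L := 4 * M / rho; pose K := 32 * M / rho ^+ 2.
have L0 : 0 <= L by rewrite divr_ge0 ?mulr_ge0// ltW.
have K0 : 0 <= K by rewrite divr_ge0 ?mulr_ge0// ?exprn_ge0// ltW.
have zrho z : cmod (z - w) < rho / 2 -> cmod (z - w) < rho.
  by move=> h; apply: lt_trans h _; rewrite ltr_pdivrMr// ltr_pMr// ltr1n.
have far z x : cmod (z - w) < rho / 2 -> cmod (x - w) = rho -> rho / 2 <= cmod (x - z).
  by move=> zr xr; have := cmod_tri z x w; rewrite xr; lra.
have cq z l x : cderiv f z l -> cmod (z - w) < rho -> cmod (x - w) <= rho -> ctn (quot f z l) x.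
  move=> dz zr xr; have [->|xz] := eqVneq x z; first exact: quot_ctn_at.
  by apply: quot_ctn => //; apply: cf'; exact: le_lt_trans rhor.
have step1 z l : z != w -> cmod (z - w) < rho / 2 -> cderiv f z l ->
    forall x, cmod (x - w) <= rho -> cmod (quot f z l x) <= L.
  move=> zw zr dz; apply: (max_principle (E := [:: z; w])) => //.
  - by move=> x; apply: cq => //; exact: zrho.
  - move=> x xr; rewrite !inE negb_or => /andP[xz xw].
    have [m dm] := df' (lt_trans xr rhor) xw; exact: quot_cderiv dm.
  - move=> x xr; have xz : x != z.
      by apply/eqP => xz; have := zrho _ zr; rewrite -xz xr ltxx.
    rewrite /quot (negbTE xz) cmodM cmodV ler_pdivrMr ?cmod_gt0 ?subr_eq0//.
    have h1 : cmod (f x) <= M by apply: fM; rewrite xr.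
    have h2 : cmod (f z) <= M by apply: fM; rewrite ltW// zrho.
    apply: (@le_trans _ _ (2 * M)).
      by rewrite (le_trans (cmodD _ _))// cmodN; lra.
    rewrite (_ : 2 * M = L * (rho / 2)); last by rewrite /L; field; rewrite gt_eqF.
    by rewrite ler_wpM2l// far.
have lip z x : z != w -> cmod (z - w) < rho / 2 -> cmod (x - w) <= rho ->
    cmod (f x - f z) <= L * cmod (x - z).
  move=> zw zr xr; have [l dl] := df' (lt_trans (zrho _ zr) rhor) zw.
  rewrite (quotE f z l x) addrAC subrr add0r cmodM mulrC ler_wpM2r ?cmod_ge0//.
  exact: step1.
exists (Num.max L K); first by rewrite le_max L0.
move=> z zw zr; split=> [x xr|y yw yr].
  by rewrite (le_trans (lip _ _ zw zr xr))// ler_wpM2r ?cmod_ge0// le_max lexx.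
have [l dl] := df' (lt_trans (zrho _ zr) rhor) zw.
have [m dm] := df' (lt_trans (zrho _ yr) rhor) yw.
have := @max_principle _ (fun x => quot f z l x - quot f y m x) w rho (K * cmod (z - y)) [:: z; y; w] rho0.
move=> H; have {H} : forall x, cmod (x - w) <= rho ->
    cmod (quot f z l x - quot f y m x) <= K * cmod (z - y).
  apply: H.
  - by move=> x xr; apply: ctnB; apply: cq => //; exact: zrho.
  - move=> x xr; rewrite !inE !negb_or => /and3P[xz xy xw].
    have [k dk] := df' (lt_trans xr rhor) xw.
    have [k1 ?] := quot_cderiv l xz dk; have [k2 ?] := quot_cderiv m xy dk.
    by exists (k1 - k2); apply: cderivB.
  - move=> x xr; have xz : x != z.
      by apply/eqP => xz; have := zrho _ zr; rewrite -xz xr ltxx.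
    have xy : x != y.
      by apply/eqP => xy; have := zrho _ yr; rewrite -xy xr ltxx.
    rewrite /quot (negbTE xz) (negbTE xy).
    have xz0 : x - z != 0 by rewrite subr_eq0.
    have xy0 : x - y != 0 by rewrite subr_eq0.
    rewrite [X in cmod X <= _](_ : _ = ((f x - f z) * (z - y) - (f z - f y) * (x - z)) /
      ((x - z) * (x - y))); last by field; rewrite xz0 xy0.
    rewrite cmodM cmodV ler_pdivrMr ?cmod_gt0 ?mulf_neq0//.
    have h1 : cmod (f x) <= M by apply: fM; rewrite xr.
    have h2 : cmod (f z) <= M by apply: fM; rewrite ltW// zrho.
    have h3 : cmod (f x - f z) <= 2 * M by rewrite (le_trans (cmodD _ _))// cmodN; lra.
    have h4 : cmod (f z - f y) <= L * cmod (z - y) by apply: lip => //; rewrite ltW// zrho.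
    have h5 : cmod (x - z) <= 3 / 2 * rho.
      by have := cmod_tri w x z; rewrite xr [cmod (w - z)]cmodB; lra.
    have h6 : cmod ((f x - f z) * (z - y) - (f z - f y) * (x - z)) <= 8 * M * cmod (z - y).
      rewrite (le_trans (cmodD _ _))// cmodN !cmodM.
      have a1 := ler_wpM2r (cmod_ge0 (z - y)) h3.
      have a2 := ler_pM (cmod_ge0 _) (cmod_ge0 _) h4 h5.
      have a3 : L * cmod (z - y) * (3 / 2 * rho) = 6 * M * cmod (z - y).
        by rewrite /L; field; rewrite gt_eqF.
      lra.
    rewrite (le_trans h6)// (_ : 8 * M * _ = K * cmod (z - y) * (rho / 2 * (rho / 2))); last first.
      by rewrite /K; field; rewrite gt_eqF.
    apply: ler_wpM2l; first by apply: mulr_ge0 => //; exact: cmod_ge0.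
    by rewrite cmodM ler_pM ?far// divr_ge0// ltW.
move=> /(_ w); rewrite subrr cmod0 => /(_ (ltW rho0)).
rewrite /quot ![w == _]eq_sym (negbTE zw) (negbTE yw) => h.
by rewrite (le_trans h)// ler_wpM2r ?cmod_ge0// le_max lexx orbT.
Qed.

(** Riemann's theorem on removable singularities. By [punctured_estimates] the
    difference quotient of f at w is a Lipschitz function of the other point;
    so it converges. *)
Lemma removable : exists l, cderiv f w l.
Proof.
have [M M0 HM] := punctured_estimates.
pose Q z := (f w - f z) / (w - z).
pose u n : C := w + rc (rho / 4 / 2 ^+ n).
have P2 n : 0 < 2 ^+ n :> R by rewrite exprn_gt0.
have un n : cmod (u n - w) = rho / 4 / 2 ^+ n.
  by rewrite /u addrAC subrr add0r cmod_rc gtr0_norm// !divr_gt0.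
have uw n : u n != w by rewrite -subr_eq0 -cmod_eq0 un gt_eqF// !divr_gt0.
have ur n : cmod (u n - w) < rho / 2.
  rewrite un; apply: (@le_lt_trans _ _ (rho / 4)).
    have r4 : 0 <= rho / 4 by apply: divr_ge0 => //; exact: ltW.
    have n1 : 1 <= 2 ^+ n :> R by rewrite exprn_ege1// ler1n.
    by rewrite ler_pdivrMr// ler_peMr.
  by have := rho0; lra.
have [|l lP] := @geometric_limit_C _ (fun n => Q (u n)) (M * rho).
  move=> n; have [_ /(_ (u n) (uw n) (ur n)) h] := HM (u n.+1) (uw _) (ur _).
  rewrite (le_trans h)// -mulrA ler_wpM2l//.
  rewrite /u opprD addrACA subrr add0r -rcB cmod_rc exprS ler_norml.
  set t := rho / 4 / 2 ^+ n.
  have t0 : 0 < t by rewrite !divr_gt0.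
  have -> : rho / 4 / (2 * 2 ^+ n) = t / 2 by rewrite /t; field; rewrite gt_eqF.
  have -> : rho / 2 ^+ n = 4 * t by rewrite /t; field; rewrite gt_eqF.
  by apply/andP; split; lra.
have QL z : z != w -> cmod (z - w) < rho / 2 -> cmod (Q z - l) <= M * cmod (z - w).
  move=> zw zr; apply/ler_addgt0Pr => e e0.
  have [n nP] : exists n : nat, (M * rho / 4 + 4 * (M * rho)) / e < n%:R.
    by exists (Num.truncn ((M * rho / 4 + 4 * (M * rho)) / e)).+1; rewrite truncnS_gt.
  have {}nP : (M * rho / 4 + 4 * (M * rho)) / 2 ^+ n <= e.
    rewrite ler_pdivrMr// [e * _]mulrC -ler_pdivrMr// (le_trans (ltW nP))//.
    by rewrite -natrX ler_nat ltnW// ltn_expl.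
  have [_ /(_ (u n) (uw n) (ur n)) h] := HM z zw zr.
  have h2 := lP n; have h3 := cmod_tri (Q (u n)) (Q z) l.
  have h4 := cmod_tri w z (u n).
  have h5 := ler_wpM2l M0 h4; rewrite [cmod (w - u n)]cmodB un mulrDr in h5.
  have E : M * (rho / 4 / 2 ^+ n) + 4 * (M * rho) / 2 ^+ n =
    (M * rho / 4 + 4 * (M * rho)) / 2 ^+ n by ring.
  rewrite -/(Q z) -/(Q (u n)) in h; lra.
exists l; apply/cderivP => e e0.
have M1 : 0 < M + 1 by rewrite ltr_wpDl.
exists (Num.min (rho / 2) (e / (M + 1))).
  by rewrite lt_min !divr_gt0.
move=> z; rewrite lt_min => /andP[zr ze].
have [->|zw] := eqVneq z w; first by rewrite !subrr mulr0 subrr cmod0 mulr0.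
have wz0 : w - z != 0 by rewrite subr_eq0 eq_sym.
rewrite (_ : _ - _ - _ = (Q z - l) * (z - w)); last by rewrite /Q; field.
rewrite cmodM ler_wpM2r ?cmod_ge0// (le_trans (QL z zw zr))//.
have MM : M <= M + 1 by rewrite lerDl.
by rewrite (le_trans (ler_wpM2r (cmod_ge0 _) MM))// mulrC -ler_pdivlMr// ltW.
Qed.

End Punctured.

Lemma cderiv_lip_bound (f : C -> C) z l (L d : R) : 0 < d -> cderiv f z l ->
  (forall w, cmod (w - z) < d -> cmod (f w - f z) <= L * cmod (w - z)) -> cmod l <= L.
Proof.
move=> d0 /cderivP df fL; apply/ler_addgt0Pr => e e0.
have [d' d'0 dP] := df _ e0.
pose m := Num.min d d' / 2.
have mm0 : 0 < Num.min d d' by rewrite lt_min d0.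
have m0 : 0 < m by rewrite divr_gt0.
have mm : m < Num.min d d' by rewrite ltr_pdivrMr// ltr_pMr ?ltr1n.
have zE : z + rc m - z = rc m by ring.
have := dP (z + rc m); have := fL (z + rc m); rewrite zE cmod_rc gtr0_norm//.
move=> h1 h2.
have {}h1 : cmod (f (z + rc m) - f z) <= L * m.
  by apply: h1; apply: lt_le_trans mm _; rewrite ge_min lexx.
have {}h2 : cmod (f (z + rc m) - f z - l * rc m) <= e * m.
  by apply: h2; apply: lt_le_trans mm _; rewrite ge_min lexx orbT.
rewrite -(ler_pM2r m0) mulrDl.
have := cmod_lB (l * rc m) (f (z + rc m) - f z).
rewrite cmodM cmod_rc gtr0_norm// [cmod (l * rc m - _)]cmodB; lra.
Qed.

(** Away from w the quotient is holomorphic, and at w it is continuous, so that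
    [removable] applies. *)
Lemma holo_quot (A : set C) (f : C -> C) w : copen A -> holo A f -> A w ->
  exists2 q, holo A q & forall x, f x = f w + (x - w) * q x.
Proof.
move=> oA hf Aw; have [l dl] := hf w Aw.
exists (quot f w l); last by move=> x; exact: quotE.
have off z : A z -> z != w -> exists l', cderiv (quot f w l) z l'.
  by move=> Az zw; have [m dm] := hf z Az; exact: quot_cderiv dm.
move=> z Az; have [->|zw] := eqVneq z w; last exact: off.
have [r r0 rA] := oA w Aw; apply: (removable r0); first exact: quot_ctn_at.
move=> x /andP[x0 xr]; apply: off; first exact: rA.
by rewrite -subr_eq0 -cmod_eq0 gt_eqF.
Qed.

(** A holomorphic function is locally Lipschitz, and a Lipschitz constant
    bounds derivatives. *)
Lemma holo_deriv_bounded (A : set C) (f : C -> C) w : copen A -> holo A f -> A w ->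
  exists L, exists2 d : R, 0 < d &
    forall z l, cmod (z - w) < d -> z != w -> cderiv f z l -> cmod l <= L.
Proof.
move=> oA hf Aw; have [r r0 rA] := oA w Aw.
have [l0 /cderiv_ctn cf] := hf w Aw.
have [|M M0 HM] := punctured_estimates r0 cf.
  by move=> z /andP[_ zr]; apply: hf; apply: rA.
exists M, (r / 2 / 2); first by rewrite !divr_gt0.
move=> z l zr zw dl; have [lip _] := HM z zw zr.
apply: (cderiv_lip_bound (d := r / 2 / 2)) dl _; first by rewrite !divr_gt0.
by move=> x xz; apply: lip; have := cmod_tri z x w; lra.
Qed.

(** Write f x = f w + (x - w) (q w + (x - w) q2 x) with q2 holomorphic and
    differentiate: (f' x - f' w) / (x - w) = 2 q2 x + (x - w) q2' x, which
    tends to 2 q2 w because q2' is bounded near w. *)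
Lemma holo_deriv (A : set C) (f f' : C -> C) : copen A ->
  (forall z, A z -> cderiv f z (f' z)) -> holo A f'.
Proof.
move=> oA df w Aw; have hf : holo A f by move=> z /df; exists (f' z).
have [q hq qE] := holo_quot oA hf Aw.
have [q2 hq2 q2E] := holo_quot oA hq Aw.
have [L [d d0 LP]] := holo_deriv_bounded oA hq2 Aw.
have [r r0 rA] := oA w Aw.
have [l0 /cderiv_ctn cq2] := hq2 w Aw.
have f'E z m : A z -> cderiv q2 z m -> f' z = q w + (z - w) * (2 * q2 z + (z - w) * m).
  move=> Az dm; apply: cderiv_uniq (df z Az) _.
  apply: cderiv_ext (_ : cderiv (fun x => f w + (x - w) * (q w + (x - w) * q2 x)) z _).
    by move=> x; rewrite -q2E -qE.
  have dw := cderivB (cderiv_id z) (cderiv_cst w z).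
  apply: cderiv_eq (cderivD (cderiv_cst _ _) (cderivM dw (cderivD (cderiv_cst _ _) (cderivM dw dm)))) _.
  by rewrite /=; ring.
exists (2 * q2 w); apply/cderivP => e e0.
have f'w : f' w = q w.
  by have [m /f'E -> //] := hq2 w Aw; rewrite subrr mul0r addr0.
have e4 : 0 < e / 4 by rewrite divr_gt0.
have [d2 d20 d2P] := cq2 _ e4.
have L1 : 0 < `|L| + 1 by rewrite ltr_wpDl.
exists (Num.min (Num.min r d) (Num.min d2 (e / 4 / (`|L| + 1)))).
  by rewrite !lt_min r0 d0 d20 divr_gt0.
move=> z; rewrite !lt_min => /andP[/andP[zr zd] /andP[/d2P zd2 ze]].
have [->|zw] := eqVneq z w; first by rewrite !subrr mulr0 subrr cmod0 mulr0.
have [m dm] := hq2 z (rA _ zr).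
rewrite (f'E z m (rA _ zr) dm) f'w.
rewrite (_ : _ - _ - _ = (2 * (q2 z - q2 w) + (z - w) * m) * (z - w)); last by ring.
rewrite cmodM ler_wpM2r ?cmod_ge0// (le_trans (cmodD _ _))// !cmodM -(rc_nat _ 2) cmod_rc ger0_norm//.
have mL : cmod m <= `|L| + 1.
  by have := LP z m zd zw dm; have := ler_norm L; lra.
have := ler_pM (cmod_ge0 _) (cmod_ge0 _) (ltW ze) mL.
by rewrite divfK ?gt_eqF//; lra.
Qed.

End Removable.

(** * Zeros, univalent functions and logarithms *)

Section Univalent.
Variable R : realType.
Notation C := (Cplx R).
Implicit Types (z w : C).

Lemma holo_ctn (A : set C) (f : C -> C) z : holo A f -> A z -> ctn f z.
Proof. by move=> hf /hf[l]; exact: cderiv_ctn. Qed.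

Lemma holo_derivative (A : set C) (f : C -> C) : holo A f ->
  exists f', forall z, A z -> cderiv f z (f' z).
Proof.
move=> hf; have /choice[f' f'P] : forall z, exists l, A z -> cderiv f z l.
  move=> z; have [/hf[l]|nA] := pselect (A z); first by exists l.
  by exists 0.
by exists f'.
Qed.

(** If f could be divided by every power of x - w, the quotients being q_n,
    then the maximum principle would give |q_n| <= M / rho^n with M a bound of
    f on the circle of radius rho = r / 2; so |f z| <= M (|z-w| / rho)^n for
    all n. *)
Lemma zero_order (A : set C) (f : C -> C) w (r : R) : copen A -> holo A f ->
  0 < r -> (forall z, cmod (z - w) < r -> A z) ->
  (forall z, cmod (z - w) < r / 2 -> f z = 0) \/
  exists (k : nat) (g : C -> C), [/\ holo A g, g w != 0 & forall x, f x = (x - w) ^+ k * g x].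
Proof.
move=> oA hf r0 rA; have Aw : A w by apply: rA; rewrite subrr cmod0.
have [|no] := pselect (exists (k : nat) (g : C -> C),
  [/\ holo A g, g w != 0 & forall x, f x = (x - w) ^+ k * g x]); first by right.
left; have div n : exists2 q, holo A q & forall x, f x = (x - w) ^+ n * q x.
  elim: n => [|n [q hq qE]]; first by exists f => // x; rewrite mul1r.
  have [q2 hq2 q2E] := holo_quot oA hq Aw; exists q2 => // x.
  have [q0|q0] := eqVneq (q w) 0; last by case: no; exists n, q.
  by rewrite qE q2E q0 add0r exprSr mulrA.
have rho0 : 0 < r / 2 by rewrite divr_gt0.
have rhor : r / 2 < r by rewrite ltr_pdivrMr// ltr_pMr// ltr1n.
have [M M0 fM] := bounded_disc r0 (holo_ctn hf Aw) (fun z zr => hf z (rA z (proj2 (andP zr)))).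
move=> z zr; apply/eqP; rewrite -cmod_eq0 eq_le cmod_ge0 andbT.
set t := cmod (z - w) / (r / 2).
have t0 : 0 <= t by rewrite divr_ge0 ?cmod_ge0// ltW.
have t1 : t < 1 by rewrite ltr_pdivrMr// mul1r.
have bd n : cmod (f z) <= M * t ^+ n.
  have [q hq qE] := div n; rewrite qE cmodM cmodX /t expr_div_n mulrCA ler_wpM2l ?exprn_ge0 ?cmod_ge0//.
  apply: (max_principle (E := [::]) rho0) (ltW zr).
  - by move=> x xr; apply: holo_ctn hq (rA _ _); exact: le_lt_trans rhor.
  - by move=> x xr _; apply/hq/rA; exact: lt_trans rhor.
  - move=> x xr; rewrite ler_pdivlMr ?exprn_gt0// -xr -cmodX -cmodM mulrC -qE.
    by apply: fM; rewrite xr.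
apply/ler_addgt0Pr => e e0; rewrite add0r.
have [tz|tz] := eqVneq t 0.
  by have := bd 1%N; rewrite expr1 tz mulr0 => /le_trans; apply; exact: ltW.
have tp : 0 < t by rewrite lt_def tz t0.
have /cvgrPdist_le/(_ (e / (M + 1))) : (fun n => t ^+ n) @ \oo --> (0 : R).
  by apply: cvg_expr; rewrite ger0_norm.
rewrite divr_gt0// ?ltr_wpDl// => /(_ isT)[N _ /(_ N (leqnn N))].
rewrite sub0r normrN ger0_norm ?exprn_ge0// => h.
rewrite (le_trans (bd N))// (le_trans (_ : _ <= (M + 1) * t ^+ N))//.
  by rewrite ler_wpM2r ?exprn_ge0// lerDl.
by rewrite mulrC -ler_pdivlMr// ltr_wpDl.
Qed.

Lemma ctn_neq0 (g : C -> C) w : ctn g w -> g w != 0 ->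
  exists2 d : R, 0 < d & forall z, cmod (z - w) < d -> g z != 0.
Proof.
move=> cg g0; have [d d0 dP] := cg (cmod (g w)) ltac:(by rewrite cmod_gt0).
exists d => // z /dP; apply: contraTneq => ->.
by rewrite sub0r cmodN ltxx.
Qed.

Lemma isolated_zeros (A : set C) (f : C -> C) w (r : R) : copen A -> holo A f ->
  0 < r -> (forall z, cmod (z - w) < r -> A z) ->
  (forall z, cmod (z - w) < r / 2 -> f z = 0) \/
  exists2 d : R, 0 < d & forall z, 0 < cmod (z - w) < d -> f z != 0.
Proof.
move=> oA hf r0 rA; have Aw : A w by apply: rA; rewrite subrr cmod0.
have [|[k [g [hg g0 fE]]]] := zero_order oA hf r0 rA; [by left|right].
have [d d0 dP] := ctn_neq0 (holo_ctn hg Aw) g0; exists d => // z /andP[z0 zd].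
by rewrite fE mulf_neq0 ?dP// expf_neq0// -cmod_eq0 gt_eqF.
Qed.

(** If v is close to f w and not attained, then 1 / (f - v) is holomorphic, but
    its modulus at w is larger than on a small circle, where f stays away from
    f w. *)
Lemma open_at (f : C -> C) w (r : R) : 0 < r ->
  (forall z, cmod (z - w) < r -> exists l, cderiv f z l) ->
  (forall z, 0 < cmod (z - w) < r -> f z != f w) ->
  exists2 d : R, 0 < d & forall v, cmod (v - f w) < d ->
    exists2 z, cmod (z - w) < r & f z = v.
Proof.
move=> r0 df fw; pose s := r / 2.
have s0 : 0 < s by rewrite divr_gt0.
have sr : s < r by rewrite /s ltr_pdivrMr// ltr_pMr// ltr1n.
have cf z : cmod (z - w) <= s -> ctn f z.
  by move=> zs; have [l] := df z (le_lt_trans zs sr); exact: cderiv_ctn.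
have [||z1 /= z1s z1m] := @inf_cmod _ [set z : C | cmod (z - w) = s] (fun z => f z - f w) _ (@circle_compact _ w s).
- by exists (w + rc s); rewrite /= addrAC subrr add0r cmod_rc gtr0_norm.
- by move=> z /= zs; apply: ctnB (cf _ _) (ctn_cst _ _); rewrite zs.
set m := cmod (f z1 - f w) in z1m.
have m0 : 0 < m by rewrite cmod_gt0 subr_eq0 fw// z1s s0.
have m20 : 0 < m / 2 by apply: divr_gt0.
exists (m / 2) => //.
move=> v vd; apply: contrapT => nov.
have fv z : cmod (z - w) < r -> f z - v != 0.
  by move=> zr; rewrite subr_eq0; apply/eqP => fz; apply: nov; exists z.
have : cmod ((f w - v)^-1) <= 2 / m.
  have H := @max_principle _ (fun z => (f z - v)^-1) w s (2 / m) [::] s0.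
  apply: H; last by rewrite subrr cmod0 ltW.
  - move=> z zs; apply: (ctnV (f := fun z => f z - v)); first exact: fv (le_lt_trans zs sr).
    exact: ctnB (cf _ zs) (ctn_cst _ _).
  - move=> z zs _; have [l dl] := df z (lt_trans zs sr).
    eexists; apply: cderivV (cderivB dl (cderiv_cst v z)); exact: fv (lt_trans zs sr).
  - move=> z zs; rewrite cmodV -[2 / m]invf_div lef_pV2 ?posrE ?m20 ?cmod_gt0 ?fv ?zs//.
    have h1 := cmod_tri v (f z) (f w); have h2 := z1m z zs; lra.
have fvw : 0 < cmod (f w - v) by rewrite cmod_gt0 fv// subrr cmod0.
rewrite cmodV -[2 / m]invf_div lef_pV2 ?posrE// cmodB; lra.
Qed.

Lemma cderiv_inverse (f g : C -> C) z l : cderiv f z l -> l != 0 -> g (f z) = z ->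
  ctn g (f z) -> (exists2 r : R, 0 < r & forall v, cmod (v - f z) < r -> f (g v) = v) ->
  cderiv g (f z) l^-1.
Proof.
move=> /cderivP df l0 gf cg [r r0 rP]; apply/cderivP => e e0.
have nl : 0 < cmod l by rewrite cmod_gt0.
have [d d0 dP] := df (Num.min (cmod l / 2) (e * cmod l * cmod l / 2))
  ltac:(by rewrite lt_min !divr_gt0// !mulr_gt0).
have [d2 d20 d2P] := cg d d0.
exists (Num.min r d2); first by rewrite lt_min r0.
move=> v; rewrite lt_min => /andP[/rP vE /d2P]; rewrite gf => /dP.
rewrite vE; set x := g v; set N := cmod (x - z); set q := cmod (v - f z) => h.
have N0 : 0 <= N := cmod_ge0 _; have q0 : 0 <= q := cmod_ge0 _.
have h1 : cmod (v - f z - l * (x - z)) <= cmod l / 2 * N.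
  by rewrite (le_trans h)// ler_wpM2r// ge_min lexx.
have h2 : cmod (v - f z - l * (x - z)) <= e * cmod l * cmod l / 2 * N.
  by rewrite (le_trans h)// ler_wpM2r// ge_min lexx orbT.
have h3 : cmod l * N <= 2 * q.
  have := cmod_lB (l * (x - z)) (v - f z); rewrite cmodM [cmod (l * _ - _)]cmodB -/q -/N; lra.
rewrite (_ : _ - _ - _ = - (l^-1 * (v - f z - l * (x - z)))); last by field.
rewrite cmodN cmodM cmodV mulrC ler_pdivrMr// (le_trans h2)//.
have := ler_wpM2l (ltW (mulr_gt0 e0 nl)) h3; lra.
Qed.

Section Univalent.
Variables (A : set C) (f g : C -> C).
Hypotheses (oA : copen A) (hf : holo A f)
  (fI : forall x y, A x -> A y -> f x = f y -> x = y)
  (gf : forall z, A z -> g (f z) = z).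

Lemma univalent_open_at w (r : R) : A w -> 0 < r -> exists2 d : R, 0 < d &
  forall v, cmod (v - f w) < d -> exists z, [/\ A z, cmod (z - w) < r & f z = v].
Proof.
move=> Aw r0; have [s s0 sA] := oA Aw.
pose m := Num.min r s; have m0 : 0 < m by rewrite lt_min r0.
have mA z : cmod (z - w) < m -> A z by rewrite lt_min => /andP[_ /sA].
have [||d d0 dP] := @open_at f w m m0.
- by move=> z /mA; exact: hf.
- move=> z /andP[z0 /mA Az]; apply/eqP => fz.
  by move: z0; rewrite (fI Az Aw fz) subrr cmod0 ltxx.
exists d => // v /dP[z zm <-]; exists z; split=> //; first exact: mA.
by move: zm; rewrite lt_min => /andP[].
Qed.

Lemma univalent_image_open : copen (f @` A).
Proof.
move=> _ [w Aw <-]; have [d d0 dP] := univalent_open_at Aw ltr01.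
by exists d => // v /dP[z [Az _ <-]]; exists z.
Qed.

Lemma univalent_inv_ctn z : A z -> ctn g (f z).
Proof.
move=> Az e e0; have [d d0 dP] := univalent_open_at Az e0.
by exists d => // v /dP[x [Ax xz <-]]; rewrite !gf.
Qed.

Lemma univalent_inv_near z : A z -> exists2 r : R, 0 < r &
  forall v, cmod (v - f z) < r -> f (g v) = v.
Proof.
move=> Az; have [r r0 rP] := univalent_image_open (ex_intro2 _ _ z Az erefl).
by exists r => // v /rP[x Ax <-]; rewrite gf.
Qed.

(** As f is not locally constant, its derivative has isolated zeros. Off the
    corresponding values the inverse g is holomorphic, and it is continuous, so
    its singularities are removable; now differentiate g (f z) = z. *)
Lemma univalent_deriv_neq0 z l : A z -> cderiv f z l -> l != 0.
Proof.
move=> Az dl; have [f' df'] := holo_derivative hf.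
have hf' := holo_deriv oA df'.
have [r r0 rA] := oA Az.
have [f'0|[d d0 dP]] := isolated_zeros oA hf' r0 rA.
  have r20 : 0 < r / 2 by rewrite divr_gt0.
  have rr : r / 2 < r by rewrite ltr_pdivrMr// ltr_pMr// ltr1n.
  pose x := z + rc (r / 2 / 2).
  have xz : cmod (x - z) = r / 2 / 2.
    by rewrite /x addrAC subrr add0r cmod_rc gtr0_norm// !divr_gt0.
  have xr : cmod (x - z) < r / 2 by rewrite xz; lra.
  have : f x = f z.
    apply: (cderiv0_cst (A := [set y | cmod (y - z) < r / 2])) => //=.
    - exact: region_ball.
    - by move=> y /= yr; rewrite -(f'0 y yr); apply/df'/rA/(lt_trans yr).
    - by rewrite subrr cmod0.
  move/(fI (rA _ (lt_trans xr rr)) Az) => xzE.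
  by move: xz; rewrite xzE subrr cmod0 => xz; exfalso; lra.
pose m := Num.min r d; have m0 : 0 < m by rewrite lt_min r0.
have [e e0 eP] := univalent_open_at Az m0.
have [|k dk] := @removable _ g (f z) e e0 (univalent_inv_ctn Az).
  move=> v /andP[v0 /eP[x [Ax xm fx]]]; rewrite -fx.
  have xz : 0 < cmod (x - z).
    rewrite cmod_gt0 subr_eq0; apply: contraTneq v0 => xz.
    by rewrite -fx xz subrr cmod0 ltxx.
  move: xm; rewrite lt_min => /andP[_ xd].
  exists (f' x)^-1; apply: (cderiv_inverse (df' _ Ax)) => //.
  - by apply: dP; rewrite xz.
  - exact: gf.
  - exact: univalent_inv_ctn.
  - exact: univalent_inv_near.
have := cderiv_comp dl dk => /(cderiv_near (g := id)) H.
have E : k * l = 1.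
  apply: cderiv_uniq (H _) (cderiv_id z); exists r => // x /rA Ax; exact: gf.
by apply/eqP => l0; move: E; rewrite l0 mulr0 => /eqP; rewrite eq_sym oner_eq0.
Qed.

End Univalent.

(** A primitive L of f' / f makes e^-L f constant. *)
Lemma holo_log (A : set C) (f : C -> C) : region A -> holo A f ->
  (forall z, A z -> f z != 0) ->
  exists2 L, holo A L & forall z, A z -> expC (L z) = f z.
Proof.
move=> rA hf f0; have [f' df'] := holo_derivative hf.
have hf' := holo_deriv rA.1 df'.
have hq : holo A (fun z => f' z / f z).
  by move=> z Az; have [l dl] := hf' z Az; eexists; apply: cderiv_div dl (df' _ Az); exact: f0.
have [L dL] := primitive rA (fun z Az => holo_ctn hq Az) hq.
have [[z0 Az0]|A0] := pselect (A !=set0); last first.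
  by exists (fun=> 0) => z Az; case: A0; exists z.
pose E z := expC (- L z) * f z.
have dE z : A z -> cderiv E z 0.
  move=> Az; apply: cderiv_eq (cderivM (cderiv_comp (cderivN (dL _ Az)) (cderiv_expC _)) (df' _ Az)) _.
  by have := f0 z Az => f0z; rewrite /=; field.
have E0 : E z0 != 0 by rewrite mulf_neq0 ?expC_neq0 ?f0.
have [s sE] := expC_surj E0; exists (fun z => L z + s).
  by move=> z Az; eexists; apply: cderivD (dL _ Az) (cderiv_cst s z).
move=> z Az; rewrite expCD sE -(cderiv0_cst rA dE Az Az0) /E mulrA expCN divff ?mul1r//.
exact: expC_neq0.
Qed.

End Univalent.

(** * Finite Blaschke products *)

Section Blaschke.
Variable R : realType.
Notation C := (Cplx R).
Implicit Types (z w : C).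
Notation D := (@disc R).

Lemma holoP (A : set C) (f : C -> C) : holomorphic_on A f <-> holo A f.
Proof. by split=> hf z /hf /derivable_cderiv. Qed.

Lemma discE : D = [set w | cmod (w - 0) < 1].
Proof. by apply/seteqP; split=> z /=; rewrite subr0 => /discP. Qed.

Lemma disc_region : region D.
Proof. by rewrite discE; exact: region_ball. Qed.

Lemma disc0 : D 0. Proof. by apply/discP; rewrite cmod0. Qed.

(** The order k may be 0, and it depends only on f near z. *)
Definition order_at (f : C -> C) z (k : nat) := exists q : C -> C,
  q z != 0 /\ exists2 r : R, 0 < r & forall x, cmod (x - z) < r ->
    (exists l, cderiv q x l) /\ f x = (x - z) ^+ k * q x.

Lemma ctn_eq (f g : C -> C) z (r : R) : 0 < r -> ctn f z -> ctn g z ->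
  (forall x, 0 < cmod (x - z) < r -> f x = g x) -> f z = g z.
Proof.
move=> r0 cf cg fg; apply/eqP; rewrite -subr_eq0 -cmod_eq0 eq_le cmod_ge0 andbT.
apply/ler_addgt0Pr => e e0; rewrite add0r.
have e20 : 0 < e / 2 by rewrite divr_gt0.
have [a a0 aP] := cf _ e20; have [b b0 bP] := cg _ e20.
pose m := Num.min r (Num.min a b).
have m0 : 0 < m by rewrite !lt_min r0 a0.
pose x := z + rc (m / 2).
have xz : cmod (x - z) = m / 2 by rewrite /x addrAC subrr add0r cmod_rc gtr0_norm// divr_gt0.
have : cmod (x - z) < m by rewrite xz; lra.
rewrite !lt_min => /and3P[xr /aP h1 /bP h2].
have xx : f x = g x by apply: fg; rewrite xr xz divr_gt0.
rewrite (_ : f z - g z = (g x - g z) - (f x - f z)); last by rewrite xx; ring.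
by rewrite (le_trans (cmodD _ _))// cmodN; lra.
Qed.

(** Zeros are divided out one at a time; the order at z drops by one and the
    orders elsewhere do not change. *)
Lemma factor_zeros (A : set C) (zs : seq C) (f : C -> C) : copen A -> holo A f ->
  (forall z, z \in zs -> A z) -> (forall z, A z -> order_at f z (count_mem z zs)) ->
  exists u, [/\ holo A u, forall z, A z -> u z != 0 &
    forall x, f x = (\prod_(z <- zs) (x - z)) * u x].
Proof.
move=> oA; elim: zs f => [|z zs IH] f hf zA of_.
  exists f; split=> // [z Az|x]; last by rewrite big_nil mul1r.
  have [q [q0 [r r0 /(_ z)]]] := of_ z Az.
  by rewrite subrr cmod0 => /(_ r0)[_ ->]; rewrite mul1r.
have Az : A z by apply: zA; rewrite inE eqxx.
have fz : f z = 0.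
  have [q [q0 [r r0 /(_ z)]]] := of_ z Az.
  by rewrite subrr cmod0 => /(_ r0)[_ ->]; rewrite /= eqxx exprS !mul0r.
have [q hq qE] := holo_quot oA hf Az; rewrite fz in qE.
have [||u [hu u0 uE]] := IH q hq.
- by move=> y yzs; apply: zA; rewrite inE yzs orbT.
- move=> w Aw; have [p [p0 [r r0 rP]]] := of_ w Aw.
  have [wz|wz] := eqVneq w z; last first.
    rewrite /= eq_sym (negbTE wz) add0n in rP.
    exists (fun x => p x / (x - z)); split.
      by rewrite mulf_neq0// invr_eq0 subr_eq0.
    exists (Num.min r (cmod (w - z))); first by rewrite lt_min r0 cmod_gt0 subr_eq0.
    move=> x; rewrite lt_min => /andP[/rP[[l dl] fx] xw].
    have xz : x - z != 0.
      rewrite subr_eq0; apply: contraTneq xw => ->.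
      by rewrite cmodB ltxx.
    split; first by eexists; apply: cderiv_div dl (cderivB (cderiv_id x) (cderiv_cst z x)).
    by apply: (mulfI xz); rewrite -[LHS]add0r -qE fx; field.
  subst w; rewrite /= eqxx add1n in rP; exists p; split=> //.
  exists r => // x xr; have [dp fx] := rP x xr; split=> //.
  have key y : cmod (y - z) < r -> y != z -> q y = (y - z) ^+ count_mem z zs * p y.
    move=> yr yz; have [_ fy] := rP y yr.
    have yz0 : y - z != 0 by rewrite subr_eq0.
    by apply: (mulfI yz0); rewrite -[LHS]add0r -qE fy exprS mulrA.
  have [xz|] := eqVneq x z; last exact: key.
  subst x; apply: (ctn_eq (f := q) (g := fun x => (x - z) ^+ count_mem z zs * p x) r0).
  - exact: holo_ctn hq Az.
  - by have [l dl] := dp; exact: cderiv_ctn (cderivM (cderivX _ (cderivB (cderiv_id z) (cderiv_cst z z))) dl).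
  - by move=> y /andP[y0 yr]; apply: key; rewrite // -subr_eq0 -cmod_eq0 gt_eqF.
exists u; split=> // x.
by rewrite qE add0r uE big_cons mulrA.
Qed.

(** Unlike the radial limits of an inner function, |F| tends to 1 uniformly at
    the circle; this is what properness gives. *)
Definition inner_bdry (F : C -> C) := (forall x, D x -> cmod (F x) <= 1) /\
  forall e : R, 0 < e -> exists2 rho : R, rho < 1 & forall x, rho < cmod x -> D x ->
    1 - e <= cmod (F x).

Lemma inner_bdryM F G : inner_bdry F -> inner_bdry G -> inner_bdry (fun x => F x * G x).
Proof.
move=> [F1 Fb] [G1 Gb]; split=> [x Dx|e e0].
  by rewrite cmodM -(mulr1 1) ler_pM ?cmod_ge0 ?F1 ?G1.
have e20 : 0 < e / 2 by rewrite divr_gt0.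
have [a a1 aP] := Fb _ e20; have [b b1 bP] := Gb _ e20.
exists (Num.max a b); first by rewrite gt_max a1.
move=> x; rewrite gt_max => /andP[/aP h1 /bP h2] Dx.
have {}h1 := h1 Dx; have {}h2 := h2 Dx; have h3 := F1 x Dx; have h4 := G1 x Dx.
by rewrite cmodM; have := cmod_ge0 (F x); have := cmod_ge0 (G x); nra.
Qed.

Lemma inner_bdry_ext F G : (forall x, D x -> F x = G x) -> inner_bdry F -> inner_bdry G.
Proof.
move=> FG [F1 Fb]; split=> [x Dx|e /Fb[rho r1 rP]]; first by rewrite -FG ?F1.
by exists rho => // x xr Dx; rewrite -FG ?rP.
Qed.

(** On circles close to the unit circle |U| = |F1 / F2| is at most 1 / (1 -
    eta). *)
Lemma inner_quotient_le1 F1 F2 U : inner_bdry F1 -> inner_bdry F2 -> holo D U ->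
  (forall x, D x -> F1 x = F2 x * U x) -> forall x, D x -> cmod (U x) <= 1.
Proof.
move=> [F11 _] [_ F2b] hU E x Dx; apply/ler_addgt0Pr => e e0.
have K0 : 0 < cmod (U x) + e by rewrite ltr_wpDl// cmod_ge0.
(* Chosen so that 1 / (1 - eta) = (|U x| + e) / |U x|; letting e tend to 0 then
   gives |U x| <= 1. *)
pose eta := e / (cmod (U x) + e).
have et0 : 0 < eta by rewrite divr_gt0.
have [Ux0|Ux0] := eqVneq (cmod (U x)) 0; first by rewrite Ux0; lra.
have Up : 0 < cmod (U x) by rewrite lt_def Ux0 cmod_ge0.
have et1 : eta < 1 by rewrite /eta ltr_pdivrMr// mul1r; lra.
have [rho rho1 rP] := F2b _ et0.
have /discP x1 := Dx.
pose m := Num.max (cmod x) (Num.max rho 0).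
have m1 : m < 1 by rewrite !gt_max x1 rho1 ltr01.
pose r := (m + 1) / 2.
have mr : m < r by rewrite /r; lra.
have r1 : r < 1 by rewrite /r; lra.
have mrho : rho <= m by rewrite !le_max lexx orbT.
have m0 : 0 <= m by rewrite !le_max lexx !orbT.
have mx : cmod x <= m by rewrite le_max lexx.
have inD z : cmod (z - 0) <= r -> D z.
  by rewrite subr0 => zr; apply/discP; exact: le_lt_trans r1.
have : cmod (U x) <= (1 - eta)^-1.
  apply: (@max_principle _ U 0 r _ [::]).
  - exact: le_lt_trans mr.
  - by move=> z /inD; exact: holo_ctn.
  - by move=> z zr _; apply/hU/inD; exact: ltW.
  - move=> z zr; have Dz : D z by apply: inD; rewrite zr.
    have h : 1 - eta <= cmod (F2 z).
      by apply: rP => //; rewrite subr0 in zr; rewrite zr (le_lt_trans mrho).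
    have := F11 z Dz; rewrite E// cmodM => h2.
    rewrite -[leRHS]mul1r ler_pdivlMr ?subr_gt0// (le_trans _ h2)// mulrC.
    by rewrite ler_wpM2r ?cmod_ge0.
  - by rewrite subr0 (le_trans mx)// ltW.
have -> : (1 - eta)^-1 = (cmod (U x) + e) / cmod (U x).
  by rewrite /eta; field; rewrite Ux0 gt_eqF//= addrK.
by rewrite ler_pdivlMr// => H; rewrite -(ler_pM2r Up); nra.
Qed.

(** A non-zero derivative at z would allow a step from z in the direction in
    which |U| increases at first order. *)
Lemma unimodular_cst U : holo D U -> (forall x, D x -> cmod (U x) = 1) ->
  forall x y, D x -> D y -> U x = U y.
Proof.
move=> hU U1; apply: cderiv0_cst disc_region _ => z Dz.
have [l dl] := hU z Dz; have [l0|l0] := eqVneq l 0; first by rewrite -l0.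
exfalso; move/cderivP: dl => dl.
have nl : 0 < cmod l by rewrite cmod_gt0.
have [d d0 dP] := dl _ (divr_gt0 nl (ltr0Sn _ 1)).
have [r r0 rD] := disc_region.1 z Dz.
pose m := Num.min d r; have m0 : 0 < m by rewrite lt_min d0.
pose t := m * cmod l / 2.
have t0 : 0 < t by rewrite !divr_gt0// mulr_gt0.
(* A step from z along which U grows, to first order, by the factor 1 + t. *)
pose x := z + rc t * U z / l.
have xz : cmod (x - z) = t / cmod l.
  by rewrite /x addrAC subrr add0r !cmodM cmodV U1// cmod_rc gtr0_norm// mulr1.
have : cmod (x - z) < m by rewrite xz /t ltr_pdivrMr//; have := mulr_gt0 m0 nl; lra.
rewrite lt_min => /andP[/dP h /rD Dx].
have := U1 x Dx; apply/eqP; rewrite gt_eqF//.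
have E : l * (x - z) = rc t * U z by rewrite /x; field.
rewrite E xz in h.
have h1 : cmod (U z + rc t * U z) = 1 + t.
  by rewrite -[X in X + _]mul1r -mulrDl cmodM U1// mulr1 -rc1 -rcD cmod_rc gtr0_norm//; lra.
have := cmod_lB (U z + rc t * U z) (U x); rewrite h1 cmodB.
rewrite (_ : U x - (U z + _) = U x - U z - rc t * U z); last by ring.
have E2 : cmod l / 2 * (t / cmod l) = t / 2 by field; rewrite gt_eqF.
rewrite E2 in h; lra.
Qed.

Lemma conjE z : z^* = cj z. Proof. by case: z. Qed.

Lemma blaschke_den z x : D z -> D x -> 1 - cmod z <= cmod (1 - cj z * x).
Proof.
move=> /discP z1 /discP x1; have := cmod_lB 1 (cj z * x).
rewrite cmod1 cmodM cmod_cj; have := cmod_ge0 z; have := cmod_ge0 x; nra.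
Qed.

Lemma blaschke_den0 z x : D z -> D x -> 1 - cj z * x != 0.
Proof.
move=> Dz Dx; rewrite -cmod_gt0 (lt_le_trans _ (blaschke_den Dz Dx))//.
by rewrite subr_gt0; apply/discP.
Qed.

Lemma blaschke_factorE z x : z != 0 ->
  Blaschke_factor z x = rc (cmod z) / z * ((z - x) / (1 - cj z * x)).
Proof. by move=> z0; rewrite /Blaschke_factor (negbTE z0) cmodE conjE. Qed.

(** This identity shows both that the factor has modulus at most 1 and how fast
    its modulus tends to 1. *)
Lemma blaschke_sqr z x : D z -> D x -> z != 0 ->
  1 - cmod (Blaschke_factor z x) ^+ 2 =
    (1 - cmod z ^+ 2) * (1 - cmod x ^+ 2) / cmod (1 - cj z * x) ^+ 2.
Proof.
move=> Dz Dx z0; rewrite blaschke_factorE//.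
have nz : cmod z != 0 by rewrite cmod_eq0.
have nd : cmod (1 - cj z * x) != 0 by rewrite cmod_eq0 blaschke_den0.
rewrite !cmodM !cmodV cmod_rc ger0_norm ?cmod_ge0// divff// mul1r expr_div_n.
apply: (mulIf (expf_neq0 2 nd)); rewrite mulrBl !divfK ?expf_neq0// mul1r.
by rewrite !cmod_sqr !rimE; ring.
Qed.

Lemma blaschke_inner z : D z -> inner_bdry (Blaschke_factor z).
Proof.
move=> Dz; have [->|z0] := eqVneq z 0.
  split=> [x /discP x1|e e0]; first by rewrite /Blaschke_factor eqxx ltW.
  exists (1 - e); first by lra.
  by move=> x xe _; rewrite /Blaschke_factor eqxx ltW.
have /discP z1 := Dz; have zge := cmod_ge0 z.
have B1 x : D x -> cmod (Blaschke_factor z x) <= 1.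
  move=> Dx; rewrite -(@ler_pXn2r _ 2) ?nnegrE ?cmod_ge0// expr1n -subr_ge0.
  have /discP x1 := Dx; have xge := cmod_ge0 x.
  by rewrite blaschke_sqr// divr_ge0 ?sqr_ge0// mulr_ge0// subr_ge0 expr_le1// ltW.
split=> // e e0; exists (1 - e * (1 - cmod z) / 4).
  by rewrite ltrBlDr ltrDl divr_gt0// mulr_gt0// subr_gt0.
move=> x xe Dx; have := B1 x Dx; set b := cmod (Blaschke_factor z x) => b1.
have b0 : 0 <= b := cmod_ge0 _; have /discP x1 := Dx; have xge := cmod_ge0 x.
suff : 1 - b ^+ 2 <= e by rewrite expr2; nra.
rewrite blaschke_sqr//.
have dn := blaschke_den Dz Dx; have z1' : 0 < 1 - cmod z by rewrite subr_gt0.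
have dp : 0 < cmod (1 - cj z * x) by rewrite (lt_le_trans z1').
rewrite ler_pdivrMr ?exprn_gt0//.
apply: (@le_trans _ _ (e * (1 - cmod z) ^+ 2)); last first.
  by rewrite ler_pM2l// ler_pXn2r ?nnegrE// ltW.
have x2 : 1 - cmod x ^+ 2 <= 2 * (1 - cmod x) by rewrite expr2; nra.
have x3 : 2 * (1 - cmod x) <= e * (1 - cmod z) / 2 by lra.
have z2 : 1 - cmod z ^+ 2 <= 2 * (1 - cmod z) by rewrite expr2; nra.
have z3 : 0 <= 1 - cmod z ^+ 2 by rewrite subr_ge0 expr_le1// ltW.
rewrite (le_trans (ler_wpM2l z3 (le_trans x2 x3)))//.
have q0 : 0 <= e * (1 - cmod z) / 2 by rewrite divr_ge0 ?mulr_ge0// ltW.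
rewrite (le_trans (ler_wpM2r q0 z2))// expr2; lra.
Qed.

(** A Blaschke factor is x - z up to a zero-free factor, so that dividing by
    linear factors and by Blaschke factors is the same. *)
Lemma blaschke_unit z : D z -> exists c, [/\ holo D c, forall x, D x -> c x != 0 &
  forall x, D x -> x - z = c x * Blaschke_factor z x].
Proof.
move=> Dz; have [->|z0] := eqVneq z 0.
  exists (fun=> 1); split=> [x _|x _|x _].
  - by exists 0; exact: cderiv_cst.
  - exact: oner_neq0.
  - by rewrite /Blaschke_factor eqxx mul1r subr0.
have nz : rc (cmod z) != 0 by rewrite rc_eq0 cmod_eq0.
exists (fun x => - (z / rc (cmod z)) * (1 - cj z * x)); split=> x Dx.
- by eexists; apply: cderivMl (cderivB (cderiv_cst 1 x) (cderivMl (cj z) (cderiv_id x))).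
- by rewrite mulf_neq0 ?blaschke_den0// oppr_eq0 mulf_neq0// invr_eq0.
- have := blaschke_den0 Dz Dx; rewrite blaschke_factorE// => d0; field.
  by rewrite nz d0 z0.
Qed.

Lemma blaschke_prod_unit zs : (forall z, z \in zs -> D z) ->
  inner_bdry (fun x => \prod_(z <- zs) Blaschke_factor z x) /\
  exists c, [/\ holo D c, forall x, D x -> c x != 0 &
  forall x, D x -> \prod_(z <- zs) (x - z) = c x * \prod_(z <- zs) Blaschke_factor z x].
Proof.
elim: zs => [_|z zs IH zD].
  split.
    apply: inner_bdry_ext (_ : inner_bdry (fun=> 1)); first by move=> x _; rewrite big_nil.
    split=> [x _|e e0]; first by rewrite cmod1.
    by exists 0 => // x _ _; rewrite cmod1; lra.
  exists (fun=> 1); split=> [x _|x _|x _]; last by rewrite !big_nil mul1r.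
    by exists 0; exact: cderiv_cst.
  exact: oner_neq0.
have [|Ib [c [hc c0 cE]]] := IH; first by move=> y yzs; apply: zD; rewrite inE yzs orbT.
have Dz : D z by apply: zD; rewrite inE eqxx.
have [b [hb b0 bE]] := blaschke_unit Dz.
split.
  by apply: inner_bdry_ext (inner_bdryM (blaschke_inner Dz) Ib) => x _; rewrite big_cons.
exists (fun x => b x * c x); split=> x Dx.
- have [l dl] := hb x Dx; have [m dm] := hc x Dx; eexists; exact: cderivM dl dm.
- by rewrite mulf_neq0 ?b0 ?c0.
- by rewrite !big_cons cE// bE// mulrACA.
Qed.

(** The quotient U of g by the Blaschke product of its zeros is zero-free, and
    U and 1 / U are both bounded by 1. *)
Lemma blaschke_of_zeros (g : C -> C) (zs : seq C) : holo D g -> inner_bdry g ->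
  (forall z, z \in zs -> D z) -> (forall z, D z -> order_at g z (count_mem z zs)) ->
  finite_Blaschke (size zs) g.
Proof.
move=> hg bg zD og.
have [u [hu u0 gE]] := factor_zeros disc_region.1 hg zD og.
have [bV [c [hc c0 cE]]] := blaschke_prod_unit zD.
set V := fun x => _ in bV.
pose U x := u x * c x.
have hU : holo D U.
  by move=> x Dx; have [l dl] := hu x Dx; have [m dm] := hc x Dx; eexists; exact: cderivM dl dm.
have U0 x : D x -> U x != 0 by move=> Dx; rewrite mulf_neq0 ?u0 ?c0.
have gVU x : D x -> g x = V x * U x.
  by move=> Dx; rewrite gE cE// /V /U; ring.
have U1 := inner_quotient_le1 bg bV hU gVU.
have U2 : forall x, D x -> cmod ((U x)^-1) <= 1.
  apply: (inner_quotient_le1 bV bg (U := fun x => (U x)^-1)).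
    by move=> x Dx; have [l dl] := hU x Dx; eexists; apply: cderivV dl; exact: U0.
  by move=> x Dx; rewrite gVU// mulfK// U0.
have nU x : D x -> cmod (U x) = 1.
  move=> Dx; apply/eqP; rewrite eq_le U1//=; have := U2 x Dx.
  by rewrite cmodV invf_le1// cmod_gt0 U0.
have [s sE] := expC_surj (U0 0 disc0).
have res : re s = 0 by apply: expR_inj; rewrite -cmod_expC sE nU ?expR0//; exact: disc0.
exists (im s), (fun i => nth 0 zs i); split.
  by move=> i; apply: zD; rewrite mem_nth.
move=> x Dx; rewrite gVU// (unimodular_cst hU nU Dx disc0) -sE /V mulrC.
rewrite (big_nth 0) big_mkord; congr (expC _ * _).
by apply: complex_ext; rewrite ?res.
Qed.

End Blaschke.

(** * Proper maps in a Riemann coordinate *)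

Section RiemannCoordinates.
Variable R : realType.
Notation C := (Cplx R).
Implicit Types (z w : C).
Notation D := (@disc R).

Lemma ctn_within (K : set C) (f : C -> C) : (forall z, K z -> ctn f z) ->
  {within K, continuous f}.
Proof.
by move=> cf; apply: continuous_in_subspaceT => z; rewrite inE => /cf /ctnP.
Qed.

Lemma conformal_inv (A B : set C) (f : C -> C) : conformal_bij A B f ->
  [/\ holo A f, forall x, A x -> B (f x),
      forall x y, A x -> A y -> f x = f y -> x = y &
      exists g, (forall x, A x -> g (f x) = x) /\
                forall y, B y -> A (g y) /\ f (g y) = y].
Proof.
move=> [/holoP hf [fAB fI fS]].
have fI' x y : A x -> A y -> f x = f y -> x = y by move=> Ax Ay; apply: fI; rewrite inE.
have /choice[g gP] : forall y, exists x, B y -> A x /\ f x = y.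
  move=> y; have [/fS[x Ax <-]|nB] := pselect (B y); first by exists x.
  by exists 0.
split=> //; exists g; split=> // x Ax.
by have [Agx /fI' ->] := gP _ (fAB x Ax).
Qed.

Lemma conformal_intro (A B : set C) (f : C -> C) : holo A f ->
  (forall x, A x -> B (f x)) -> (forall x y, A x -> A y -> f x = f y -> x = y) ->
  (forall y, B y -> exists2 x, A x & f x = y) -> conformal_bij A B f.
Proof.
move=> /holoP hf fAB fI fS; split=> //; split=> //.
by move=> x y; rewrite !inE; exact: fI.
Qed.

(** At w the quotient is the derivative of f, which does not vanish as f is
    univalent. *)
Lemma quot_neq0 (A : set C) (f q : C -> C) w : copen A -> holo A f ->
  (forall x y, A x -> A y -> f x = f y -> x = y) ->
  A w -> holo A q -> (forall x, f x = f w + (x - w) * q x) ->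
  forall x, A x -> q x != 0.
Proof.
move=> oA hf fI Aw hq qE x Ax; have [->|xw] := eqVneq x w; last first.
  apply/eqP => qx; have := qE x; rewrite qx mulr0 addr0 => /(fI _ _ Ax Aw).
  exact/eqP.
have [/choice[g gP] _] : (forall y, exists x, (f @` A) y -> A x /\ f x = y) /\ True.
  split=> // y; have [[z Az <-]|nB] := pselect ((f @` A) y); first by exists z.
  by exists 0.
have gf z : A z -> g (f z) = z.
  by move=> Az; have [Ag /fI ->] := gP (f z) (ex_intro2 _ _ z Az erefl).
have [m dm] := hq w Aw.
apply: (univalent_deriv_neq0 (f := f) oA hf fI gf Aw).
apply: cderiv_ext (_ : cderiv (fun x => f w + (x - w) * q x) w _); first by move=> y.
apply: cderiv_eq (cderivD (cderiv_cst _ _) (cderivM (cderivB (cderiv_id w) (cderiv_cst w w)) dm)) _.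
by rewrite /=; ring.
Qed.

Lemma count_mem_nseqs (S T : eqType) (s : seq S) (p : S -> T) (k : S -> nat) y0 :
  uniq s -> {in s &, injective p} -> y0 \in s ->
  count_mem (p y0) (flatten [seq nseq (k y) (p y) | y <- s]) = k y0.
Proof.
elim: s => // x s IH /= /andP[xs us] pI; rewrite inE count_cat count_nseq /=.
have pI' : {in s &, injective p}.
  by move=> a b ia ib; apply: pI; rewrite inE ?ia ?ib orbT.
have [-> _|y0x /= y0s] := eqVneq y0 x.
  rewrite eqxx mul1n -[RHS]addn0; congr addn.
  apply/count_memPn/flatten_mapP => -[y ys]; rewrite mem_nseq => /andP[_ /eqP].
  move=> /pI; rewrite !inE eqxx ys orbT => /(_ isT isT) xy.
  by move: xs; rewrite xy ys.
rewrite IH// (_ : p x == p y0 = false) ?mul0n//.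
apply/negP => /eqP /pI; rewrite !inE eqxx y0s orbT => /(_ isT isT) xy.
by move: y0x; rewrite xy eqxx.
Qed.

Lemma size_nseqs (S T : eqType) (s : seq S) (p : S -> T) (k : S -> nat) :
  size (flatten [seq nseq (k y) (p y) | y <- s]) = (\sum_(y <- s) k y)%N.
Proof.
elim: s => [|x s IH]; first by rewrite big_nil.
by rewrite /= size_cat size_nseq IH big_cons.
Qed.

(** Properness of h says that the set where |g| <= 1 - e is contained in the
    image of a compact subset of G under the continuous inverse of phi, hence
    in a smaller disc. The zeros of g are the points over the preimages of phi
    0 under h; as phi has a non-vanishing derivative, it transports
    multiplicities. *)
Lemma finite_degree_blaschke (h g phi : C -> C) (G : set C) (d : nat) :
  conformal_bij D G phi -> finite_degree h G G d -> holo D g ->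
  (forall z, D z -> D (g z)) -> (forall z, D z -> phi (g z) = h (phi z)) ->
  finite_Blaschke d g.
Proof.
move=> cphi [_ hprop hdeg] hg gD E.
have [hphi phiG phiI [psi [psiK psiG]]] := conformal_inv cphi.
have [_ [_ _ phiS]] := cphi.
have oD := (disc_region R).1; have D0 := disc0 R.
have bg : inner_bdry g.
  split=> [x Dx|e e0]; first by apply/ltW/discP; exact: gD.
  pose B : set C := [set z | cmod (z - 0) <= 1 - e].
  have BD z : B z -> D z by rewrite /B /= subr0 => ze; apply/discP; lra.
  have cK : compact (phi @` B).
    apply: continuous_compact; last exact: closed_disc_compact.
    by apply: ctn_within => z /BD; exact: holo_ctn.
  have KG : phi @` B `<=` G by move=> _ [z /BD Dz <-]; exact: phiG.
  have := hprop _ cK KG; set X := G `&` _ => cX.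
  have cY : compact (psi @` X).
    apply: continuous_compact => //; apply: ctn_within => y [Gy _].
    have [Dp <-] := psiG y Gy; exact: (univalent_inv_ctn oD hphi phiI psiK).
  have YD y : (psi @` X) y -> D y by move=> [x [/psiG[Dp _] _] <-].
  have inY x : D x -> cmod (g x) < 1 - e -> (psi @` X) x.
    move=> Dx gx; exists (phi x); last exact: psiK.
    split; first exact: phiG.
    by exists (g x); [rewrite /B /= subr0 ltW|exact: E].
  have [Y0|Y0] := pselect (psi @` X !=set0); last first.
    exists 0 => // x _ Dx; rewrite leNgt; apply/negP => /(inY x Dx) h1.
    by apply: Y0; exists x.
  have [x0 Yx0 x0P] := sup_cmod Y0 cY (fun z _ => ctn_id z).
  exists (cmod x0); first exact/discP/YD.
  move=> x xx0 Dx; rewrite leNgt; apply/negP => /(inY x Dx)/x0P.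
  by rewrite leNgt xx0.
have [s [k [us sP sk sd]]] := hdeg (phi 0) (phiG 0 D0).
have psiI : {in s &, injective psi}.
  move=> a b /sP[Ga _] /sP[Gb _] pab.
  by rewrite -(psiG a Ga).2 pab (psiG b Gb).2.
rewrite -sd -(size_nseqs s psi k); apply: blaschke_of_zeros => //.
  move=> z /flatten_mapP[y /sP[/psiG[Dy _] _]]; rewrite mem_nseq => /andP[_ /eqP ->].
  exact: Dy.
move=> x Dx; have [gx|gx] := eqVneq (g x) 0; last first.
  have -> : count_mem x (flatten [seq nseq (k y) (psi y) | y <- s]) = 0%N.
    apply/count_memPn/flatten_mapP => -[y /sP[/psiG[Dy yE] hy]].
    rewrite mem_nseq => /andP[_ /eqP xE]; move/eqP: gx; apply.
    by apply: phiI => //; [exact: gD|rewrite E// xE yE].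
  exists g; split=> //; have [r r0 rD] := oD x Dx.
  by exists r => // y /rD Dy; rewrite expr0 mul1r; split=> //; exact: hg.
have xs : phi x \in s by apply/sP; split; [exact: phiG|rewrite -E// gx].
rewrite -[in count_mem x](psiK x Dx) count_mem_nseqs//.
have [q [N [/= [oN Nx] hq q0 qE]]] := sk _ xs.
move/copenP: oN => oN; have [r r0 rN] := oN _ Nx; move/holoP: hq => hq.
have [q0f hq0 q0E] := holo_quot oD hphi D0.
have q0n := quot_neq0 oD hphi phiI D0 hq0 q0E.
have [qx hqx qxE] := holo_quot oD hphi Dx.
have qxn := quot_neq0 oD hphi phiI Dx hqx qxE.
have cphix := holo_ctn hphi Dx.
have [r1 r10 r1P] := cphix r r0; have [r2 r20 r2D] := oD x Dx.
have key t : D t -> N (phi t) -> g t = (t - x) ^+ k (phi x) *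
    (qx t ^+ k (phi x) * q (phi t) / q0f (g t)).
  move=> Dt Nt; have n0 := q0n _ (gD t Dt).
  apply: (mulIf n0); rewrite mulrA divfK// mulrA -exprMn.
  have e1 : phi t - phi x = (t - x) * qx t by rewrite {1}(qxE t) addrAC subrr add0r.
  rewrite -e1 -(qE _ Nt) -!E// gx [in phi (g t)]q0E subr0.
  by rewrite addrAC subrr add0r.
exists (fun t => qx t ^+ k (phi x) * q (phi t) / q0f (g t)); split.
  by rewrite !mulf_neq0 ?expf_neq0 ?qxn ?invr_eq0 ?q0n//; exact: gD.
exists (Num.min r1 r2); first by rewrite lt_min r10.
move=> t; rewrite lt_min => /andP[/r1P /rN Nt /r2D Dt]; split; last exact: key.
have [l1 d1] := hqx t Dt; have [l2 d2] := hphi t Dt; have [l3 d3] := hq _ Nt.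
have [l4 d4] := hg t Dt; have [l5 d5] := hq0 _ (gD t Dt).
eexists; apply: cderiv_div; [exact: q0n (gD t Dt)| |exact: cderiv_comp d4 d5].
exact: cderivM (cderivX _ d1) (cderiv_comp d2 d3).
Qed.

End RiemannCoordinates.

(** * The case of G avoiding 0 *)

Section Avoiding0.
Variable R : realType.
Notation C := (Cplx R).
Implicit Types (z w : C).
Notation D := (@disc R).
Notation ii := (ii R).

Definition period (k : int) : C := ii * rc (pi *+ 2 *~ k).

Lemma expC_periodD (z : C) k : expC (z + period k) = expC z.
Proof. by rewrite expCD expC_period mulr1. Qed.

Lemma expC_inj_period z w : expC z = expC w -> exists k, z = w + period k.
Proof.
move=> zw; have [|k kE] := @expC_eq1 R (z - w).
  by rewrite expCD expCN zw divff// expC_neq0.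
by exists k; rewrite -[period k]kE; ring.
Qed.

Lemma periodD k l : period (k + l) = period k + period l.
Proof. by rewrite /period mulrzDr rcD mulrDr. Qed.

Lemma period_inj : injective period.
Proof.
move=> k l /(mulfI (ii_neq0 R))/rc_inj/eqP.
by rewrite -!(mulrzr (pi *+ 2)) (inj_eq (mulfI _)) ?eqr_int => [/eqP//|];
  rewrite gt_eqF// pmulrn_lgt0// pi_gt0.
Qed.

(** The difference of F and G has derivative 0, because the exponential of the
    difference is constant. *)
Lemma log_uniq (A : set C) (F G : C -> C) : region A -> A !=set0 -> holo A F ->
  holo A G -> (forall z, A z -> expC (F z) = expC (G z)) ->
  exists k, forall z, A z -> F z = G z + period k.
Proof.
move=> rA [z0 Az0] hF hG E.
have [k kE] := expC_inj_period (E z0 Az0); exists k => z Az.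
have FG : F z - G z = F z0 - G z0.
  apply: (cderiv0_cst (F := fun z => F z - G z) rA) => // y Ay.
  have [l dl] := hF y Ay; have [m dm] := hG y Ay.
  apply: cderiv_eq (cderivB dl dm) _.
  have d1 := cderiv_comp (cderivB dl dm) (cderiv_expC _).
  have d0 : cderiv (fun x => expC (F x - G x)) y 0.
    apply: cderiv_near (cderiv_cst 1 y); have [r r0 rP] := rA.1 y Ay.
    by exists r => // x /rP Ax; rewrite expCD expCN E// divff// expC_neq0.
  by have /eqP := cderiv_uniq d1 d0; rewrite mulf_eq0 (negbTE (expC_neq0 _)) => /eqP.
by rewrite -[LHS](subrK (G z)) FG kE; ring.
Qed.

(** A region is the union of its segments from one of its points. *)
Lemma region_connected (A : set C) : region A -> connected A.
Proof.
move=> rA; have [[p Ap]|A0] := pselect (A !=set0); last first.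
  have -> : A = set0 by apply/seteqP; split=> // x Ax; case: A0; exists x.
  exact: connected0.
rewrite (_ : A = \bigcup_(y in A) (on_seg p y @` `[0, 1])).
  apply: bigcup_connected.
    exists p => y Ay; exists 0; first by rewrite /= in_itv /= lexx ler01.
    by rewrite /on_seg rc0 mul0r addr0.
  move=> y Ay; apply: connected_continuous_connected; first exact: segment_connected.
  apply: continuous_subspaceT => t P /nbhs_cmodP[e e0 eP].
  have K0 : 0 < cmod (y - p) + 1 by rewrite ltr_wpDl// cmod_ge0.
  apply/nbhs_ballP; exists (e / (cmod (y - p) + 1)) => /=; first by rewrite divr_gt0.
  move=> s; rewrite /ball /= distrC => st; apply: eP.
  rewrite /on_seg (_ : _ - _ = rc (s - t) * (y - p)); last by rewrite rcB; ring.
  rewrite cmodM cmod_rc (le_lt_trans (_ : _ <= `|s - t| * (cmod (y - p) + 1)))//.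
    by rewrite ler_wpM2l// lerDl.
  by rewrite -ltr_pdivlMr.
apply/seteqP; split=> [y Ay|y [x Ax [t]]].
  exists y => //; exists 1; first by rewrite /= in_itv /= lexx ler01.
  by rewrite /on_seg rc1; ring.
by rewrite /= in_itv /= => t01 <-; exact: region_seg t01.
Qed.

Lemma holo_connected (A : set C) (f : C -> C) : region A -> holo A f ->
  connected (f @` A).
Proof.
move=> rA hf; apply: connected_continuous_connected; first exact: region_connected.
by apply: ctn_within => z; exact: holo_ctn.
Qed.

Lemma connected_sub (B P Q : set C) : connected B -> copen P -> copen Q ->
  B `<=` P `|` Q -> (forall x, P x -> Q x -> False) -> (B `&` P) !=set0 -> B `<=` P.
Proof.
move=> cB /copenP oP /copenP oQ BPQ PQ BP0 x Bx.
have BE : B `&` P = B.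
  apply: cB => //; first by exists P.
  exists (~` Q); first exact: open_closedC.
  apply/seteqP; split=> y [By]; first by move=> Py; split=> // Qy; exact: PQ Py Qy.
  by move=> nQ; split=> //; have [] := BPQ y By.
by move: Bx; rewrite -[in X in X -> _]BE => -[].
Qed.

Lemma pi_mapE (a z : C) : pi_map a z = expC (a * z). Proof. by []. Qed.

Lemma holo_entire (a : C) (h f : C -> C) (A : set C) : class_La a h f -> holo A f.
Proof. by move=> [[/holoP hf _] _] z _; exact: hf. Qed.

(** The maps [ph k] are the branches of log phi / a. Their images are open,
    connected and disjoint, so they are the components; comparing logarithms
    gives f o ph k = ph j o gh. *)
Lemma case_avoiding (h f : C -> C) (a : C) (G : set C) (gh : C -> C) :
  a != 0 -> class_La a h f -> dyn_associated_inner h G gh -> ~ G 0 ->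
  exists U : int -> set C, component_indexing a G U /\
    forall k, exists j, associated_inner f (U k) (U j) gh.
Proof.
move=> a0 fL [inn hGG [phi cphi phiE]] G0.
have [hphi phiG phiI [psi [psiK psiG]]] := conformal_inv cphi.
have [hgh ghD _] := inn; move/holoP: hgh => hgh.
have {}ghD z : D z -> D (gh z) by move=> Dz; apply: ghD; exists z.
have rD := disc_region R; have D0 := disc0 R.
have phi0 z : D z -> phi z != 0.
  by move=> Dz; apply/eqP => p0; apply: G0; rewrite -p0; exact: phiG.
have [L hL LE] := holo_log rD hphi phi0.
pose ph k z := (L z + period k) / a.
have hph k : holo D (ph k).
  move=> z /hL[l dl]; eexists.
  exact: cderivM (cderivD dl (cderiv_cst _ _)) (cderiv_cst _ _).
have aph k z : a * ph k z = L z + period k by rewrite /ph; field.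
have pph k z : D z -> pi_map a (ph k z) = phi z.
  by move=> Dz; rewrite pi_mapE aph expC_periodD LE.
(* The shift by the period is invisible to the exponential, so a common value
   of ph k and ph k' has the same coordinate in the disc for both. *)
have phI k k' x y : D x -> D y -> ph k x = ph k' y -> x = y /\ k = k'.
  move=> Dx Dy E; have xy : x = y.
    by apply: phiI => //; rewrite -(pph k)// -(pph k')// E.
  split=> //; apply: period_inj; apply: (addrI (L x)).
  by rewrite -aph E aph xy.
pose U k := ph k @` D.
have Uconf k : conformal_bij D (U k) (ph k).
  apply: conformal_intro => //; first by move=> x Dx; exists x.
  by move=> x y Dx Dy E; have [] := phI k k x y Dx Dy E.
have Uopen k : copen (U k).
  have [_ _ I [g [gK _]]] := conformal_inv (Uconf k).
  exact: (univalent_image_open rD.1 (hph k) I).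
have Udisj k k' x : U k x -> U k' x -> k = k'.
  by move=> [y Dy <-] [y' Dy' /esym E]; have [] := phI _ _ _ _ Dy Dy' E.
pose S := pi_map a @^-1` G.
have US k : U k `<=` S.
  by move=> _ [z Dz <-]; rewrite /S /preimage /= pph//; exact: phiG.
have SU x : S x -> exists k, U k x.
  move=> Sx; have [Dp pE] := psiG _ Sx.
  have [|k kE] := @expC_inj_period (a * x) (L (psi (pi_map a x))).
    by rewrite LE.
  by exists k; exists (psi (pi_map a x)) => //; rewrite /ph -kE; field.
have Ucomp k x : U k x -> connected_component S x = U k.
  move=> Ukx; apply/seteqP; split; last first.
    by apply: connected_component_max => //; exact: holo_connected.
  apply: (@connected_sub _ _ (\bigcup_(j in [set j | j != k]) U j)) => //.
  - exact: component_connected.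
  - by move=> y [j /= jk /Uopen[r r0 rP]]; exists r => // w /rP Ujw; exists j.
  - move=> y /connected_component_sub/SU[j Ujy].
    by have [<-|jk] := eqVneq j k; [left|right; exists j].
  - by move=> y Uky [j /= /eqP jk Ujy]; apply: jk; exact: Udisj Ujy Uky.
  - by exists x; split=> //; apply: connected_component_refl; exact: US Ukx.
exists U; split.
  split.
  - move=> k k' UE; have : U k (ph k 0) by exists 0.
    by move=> /[dup]; rewrite [in X in _ -> X -> _]UE; exact: Udisj.
  - move=> A; split=> [[z Sz ->]|[k ->]].
      by have [k Ukz] := SU z Sz; exists k; exact: Ucomp.
    have U0 : U k (ph k 0) by exists 0.
    by exists (ph k 0); [exact: US U0|rewrite (Ucomp k)].
  - move=> k; have step z : ph (k + 1) z = ph k z + (Complex 0 (pi *+ 2) : C) / a.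
      rewrite (_ : (Complex _ _ : C) = period 1).
        by rewrite /ph periodD; field.
      by apply: complex_ext; rewrite /period !rimE mulr1z; ring.
    apply/seteqP; split=> [_ [z Dz <-]|_ [_ [z Dz <-] <-]].
      by exists (ph k z); [exists z|rewrite step].
    by exists z => //; rewrite step.
move=> k.
have hf : holo D (fun z => a * f (ph k z)).
  move=> z Dz; have [l dl] := hph k z Dz.
  have [m dm] := holo_entire (A := setT) fL (I : setT (ph k z)).
  by eexists; exact: cderivMl (cderiv_comp dl dm).
have hLg : holo D (fun z => L (gh z)).
  move=> z Dz; have [l dl] := hgh z Dz; have [m dm] := hL _ (ghD z Dz).
  by eexists; exact: cderiv_comp dl dm.
have [|j jE] := log_uniq rD (ex_intro _ 0 D0) hf hLg.
  move=> z Dz; rewrite (LE _ (ghD z Dz)) phiE// -(pph k z Dz) -pi_mapE.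
  by have /(_ (ph k z)) := fL.2.
exists j; have fE z : D z -> f (ph k z) = ph j (gh z).
  by move=> Dz; apply: (mulfI a0); rewrite aph -jE.
split=> //.
  by move=> _ [_ [z Dz <-] <-]; rewrite fE//; exists (gh z) => //; exact: ghD.
by exists (ph k), (ph j); split=> // z Dz; rewrite fE.
Qed.

End Avoiding0.

(** * The case of G containing 0 *)

Section Containing0.
Variable R : realType.
Notation C := (Cplx R).
Implicit Types (z w : C).
Notation D := (@disc R).
Notation ii := (ii R).

Definition mobius (p z : C) : C := (z + p) / (1 + cj p * z).

Lemma mobius_den (p z : C) : D p -> D z -> 1 + cj p * z != 0.
Proof.
move=> /discP p1 /discP z1; apply/eqP => E.
have : cmod (cj p * z) = 1.
  by rewrite -cmodN -(cmod1 R); congr cmod; rewrite -[RHS]subr0 -E; ring.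
by rewrite cmodM cmod_cj; have := cmod_ge0 p; have := cmod_ge0 z; nra.
Qed.

Lemma mobius_disc (p z : C) : D p -> D z -> D (mobius p z).
Proof.
move=> Dp Dz; have d0 := mobius_den Dp Dz.
move/discP: Dp => p1; move/discP: Dz => z1; apply/discP.
rewrite /mobius cmodM cmodV ltr_pdivrMr ?cmod_gt0// mul1r.
rewrite -(@ltr_pXn2r _ 2) ?nnegrE ?cmod_ge0// -subr_gt0.
have -> : cmod (1 + cj p * z) ^+ 2 - cmod (z + p) ^+ 2 = (1 - cmod p ^+ 2) * (1 - cmod z ^+ 2).
  by rewrite !cmod_sqr !rimE; ring.
by rewrite mulr_gt0// subr_gt0 expr_lt1// cmod_ge0.
Qed.

Lemma mobius_holo (p : C) : D p -> holo D (mobius p).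
Proof.
move=> Dp z Dz; eexists; apply: cderiv_div; first exact: mobius_den Dp Dz.
  exact: cderivD (cderiv_id z) (cderiv_cst p z).
exact: cderivD (cderiv_cst 1 z) (cderivMl (cj p) (cderiv_id z)).
Qed.

Lemma disc_opp (p : C) : D p -> D (- p).
Proof. by move=> /discP ?; apply/discP; rewrite cmodN. Qed.

Lemma cj_opp (p : C) : cj (- p) = - cj p.
Proof. by apply: complex_ext; rewrite !rimE. Qed.

Lemma mobiusK (p z : C) : D p -> D z -> mobius (- p) (mobius p z) = z.
Proof.
move=> Dp Dz; have d1 := mobius_den Dp Dz.
have := mobius_den (disc_opp Dp) (mobius_disc Dp Dz).
have := mobius_den (disc_opp Dp) Dp.
rewrite /mobius cj_opp => n0 n1; field.
rewrite d1 /=.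
have E : (1 + - cj p * ((z + p) / (1 + cj p * z))) * (1 + cj p * z) = 1 - cj p * p by field.
have := mulf_neq0 n1 d1; rewrite E; apply: contra_neq => H.
by rewrite -H; ring.
Qed.

Notation Hp := [set s : C | re s < 0].

(** An involution that exchanges the disc and the left half-plane. *)
Definition cayley z : C := (z + 1) / (z - 1).

Lemma cayley_half z : D z -> re (cayley z) < 0.
Proof.
move=> /discP z1; have z10 : z - 1 != 0.
  by rewrite subr_eq0; apply: contraTneq z1 => ->; rewrite cmod1 ltxx.
have n0 : 0 < cmod (z - 1) ^+ 2 by rewrite exprn_gt0// cmod_gt0.
have E : cayley z = (z + 1) * cj (z - 1) * rc (cmod (z - 1) ^- 2).
  by rewrite /cayley rcV -cjM; field; rewrite -cmod_eq0 cmod_cj cmod_eq0 z10.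
rewrite E reM im_rc mulr0 subr0 re_rc pmulr_llt0 ?invr_gt0//.
have -> : re ((z + 1) * cj (z - 1)) = cmod z ^+ 2 - 1 by rewrite cmod_sqr !rimE; ring.
by rewrite subr_lt0 expr_lt1// cmod_ge0.
Qed.

Lemma cayley_disc z : re z < 0 -> D (cayley z).
Proof.
move=> rz; have z10 : z - 1 != 0.
  by apply: contraTneq rz => /eqP; rewrite subr_eq0 => /eqP ->; rewrite re1 -leNgt.
apply/discP; rewrite /cayley cmodM cmodV ltr_pdivrMr ?cmod_gt0// mul1r.
rewrite -(@ltr_pXn2r _ 2) ?nnegrE ?cmod_ge0// !cmod_sqr !rimE; lra.
Qed.

Lemma cayleyK z : z != 1 -> cayley (cayley z) = z.
Proof.
move=> z1; have z10 : z - 1 != 0 by rewrite subr_eq0.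
have n2 : (2 : C) != 0 by rewrite pnatr_eq0.
have e1 : (z + 1) / (z - 1) + 1 = 2 * z / (z - 1) by field.
have e2 : (z + 1) / (z - 1) - 1 = 2 / (z - 1) by field.
by rewrite /cayley e1 e2; field; rewrite z10 ?n2.
Qed.

Lemma disc_neq1 z : D z -> z != 1.
Proof. by move=> /discP; apply: contraTneq => ->; rewrite cmod1 ltxx. Qed.

Lemma half_neq1 z : re z < 0 -> z != 1.
Proof. by apply: contraTneq => ->; rewrite re1 -leNgt. Qed.

Lemma cayley_holo z : z != 1 -> exists l, cderiv cayley z l.
Proof.
move=> z1; eexists; apply: cderiv_div; first by rewrite subr_eq0.
  exact: cderivD (cderiv_id z) (cderiv_cst 1 z).
exact: cderivB (cderiv_id z) (cderiv_cst 1 z).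
Qed.

(** For d > 0 and real c this is an automorphism of the left half-plane. *)
Definition dilation (d : nat) (c : R) (s : C) : C := d%:R * s + ii * rc c.

(** The fraction with numerator [auto_num] and denominator [auto_den] is, for d
    > 0, the disc automorphism conjugate to [dilation] under the Cayley map. In
    this form it makes sense at 1 too and is seen to be continuous on the
    closed disc. *)
Definition auto_num (d : nat) (c : R) z : C :=
  (d%:R + 1 + ii * rc c) * z + (d%:R - 1 - ii * rc c).
Definition auto_den (d : nat) (c : R) z : C :=
  (d%:R - 1 + ii * rc c) * z + (d%:R + 1 - ii * rc c).

Lemma re_dilation d c s : re (dilation d c s) = d%:R * re s.
Proof. by rewrite /dilation -(rc_nat R d) !rimE; ring. Qed.

Lemma auto_den_neq0 d c z : (0 < d)%N -> cmod z <= 1 -> auto_den d c z != 0.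
Proof.
move=> d0 z1; apply/eqP => E.
have dp : 0 < d%:R :> R by rewrite ltr0n.
pose u : C := d%:R - 1 + ii * rc c; pose v : C := d%:R + 1 - ii * rc c.
have uv : cmod u ^+ 2 < cmod v ^+ 2.
  rewrite -subr_gt0 (_ : _ - _ = 4 * d%:R) ?mulr_gt0//.
  by rewrite !cmod_sqr /u /v -(rc_nat R d) !rimE; ring.
have : cmod v = cmod u * cmod z.
  by rewrite -cmodM -cmodN; congr cmod; rewrite -[RHS]subr0 -E /auto_den -/u -/v; ring.
move=> vE; have : cmod v <= cmod u by rewrite vE ler_piMr// cmod_ge0.
by rewrite -(@ler_pXn2r _ 2) ?nnegrE ?cmod_ge0// leNgt uv.
Qed.

(** On the unit circle the denominator is z times the conjugate of the
    numerator. *)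
Lemma auto_cmod d c z : cmod z = 1 -> cmod (auto_num d c z) = cmod (auto_den d c z).
Proof.
move=> z1; rewrite -(cmod_cj (auto_num d c z)) -[LHS]mul1r -z1 -cmodM; congr cmod.
have zz : z * cj z = 1 by rewrite cjM z1 expr1n.
have cE : cj (auto_num d c z) = (d%:R + 1 - ii * rc c) * cj z + (d%:R - 1 + ii * rc c).
  by apply: complex_ext; rewrite /auto_num -(rc_nat R d) !rimE; ring.
rewrite cE mulrDr mulrCA zz /auto_den; ring.
Qed.

Lemma auto_cayley d c z : D z ->
  auto_num d c z / auto_den d c z = cayley (dilation d c (cayley z)).
Proof.
move=> Dz; have z1 := disc_neq1 Dz; have z10 : z - 1 != 0 by rewrite subr_eq0.
have n2 : (2 : C) != 0 by rewrite pnatr_eq0.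
have E1 : auto_num d c z = (dilation d c (cayley z) + 1) * (z - 1).
  by rewrite /auto_num /dilation /cayley; field.
have E2 : auto_den d c z = (dilation d c (cayley z) - 1) * (z - 1).
  by rewrite /auto_den /dilation /cayley; field.
by rewrite E1 E2 /(cayley (dilation _ _ _)) invfM mulrACA divff// mulr1.
Qed.

Lemma dilation_inj d c s s' : (0 < d)%N -> dilation d c s = dilation d c s' -> s = s'.
Proof.
move=> d0; rewrite /dilation => /addIr/mulfI; apply.
by rewrite pnatr_eq0 -lt0n.
Qed.

Lemma auto_conformal d c : (0 < d)%N ->
  conformal_bij D D (fun z => auto_num d c z / auto_den d c z).
Proof.
move=> d0; have dp : 0 < d%:R :> R by rewrite ltr0n.
have dC : (d%:R : C) != 0 by rewrite pnatr_eq0 -lt0n.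
have Hd s : re s < 0 -> re (dilation d c s) < 0.
  by move=> s0; rewrite re_dilation pmulr_rlt0.
apply: conformal_intro.
- move=> z /discP z1; eexists; apply: cderiv_div; first exact: auto_den_neq0 (ltW z1).
    exact: cderivD (cderivMl _ (cderiv_id z)) (cderiv_cst _ z).
  exact: cderivD (cderivMl _ (cderiv_id z)) (cderiv_cst _ z).
- by move=> z Dz; rewrite auto_cayley//; apply/cayley_disc/Hd/cayley_half.
- move=> x y Dx Dy; rewrite !auto_cayley// => /(congr1 cayley).
  rewrite !cayleyK ?half_neq1 ?Hd ?cayley_half// => /(dilation_inj d0)/(congr1 cayley).
  by rewrite !cayleyK ?disc_neq1.
- move=> y Dy; pose s : C := (cayley y - ii * rc c) / d%:R.
  have sE : dilation d c s = cayley y by rewrite /dilation /s; field.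
  have s0 : re s < 0.
    by have := cayley_half Dy; rewrite -sE re_dilation pmulr_rlt0.
  exists (cayley s); first exact: cayley_disc.
  rewrite auto_cayley; last exact: cayley_disc.
  by rewrite cayleyK ?half_neq1// sE cayleyK// disc_neq1.
Qed.

Lemma auto_inner d c : (0 < d)%N ->
  inner_function (fun z => auto_num d c z / auto_den d c z).
Proof.
move=> d0; have [hg gD _ _] := conformal_inv (auto_conformal c d0).
split; first exact/holoP.
  by move=> _ [z Dz <-]; exact: gD.
apply: aeW => t; pose zeta : C := expC (Complex 0 t).
have z1 : cmod zeta = 1 by rewrite cmod_expC expR0.
have dn := @auto_den_neq0 d c zeta d0 ltac:(by rewrite z1).
exists (auto_num d c zeta / auto_den d c zeta).
  by rewrite cmodE cmodM cmodV auto_cmod// divff ?cmod_eq0.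
have cg : ctn (fun z => auto_num d c z / auto_den d c z) zeta.
  apply: cderiv_ctn; apply: cderiv_div; first exact: dn.
    exact: cderivD (cderivMl _ (cderiv_id zeta)) (cderiv_cst _ zeta).
  exact: cderivD (cderivMl _ (cderiv_id zeta)) (cderiv_cst _ zeta).
move=> P /nbhs_cmodP[e e0 eP]; have [r r0 rP] := cg e e0.
rewrite /fmap /= /at_left /within /=; apply/nbhs_ballP; exists r => // x.
rewrite /ball /= => x1 _; apply: eP; apply: rP.
rewrite (_ : _ - zeta = rc (x - 1) * zeta); last first.
  by rewrite rcB rc1 mulrBl mul1r.
by rewrite cmodM z1 mulr1 cmod_rc distrC.
Qed.

(** Each zero b n of the product is a zero of g. *)
Lemma blaschke_one_zero (g : C -> C) (d : nat) : finite_Blaschke d g ->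
  (forall z, D z -> g z = 0 -> z = 0) ->
  exists t : R, forall z, D z -> g z = expC (ii * rc t) * z ^+ d.
Proof.
move=> [t [b [bD gE]]] g0; exists t => z Dz; rewrite gE//.
have b0 n : b n = 0.
  apply: g0; first exact: bD.
  rewrite gE; last exact: bD.
  rewrite (bigD1 n)//= (_ : Blaschke_factor (b n) (b n) = 0) ?mul0r ?mulr0//.
  by rewrite /Blaschke_factor; case: eqVneq => // _; rewrite subrr mul0r mulr0.
congr (expC _ * _); first by apply: complex_ext; rewrite !rimE; ring.
rewrite (eq_bigr (fun=> z)); last by move=> n _; rewrite b0 /Blaschke_factor eqxx.
by rewrite prodr_const card_ord.
Qed.

(** The preimage of G is uniformized by the left half-plane through [Phi], in
    which f is the affine map [dilation d c]. *)
Lemma case_containing (h f : C -> C) (a : C) (G : set C) (d : nat) (gh : C -> C) :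
  class_L h -> a != 0 -> class_La a h f -> finite_degree h G G d ->
  dyn_associated_inner h G gh -> G 0 ->
  [/\ connected (pi_map a @^-1` G),
        univalent_on (pi_map a @^-1` G) f &
        exists gf : C -> C,
          dyn_associated_inner f (pi_map a @^-1` G) gf /\ conformal_bij D D gf].
Proof.
move=> [_ h0] a0 fL hdeg [[/holoP hgh ghD _] hGG [phi cphi phiE]] G0.
have {}ghD z : D z -> D (gh z) by move=> Dz; apply: ghD; exists z.
have rD := disc_region R; have D0 := disc0 R.
have [hphi phiG phiI [psi [psiK psiG]]] := conformal_inv cphi.
have [Dp pE] := psiG 0 G0; set p := psi 0 in Dp pE.
have Dp' := disc_opp Dp.
have MK z : D z -> mobius p (mobius (- p) z) = z.
  by move=> Dz; have := mobiusK Dp' Dz; rewrite opprK.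
have MD z : D z -> D (mobius p z) := mobius_disc Dp.
have MD' z : D z -> D (mobius (- p) z) := mobius_disc Dp'.
pose phi0 z := phi (mobius p z).
pose g0 z := mobius (- p) (gh (mobius p z)).
have hphi0 : holo D phi0.
  move=> z Dz; have [l dl] := mobius_holo Dp Dz; have [m dm] := hphi _ (MD z Dz).
  by eexists; exact: cderiv_comp dl dm.
have phi0G z : D z -> G (phi0 z) by move=> /MD/phiG.
have phi0I x y : D x -> D y -> phi0 x = phi0 y -> x = y.
  move=> Dx Dy /(phiI _ _ (MD x Dx) (MD y Dy))/(congr1 (mobius (- p))).
  by rewrite !mobiusK.
have phi0S y : G y -> exists2 x, D x & phi0 x = y.
  move=> /psiG[Dy yE]; exists (mobius (- p) (psi y)); first exact: MD'.
  by rewrite /phi0 MK.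
have cphi0 : conformal_bij D G phi0 by apply: conformal_intro.
have phi00 : phi0 0 = 0 by rewrite /phi0 /mobius mulr0 add0r addr0 divr1.
have hg0 : holo D g0.
  move=> z Dz; have [l dl] := mobius_holo Dp Dz; have [m dm] := hgh _ (MD z Dz).
  have [n dn] := mobius_holo Dp' (ghD _ (MD z Dz)).
  by eexists; exact: cderiv_comp (cderiv_comp dl dm) dn.
have g0D z : D z -> D (g0 z) by move=> /MD/ghD/MD'.
have g0E z : D z -> phi0 (g0 z) = h (phi0 z).
  move=> Dz; rewrite /phi0 /g0 MK; last exact/ghD/MD.
  by rewrite phiE//; exact: MD.
have B := finite_degree_blaschke cphi0 hdeg hg0 g0D g0E.
(* Since h vanishes at most at 0 = phi0 0, the only possible zero of g0 is 0.
   *)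
have [t g0t] := blaschke_one_zero B ltac:(
  move=> z Dz gz; apply: phi0I => //; rewrite phi00; apply/eqP; apply: contraT => /h0;
  by rewrite -g0E// gz phi00 eqxx).
have d0 : (0 < d)%N.
  rewrite lt0n; apply/eqP => dE; have /discP := g0D 0 D0.
  by rewrite g0t// dE expr0 mulr1 cmod_expC !rimE mul0r mulr0 subrr expR0 ltxx.
have dp : 0 < d%:R :> R by rewrite ltr0n.
have [q hq qE] := holo_quot rD.1 hphi0 D0.
have q0 := quot_neq0 rD.1 hphi0 phi0I D0 hq qE.
have [Q hQ QE] := holo_log rD hq q0.
have rH : region Hp := region_halfplane 0.
have expD s : re s < 0 -> D (expC s).
  by move=> s0; apply/discP; rewrite cmod_expC expR_lt1.
pose Phi s := (s + Q (expC s)) / a.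
have aPhi s : a * Phi s = s + Q (expC s) by rewrite /Phi; field.
have Phip s k : Phi (s + period R k) = Phi s + period R k / a.
  by rewrite /Phi expC_periodD; field.
have hPhi : holo Hp Phi.
  move=> s s0; have [l dl] := hQ _ (expD s s0); eexists.
  exact: cderivM (cderivD (cderiv_id s) (cderiv_comp (cderiv_expC s) dl)) (cderiv_cst _ _).
have pPhi s : re s < 0 -> pi_map a (Phi s) = phi0 (expC s).
  move=> s0; rewrite pi_mapE aPhi expCD QE; last exact: expD.
  by rewrite (qE (expC s)) phi00 add0r subr0.
have PhiI s s' : re s < 0 -> re s' < 0 -> Phi s = Phi s' -> s = s'.
  move=> s0 s0' E; have E' : expC s = expC s'.
    by apply: phi0I; [exact: expD|exact: expD|rewrite -!pPhi// E].
  by have := aPhi s; rewrite E aPhi E' => /addIr.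
set S := pi_map a @^-1` G.
have PhiS s : re s < 0 -> S (Phi s).
  by move=> s0; rewrite /S /preimage /= pPhi//; exact/phi0G/expD.
have SPhi x : S x -> exists2 s, re s < 0 & Phi s = x.
  move=> /phi0S[z Dz zE]; have z0 : z != 0.
    by apply: contraTneq (expC_neq0 (a * x)) => z0; rewrite -pi_mapE -zE z0 phi00 eqxx.
  have [s sE] := expC_surj z0.
  have s0 : re s < 0 by rewrite -expR_lt1 -cmod_expC sE; apply/discP.
  have [|k kE] := @expC_inj_period R (a * x) (a * Phi s).
    by rewrite -!pi_mapE pPhi// sE zE.
  exists (s + period R k); first by rewrite reD /period !rimE; lra.
  by apply: (mulfI a0); rewrite Phip kE; field.
have hfPhi : holo Hp (fun s => a * f (Phi s)).
  move=> s s0; have [l dl] := hPhi s s0.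
  have [m dm] := holo_entire (A := setT) fL (I : setT (Phi s)).
  by eexists; exact: cderivMl (cderiv_comp dl dm).
have Td c s : re s < 0 -> re (dilation d c s) < 0.
  by move=> s0; rewrite re_dilation pmulr_rlt0.
have hPhiT : holo Hp (fun s => a * Phi (dilation d t s)).
  move=> s s0; have [m dm] := hPhi _ (Td t s s0).
  by eexists; apply: cderivMl (cderiv_comp (cderivD (cderivMl _ (cderiv_id s)) (cderiv_cst _ s)) dm).
have H0 : Hp !=set0 by exists (-1); suff: re (-1 : C) < 0 by []; rewrite reN re1 ltrN10.
have [|k kE] := log_uniq rH H0 hfPhi hPhiT.
  move=> s s0; rewrite -!pi_mapE pPhi; last exact: Td.
  have /(_ (Phi s)) /= <- := fL.2.
  rewrite pPhi// -g0E; last exact: expD.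
  rewrite g0t; last exact: expD.
  by rewrite /dilation expCD expCMn mulrC.
(* The period k is absorbed in the argument of [Phi], where it acts as a
   translation. *)
pose c : R := t + pi *+ 2 *~ k.
have fPhi s : re s < 0 -> f (Phi s) = Phi (dilation d c s).
  move=> s0; apply: (mulfI a0); rewrite kE//.
  have -> : dilation d c s = dilation d t s + period R k.
    by rewrite /dilation /c /period rcD; ring.
  by rewrite Phip; field.
have hcay : holo D (fun z => Phi (cayley z)).
  move=> z Dz; have [l dl] := cayley_holo (disc_neq1 Dz).
  by have [m dm] := hPhi _ (cayley_half Dz); eexists; exact: cderiv_comp dl dm.
split.
- have -> : S = Phi @` Hp.
    apply/seteqP; split=> [x /SPhi[s s0 <-]|_ [s s0 <-]]; last exact: PhiS.
    by exists s.
  exact: holo_connected.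
- split; first exact/holoP/(holo_entire fL).
  move=> x y; rewrite !inE => /SPhi[s s0 <-] /SPhi[s' s0' <-].
  rewrite !fPhi// => /(PhiI _ _ (Td c s s0) (Td c s' s0'))/(dilation_inj d0).
  by move=> ->.
exists (fun z => auto_num d c z / auto_den d c z); split; last exact: auto_conformal.
split; first exact: auto_inner.
  move=> _ [x /SPhi[s s0 <-] <-]; rewrite fPhi//; exact/PhiS/Td.
exists (fun z => Phi (cayley z)).
  apply: conformal_intro => //.
  - by move=> z /cayley_half; exact: PhiS.
  - move=> x y Dx Dy /(PhiI _ _ (cayley_half Dx) (cayley_half Dy))/(congr1 cayley).
    by rewrite !cayleyK ?disc_neq1.
  - move=> y /SPhi[s s0 <-]; exists (cayley s); first exact: cayley_disc.
    by rewrite cayleyK// half_neq1.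
move=> z Dz; rewrite fPhi ?cayley_half// auto_cayley// cayleyK// half_neq1//.
exact/Td/cayley_half.
Qed.

End Containing0.

Theorem theorem1p4 (R : realType) (h f : Cplx R -> Cplx R) (a : Cplx R)
    (G : set (Cplx R)) (d : nat) (gh : Cplx R -> Cplx R)
    (hL : class_L h) (a_neq0 : a != 0) (fL : class_La a h f)
    (GF : Fatou_component h G) (Ginv : h @` G `<=` G)
    (hdeg : finite_degree h G G d)
    (ghG : dyn_associated_inner h G gh) :
  let case_i :=
    [/\ G 0,
        connected (pi_map a @^-1` G),
        univalent_on (pi_map a @^-1` G) f &
        exists gf : Cplx R -> Cplx R,
          dyn_associated_inner f (pi_map a @^-1` G) gf /\
          conformal_bij (@disc R) (@disc R) gf] in
  let case_ii :=
    [/\ ~ G 0,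
        exists U : int -> set (Cplx R), component_indexing a G U /\
          forall k, exists j, associated_inner f (U k) (U j) gh &
        finite_Blaschke d gh] in
  (case_i \/ case_ii) /\ ~ (case_i /\ case_ii).
Proof.
move=> case_i case_ii; split; last by move=> [[G0 _ _ _] [nG0 _ _]].
have [G0|nG0] := pselect (G 0).
  by left; have [] := case_containing hL a_neq0 fL hdeg ghG G0; split.
right; split=> //; first exact: case_avoiding fL ghG nG0.
have [[hgh ghD _] _ [phi cphi phiE]] := ghG.
apply: finite_degree_blaschke cphi hdeg _ _ phiE; first exact/holoP.
by move=> z Dz; apply: ghD; exists z.
Qed.
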